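(* Let $n>2$ be an integer, let $B^n$ be the open unit ball of $\mathbb{R}^n$, and let $K_h$ be the $H$-harmonic Szegő kernel of $B^n$. For all $x,y\in B^n$, $$K_h(x,y)=\frac{(1-|x|^2)^{n-1}(1-|y|^2)^{n-1}}{(1+|x|^2)^{n-1}(1+|y|^2)^{n-1}}\;X_9\Bigl(n-1,n-1;\tfrac n2;X,Y,Z\Bigr),$$ where $$X=\left(\frac{|x|}{1+|x|^2}\right)^2,\qquad Y=\frac{2\langle x,y\rangle}{(1+|x|^2)(1+|y|^2)},\qquad Z=\left(\frac{|y|}{1+|y|^2}\right)^2 .$$
   Context: $\langle\cdot,\cdot\rangle$ and $|\cdot|$ are the Euclidean scalar product and norm on $\mathbb{R}^n$. $\sigma$ is the surface measure on $\partial B^n$ normalized so that $\sigma(\partial B^n)=1$. The hyperbolic Laplacian on $C^2(B^n)$ is $\Delta_h f(x)=(1-|x|^2)\bigl[(1-|x|^2)\Delta f(x)+2(n-2)\langle x,\nabla f(x)\rangle\bigr]$, where $\Delta$ and $\nabla$ are the Euclidean Laplacian and gradient. A function $f$ on $B^n$ is $H$-harmonic if $\Delta_h f=0$. The Hardy space $\mathcal{H}^2_h(B^n)$ consists of all $H$-harmonic $f$ on $B^n$ with $\|f\|^2:=\sup_{0<r<1}\int_{\partial B^n}|f(r\eta)|^2\,d\sigma(\eta)<\infty$. It is a reproducing kernel Hilbert space. Its reproducing kernel, the Szegő kernel $K_h(x,y)$ on $B^n\times B^n$, is $H$-harmonic in both variables, belongs to $\mathcal{H}^2_h(B^n)$ in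 each variable, and satisfies $f(x)=\lim_{r\to1}\int_{\partial B^n}f(r\eta)\,K_h(x,r\eta)\,d\sigma(\eta)$ for all $x\in B^n$, $f\in\mathcal{H}^2_h(B^n)$. Equivalently (known fact), $K_h(x,y)=\int_{\partial B^n}P_h(\eta,x)P_h(\eta,y)\,d\sigma(\eta)$ with the hyperbolic Poisson kernel $P_h(\eta,x)=\dfrac{(1-|x|^2)^{n-1}}{|x-\eta|^{2(n-1)}}$. $(a)_m=a(a+1)\cdots(a+m-1)$, $(a)_0=1$, is the Pochhammer symbol. $X_9$ is Exton's triple hypergeometric series $$X_9(a,b;c;u,v,w):=\sum_{p=0}^{\infty}\sum_{q=0}^{\infty}\sum_{l=0}^{\infty}\frac{(a)_{2p+q}\,(b)_{2l+q}}{(c)_{p+q+l}\;p!\,q!\,l!}\,u^p v^q w^l .$$ *)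

(* Defs.v *)
From HB Require Import structures.
From mathcomp Require Import all_boot all_order all_algebra.
From mathcomp Require Import all_classical all_reals all_analysis.
From mathcomp Require Import measurable_realfun.

Set Implicit Arguments.
Unset Strict Implicit.
Unset Printing Implicit Defensive.

Import Order.TTheory GRing.Theory Num.Theory.
Import numFieldNormedType.Exports.

Local Open Scope classical_set_scope.
Local Open Scope ring_scope.

(* The library norm on 'rV[R]_n is the sup norm, which gives R^n its usual
   topology; the Euclidean structure is defined here. *)
Definition dotv (R : realType) (n : nat) (x y : 'rV[R]_n) : R :=
  \sum_(i < n) x ord0 i * y ord0 i.

Definition enorm (R : realType) (n : nat) (x : 'rV[R]_n) : R :=
  Num.sqrt (dotv x x).

Definition unit_ball (R : realType) (n : nat) : set 'rV[R]_n :=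
  [set x | enorm x < 1].

Definition unit_sphere (R : realType) (n : nat) : set 'rV[R]_n :=
  [set x | enorm x = 1].

(* The sigma-algebra generated by the coordinates, i.e. the Borel one. *)
Section measurable_rV.
Context {R : realType} (n : nat).

Let coords : 'I_n -> 'rV[R]_n -> measurableTypeR R := fun i x => x ord0 i.

Let rV_set0 : g_sigma_preimage coords set0.
Proof. exact: sigma_algebra0. Qed.

Let rV_setC A : g_sigma_preimage coords A -> g_sigma_preimage coords (~` A).
Proof. exact: sigma_algebraC. Qed.

Let rV_bigcup (F : _^nat) : (forall i, g_sigma_preimage coords (F i)) ->
  g_sigma_preimage coords (\bigcup_i (F i)).
Proof. exact: sigma_algebra_bigcup. Qed.

HB.instance Definition _ := @isMeasurable.Build default_measure_display
  'rV[R]_n (g_sigma_preimage coords) rV_set0 rV_setC rV_bigcup.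

End measurable_rV.

Lemma measurable_coord (R : realType) n (i : 'I_n) :
  measurable_fun setT (fun x : 'rV[R]_n => x ord0 i : measurableTypeR R).
Proof.
move=> _ Y mY; rewrite setTI; apply: sub_sigma_algebra => /=.
rewrite -bigcup_seq/=; exists i => /=; first by rewrite mem_index_enum.
by exists Y => //; rewrite setTI.
Qed.

Lemma measurable_fun_rV d (T : measurableType d) (R : realType) n
    (f : T -> 'rV[R]_n) :
  (forall i, measurable_fun setT (fun t => f t ord0 i : measurableTypeR R)) ->
  measurable_fun setT f.
Proof.
move=> mf _ A mA.
suff /(_ A mA) : @measurable _ 'rV[R]_n `<=` [set B | measurable (f @^-1` B)].
  by rewrite setTI.
apply: smallest_sub.
  split => /=; first by rewrite preimage_set0.
  - by move=> B mB; rewrite setTD preimage_setC; exact: measurableC.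
  - by move=> F mF; rewrite preimage_bigcup; exact: bigcupT_measurable.
rewrite -bigcup_seq/=; apply: bigcup_sub => i _ B [C mC <-] /=.
by rewrite setTI; have := mf i measurableT C mC; rewrite setTI.
Qed.

(* (t, v) |-> (t, v_0, ..., v_(m-1)) *)
Definition cons_rV (R : realType) (m : nat)
    (p : measurableTypeR R * 'rV[R]_m) : 'rV[R]_m.+1 :=
  row_mx (p.1 : R)%:M p.2 : 'rV[R]_(1 + m).

(* Lebesgue measure on R^n: the iterated product of n copies of Lebesgue measure
   on R. *)
Fixpoint lebesgue_rV (R : realType) (n : nat) : set 'rV[R]_n -> \bar R :=
  match n with
  | 0 => dirac (0 : 'rV[R]_0)
  | m.+1 => pushforward (@lebesgue_measure R \x @lebesgue_rV R m)%E
              (@cons_rV R m)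
  end.

Section lebesgue_rV_measure.
Context {R : realType}.

Lemma measurable_cons_rV m : measurable_fun setT (@cons_rV R m).
Proof.
apply: measurable_fun_rV => i.
rewrite /cons_rV; have [j ij|j ij] := @split_ordP 1 m i.
  rewrite (_ : (fun _ => _) = fst); first exact: measurable_fst.
  by apply/funext => p; rewrite ij; apply: etrans (row_mxEl _ _ _ _) _;
    rewrite !ord1 mxE eqxx mulr1n.
rewrite (_ : (fun _ => _) = (fun x : 'rV[R]_m => x ord0 j : measurableTypeR R) \o snd).
  exact: (measurableT_comp (measurable_coord j) measurable_snd).
by apply/funext => p; rewrite ij; exact: row_mxEr.
Qed.

Let uncons m (v : 'rV[R]_m.+1) : measurableTypeR R * 'rV[R]_m :=
  (v ord0 ord0, \row_j v ord0 (lift ord0 j)).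

Let cons_rVK m : cancel (@cons_rV R m) (@uncons m).
Proof.
move=> [t v]; rewrite /uncons; congr pair.
  rewrite (_ : ord0 = lshift m (ord0 : 'I_1)); last exact/val_inj.
  by apply: etrans (row_mxEl _ _ _ _) _; rewrite mxE eqxx.
apply/rowP => j; rewrite mxE (_ : lift (ord0 : 'I_m.+1) j = rshift 1 j); last exact/val_inj.
exact: row_mxEr.
Qed.

Let measurable_uncons m : measurable_fun setT (@uncons m).
Proof.
apply: measurable_fun_pair; first exact: measurable_coord.
apply: measurable_fun_rV => i.
rewrite (_ : (fun _ => _) =
  fun x : 'rV[R]_m.+1 => x ord0 (lift ord0 i) : measurableTypeR R).
  exact: measurable_coord.
by apply/funext => v; rewrite mxE.
Qed.

Let lebesgue_rV_sigma_finite n :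
  {m : {sigma_finite_measure set 'rV[R]_n -> \bar R} |
    (m : set _ -> \bar R) = @lebesgue_rV R n}.
Proof.
elim: n => [|n [m mE]].
  by exists (dirac (0 : 'rV[R]_0)).
have mc := @measurable_cons_rV n.
pose P := (@lebesgue_measure R \x m)%E :
  {measure set (measurableTypeR R * 'rV[R]_n)%type -> \bar R}.
pose mu : {measure set 'rV[R]_n.+1 -> \bar R} :=
  @measure_function_pushforward__canonical__measure_function_Measure
    _ _ _ _ R P (@cons_rV R n) mc.
have sf : sigma_finite setT mu.
  have /sigma_finiteP[F [TF ndF Foo]] := sigma_finiteT (@lebesgue_measure R).
  have /sigma_finiteP[G [TG ndG Goo]] := sigma_finiteT m.
  exists (fun i => @uncons n @^-1` (F i `*` G i)).
    rewrite -preimage_bigcup -[LHS](preimage_setT (@uncons n)); congr (_ @^-1` _).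
    apply/esym; rewrite -subTset => -[x y] _.
    have [i _ Fx] : (\bigcup_i F i) x by rewrite -TF.
    have [j _ Gy] : (\bigcup_i G i) y by rewrite -TG.
    exists (maxn i j) => //; split => /=.
      by move: x Fx; exact/subsetPset/ndF/leq_maxl.
    by move: y Gy; exact/subsetPset/ndG/leq_maxr.
  move=> i; have [mF Fi] := Foo i; have [mG Gi] := Goo i; split.
    rewrite -[X in measurable X]setTI; apply: measurable_uncons => //.
    exact: measurableX.
  rewrite /= /pushforward -comp_preimage.
  rewrite (_ : _ \o _ = id); last by apply/funext => p; exact: cons_rVK.
  by rewrite preimage_id product_measure1E// lte_mul_pinfty// ge0_fin_numE.
pose mm := Measure_isSigmaFinite.Build _ _ _ mu sf.
pose mp : {sigma_finite_measure set 'rV[R]_n.+1 -> \bar R} :=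
  HB.pack (mu : set _ -> \bar R) (Measure.class mu) mm.
by exists mp; rewrite /= -mE.
Qed.

Let lebesgue_rV0 n : @lebesgue_rV R n set0 = 0%E.
Proof. by have [m <-] := lebesgue_rV_sigma_finite n; rewrite measure0. Qed.

Let lebesgue_rV_ge0 n A : (0 <= @lebesgue_rV R n A)%E.
Proof. by have [m <-] := lebesgue_rV_sigma_finite n; exact: measure_ge0. Qed.

Let lebesgue_rV_sigma_additive n : semi_sigma_additive (@lebesgue_rV R n).
Proof.
have [m <-] := lebesgue_rV_sigma_finite n.
exact: measure_semi_sigma_additive.
Qed.

HB.instance Definition _ n := isMeasure.Build _ _ _ (@lebesgue_rV R n)
  (@lebesgue_rV0 n) (@lebesgue_rV_ge0 n) (@lebesgue_rV_sigma_additive n).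

Let lebesgue_rV_sigma_finiteT n : sigma_finite setT (@lebesgue_rV R n).
Proof. by have [m <-] := lebesgue_rV_sigma_finite n; exact: sigma_finiteT. Qed.

HB.instance Definition _ n := Measure_isSigmaFinite.Build _ _ _
  (@lebesgue_rV R n) (@lebesgue_rV_sigma_finiteT n).

End lebesgue_rV_measure.

(* The normalized surface measure of a subset A of the unit sphere, in polar
   coordinates: the proportion of the unit ball lying in the cone over A. *)
Definition sphere_measure (R : realType) (n : nat) (A : set 'rV[R]_n) : \bar R :=
  (lebesgue_rV [set x | [/\ unit_ball x, x != 0%R & A ((enorm x)^-1 *: x)%R]]
     * ((fine (lebesgue_rV (@unit_ball R n)))^-1)%:E)%E.

Section sphere_measure_measure.
Context {R : realType} (n : nat).
Local Notation E := ('rV[R]_n).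
Local Notation cone A :=
  [set x : E | [/\ unit_ball x, x != 0%R & A ((enorm x)^-1 *: x)%R]].

Lemma measurable_enorm :
  measurable_fun setT (@enorm R n : E -> measurableTypeR R).
Proof.
apply: (measurableT_comp (f := @Num.sqrt R : measurableTypeR R -> measurableTypeR R)).
  by apply: continuous_measurable_fun; exact: sqrt_continuous.
apply: measurable_sum => i.
by apply: measurable_funM; exact: measurable_coord.
Qed.

Let measurable_punctured : measurable [set x : E | unit_ball x /\ x != 0].
Proof.
rewrite [X in measurable X](_ : _ = (@enorm R n) @^-1` `]-oo, 1[ `&`
  \bigcup_(i : 'I_n) (fun x : E => x ord0 i : measurableTypeR R) @^-1` ~` [set 0]).
  apply: measurableI.
    rewrite -[X in measurable X]setTI.
    by apply: (measurable_enorm measurableT); exact: measurable_itv.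
  apply: fin_bigcup_measurable => // i _.
  rewrite -[X in measurable X]setTI.
  by apply: (measurable_coord i measurableT); exact: measurableC.
apply/seteqP; split => x /=; rewrite in_itv/= => -[xB].
  move=> x0; split => //; apply: contrapT => nx; case/eqP: x0.
  apply/rowP => i; rewrite mxE; apply: contrapT => xi; apply: nx.
  by exists i.
move=> [i _ /= xi]; split=> //; apply/eqP => x0; apply: xi.
by rewrite x0 mxE.
Qed.

Let measurable_dir : measurable_fun setT (fun x : E => (enorm x)^-1 *: x).
Proof.
apply: measurable_fun_rV => i.
rewrite (_ : (fun _ => _) =
  (fun x : E => powR (enorm x) (-1) * x ord0 i : measurableTypeR R)).
  apply: measurable_funM; last exact: measurable_coord.
  apply: (measurableT_comp (f := (@powR R ^~ (-1)) : measurableTypeR R -> measurableTypeR R)).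
    exact: measurable_powR.
  exact: measurable_enorm.
by apply/funext => x; rewrite mxE powR_inv1// sqrtr_ge0.
Qed.

Let measurable_cone A : measurable A -> measurable (cone A).
Proof.
move=> mA; rewrite [X in measurable X](_ : _ =
  [set x : E | unit_ball x /\ x != 0] `&` (fun x : E => (enorm x)^-1 *: x) @^-1` A).
  apply: measurableI => //.
  by rewrite -[X in measurable X]setTI; exact: measurable_dir.
by apply/seteqP; split => x /=; [move=> [? ? ?]|move=> [[? ?] ?]]; do ?split.
Qed.

Let sphere_measure0 : @sphere_measure R n set0 = 0%E.
Proof.
rewrite /sphere_measure (_ : [set x | _] = set0) ?measure0 ?mul0e//.
by apply/seteqP; split => x // [].
Qed.

Let sphere_measure_ge0 A : (0 <= @sphere_measure R n A)%E.
Proof. by rewrite mule_ge0// lee_fin invr_ge0 fine_ge0. Qed.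

Let sphere_measure_sigma_additive : semi_sigma_additive (@sphere_measure R n).
Proof.
move=> F mF tF mUF.
pose c := fine (lebesgue_rV (@unit_ball R n)).
have cU : cone (\bigcup_i F i) = \bigcup_i cone (F i).
  apply/seteqP; split => x /=; first by move=> [xB x0 [i _ Fi]]; exists i.
  by move=> [i _ [xB x0 Fi]]; split => //; exists i.
rewrite /sphere_measure cU.
under eq_fun do rewrite -ge0_sume_distrl//.
apply: cvgeZr => //.
apply: measure_semi_sigma_additive.
- by move=> i; exact: measurable_cone.
- apply/trivIsetP => i j _ _ ij; apply/seteqP; split => x // -[/= [_ _ Fi] [_ _ Fj]].
  by move/trivIsetP : tF => /(_ i j I I ij) /seteqP[+ _]; apply; split; [exact: Fi|].
- by rewrite -cU; exact: measurable_cone.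
Qed.

HB.instance Definition _ := isMeasure.Build _ _ _ (@sphere_measure R n)
  sphere_measure0 sphere_measure_ge0 sphere_measure_sigma_additive.

End sphere_measure_measure.

Definition pderive (R : realType) (n : nat) (i : 'I_n) (f : 'rV[R]_n -> R) :
  'rV[R]_n -> R := 'D_(delta_mx ord0 i : 'rV[R]_n) f.

Definition class_C1 (R : realType) (n : nat) (U : set 'rV[R]_n)
    (f : 'rV[R]_n -> R) : Prop :=
  forall x, U x -> {for x, continuous f} /\
    forall i : 'I_n, derivable f x (delta_mx ord0 i) /\
      {for x, continuous (pderive i f)}.

Definition class_C2 (R : realType) (n : nat) (U : set 'rV[R]_n)
    (f : 'rV[R]_n -> R) : Prop :=
  class_C1 U f /\ forall i : 'I_n, class_C1 U (pderive i f).

Definition gradient (R : realType) (n : nat) (f : 'rV[R]_n -> R)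
    (x : 'rV[R]_n) : 'rV[R]_n := \row_(i < n) pderive i f x.

Definition laplacian (R : realType) (n : nat) (f : 'rV[R]_n -> R)
    (x : 'rV[R]_n) : R := \sum_(i < n) pderive i (pderive i f) x.

Definition hyperbolic_laplacian (R : realType) (n : nat) (f : 'rV[R]_n -> R)
    (x : 'rV[R]_n) : R :=
  (1 - enorm x ^+ 2) *
  ((1 - enorm x ^+ 2) * laplacian f x
     + 2 * (n%:R - 2) * dotv x (gradient f x)).

(* Functions on the ball are total functions on R^n whose values off the ball
   are never used. *)
Definition H_harmonic (R : realType) (n : nat) (f : 'rV[R]_n -> R) : Prop :=
  class_C2 (@unit_ball R n) f /\
  forall x, unit_ball x -> hyperbolic_laplacian f x = 0.

Definition hardy_normsq (R : realType) (n : nat) (f : 'rV[R]_n -> R) : \bar R :=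
  ereal_sup
    [set (\int[@sphere_measure R n]_(eta in @unit_sphere R n)
            (`|f (r *: eta)| ^+ 2)%:E)%E | r in `]0%R, 1%R[ ].

Definition hardy2 (R : realType) (n : nat) (f : 'rV[R]_n -> R) : Prop :=
  H_harmonic f /\ (hardy_normsq f < +oo)%E.

(* The inner product of the Hardy space is (f, g) |-> lim_(r -> 1-) of the
   integrals of f(r eta) g(r eta) over the unit sphere. *)
Record is_szego_kernel (R : realType) (n : nat)
    (K : 'rV[R]_n -> 'rV[R]_n -> R) : Prop := IsSzegoKernel {
  szego_hardy_l : forall y, unit_ball y -> hardy2 (fun x => K x y) ;
  szego_hardy_r : forall x, unit_ball x -> hardy2 (K x) ;
  szego_reproducing : forall (f : 'rV[R]_n -> R) (x : 'rV[R]_n),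
    hardy2 f -> unit_ball x ->
    \int[@sphere_measure R n]_(eta in @unit_sphere R n)
       (f (r *: eta) * K x (r *: eta)) @[r --> 1^'-] --> f x
}.

Definition pochhammer (R : realType) (a : R) (m : nat) : R :=
  \prod_(i < m) (a + i%:R).

Definition X9_term (R : realType) (a b c u v w : R) (p q l : nat) : R :=
  pochhammer a (2 * p + q) * pochhammer b (2 * l + q)
    / (pochhammer c (p + q + l) * p`!%:R * q`!%:R * l`!%:R)
    * u ^+ p * v ^+ q * w ^+ l.

Definition exton_X9 (R : realType) (a b c u v w : R) : R :=
  \big[+%R/0]_(0 <= p <oo) \big[+%R/0]_(0 <= q <oo) \big[+%R/0]_(0 <= l <oo)
    X9_term a b c u v w p q l.

(* exton_X9 is built from total limits, so convergence is a separate claim. *)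
Definition X9_convergent (R : realType) (a b c u v w : R) : Prop :=
  summable [set: nat * nat * nat]
    (fun t => (X9_term a b c u v w t.1.1 t.1.2 t.2)%:E).

(* Main.v *)
Require Import Defs.
From HB Require Import structures.
From mathcomp Require Import all_boot all_order all_algebra.
From mathcomp Require Import all_classical all_reals all_analysis.
From mathcomp Require Import measurable_realfun.
From mathcomp Require Import ring lra zify.

Set Implicit Arguments.
Unset Strict Implicit.
Unset Printing Implicit Defensive.

Import Order.TTheory GRing.Theory Num.Theory.
Import numFieldNormedType.Exports.

Local Open Scope classical_set_scope.
Local Open Scope ring_scope.

(* With P(z,x) = ((1-|x|^2)/|x-z|^2)^(n-1), the functions s |-> int f(s e)P(z,r e)
   and s |-> int f(r e)P(z,s e) agree for every H-harmonic f: their difference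
   solves the H-harmonic equation in polar coordinates on 0 < s <= r, vanishes at
   s = r and is bounded at s = 0, so it is 0 by the maximum principle. This
   symmetry makes G(x,y) = int P(z,x)P(z,y) dsigma(z) reproducing, and testing the
   reproducing properties of K and G against each other gives K = G.
   On the sphere P(z,x) is a multiple of (1 - t)^-(n-1) with t = 2<x,z>/(1+|x|^2).
   Expanding both factors of G reduces the claim to the moments
   int <x,z>^j <y,z>^k dsigma(z), which rotation invariance determines by a
   recursion; grouping by (j,k) = (2p+q,2l+q) yields X_9. *)

(** Hardy functions come without boundary values, and the reproducing property is a limit r -> 1.
    Comparing two radii r, s < 1 keeps every integrand continuous on the sphere and takes the place
    of a Dirichlet problem. The radial equation is singular at s = 0, where the difference is only
    known to be bounded; for n >= 3 the function 1/s is a strict supersolution of the polar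
    operator, and subtracting eps / s absorbs the singularity. The angular part is a sum of squares
    of rotation fields, so a maximum is tested by one-variable second derivatives along rotations;
    invariance of sigma moves a rotation of z onto the arguments of f and P. The vanishing of
    integrated rotational derivatives also gives the moment recursion, whose factor n - 1 + a + b
    becomes 2 (n/2 + p + q + l - 1) on the terms with a + 1 = 2p + q and b = 2l + q: this is the
    origin of the parameter n/2, while the exponent n - 1 of P gives both numerator parameters. *)

Definition preserves d (T : measurableType d) (R : realType)
    (mu : set T -> \bar R) (f : T -> T) :=
  measurable_fun setT f /\ forall A, measurable A -> mu (f @^-1` A) = mu A.

Lemma preserves_comp d (T : measurableType d) (R : realType)
    (mu : set T -> \bar R) (f g : T -> T) :
  preserves mu f -> preserves mu g -> preserves mu (f \o g).
Proof.
move=> [mf pf] [mg pg]; split; first exact: measurableT_comp.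
move=> A mA; rewrite comp_preimage pg ?pf//.
by rewrite -[X in measurable X]setTI; exact: mf.
Qed.

Lemma lebesgue_measure_shift (R : realType) (a : R) :
  preserves (@lebesgue_measure R) (fun t => t + a : measurableTypeR R).
Proof.
have mf : measurable_fun setT (fun t : measurableTypeR R => t + a : measurableTypeR R).
  by apply: measurable_funD; [exact: measurable_id|exact: measurable_cst].
split => // A mA; apply/esym.
pose mu : {measure set (measurableTypeR R) -> \bar R} :=
  @measure_function_pushforward__canonical__measure_function_Measure
    _ _ _ _ R lebesgue_measure _ mf.
apply: (@lebesgue_measure_unique R mu) => // _ [[u v] _ <-].
rewrite /= /pushforward.
rewrite (_ : _ @^-1` _ = `]u - a, v - a]%classic); last first.
  by apply/seteqP; split=> t; rewrite /= !in_itv/= ltrBlDr lerBrDr.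
rewrite [LHS](_ : _ = lebesgue_measure `]u, v]%classic)//.
rewrite !lebesgue_measure_itv/= !lte_fin ltrD2r.
by case: ifPn => // _; congr EFin; lra.
Qed.

(** * Rotation invariance of the surface measure *)

Section product_preserves.
Context d1 d2 (T1 : measurableType d1) (T2 : measurableType d2) (R : realType).
Variable m1 : {sigma_finite_measure set T1 -> \bar R}.
Variable m2 : {sigma_finite_measure set T2 -> \bar R}.

(** Cavalieri: the section over [t] is moved by a map preserving [m2], so the integrand that defines
    the product measure is unchanged. *)
Lemma preserves_fst (g : T1 -> T2 -> T2) :
  measurable_fun setT (fun p => g p.1 p.2) ->
  (forall t, preserves m2 (g t)) ->
  preserves (m1 \x m2)%E (fun p => (p.1, g p.1 p.2)).
Proof.
move=> mg pg; split; first exact: measurable_fun_pair.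
move=> A mA; rewrite /product_measure1; apply: eq_integral => t _ /=.
rewrite -[RHS](pg t).2; last exact: measurable_xsection.
by congr (m2 _); apply/seteqP; split => u; rewrite /xsection/= !inE.
Qed.

Lemma preserves_snd (g : T2 -> T1 -> T1) :
  measurable_fun setT (fun p => g p.2 p.1) ->
  (forall t, preserves m1 (g t)) ->
  preserves (m1 \x m2)%E (fun p => (g p.2 p.1, p.2)).
Proof.
move=> mg pg.
have mG : measurable_fun setT (fun p : T1 * T2 => (g p.2 p.1, p.2)).
  exact: measurable_fun_pair.
split => // A mA.
(* The product measure integrates sections over the first factor; uniqueness of product measures
   allows slicing along the second factor instead. *)
have E X : measurable X -> (m1 \x m2)%E X = (m1 \x^ m2)%E X.
  move=> mX; apply: product_measure_unique => // B C mB mC.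
  exact: product_measure2E.
rewrite !E//; last by rewrite -[X in measurable X]setTI; exact: mG.
rewrite /product_measure2; apply: eq_integral => t _ /=.
rewrite -[RHS](pg t).2; last exact: measurable_ysection.
by congr (m1 _); apply/seteqP; split => u; rewrite /ysection/= !inE.
Qed.

End product_preserves.

Section lebesgue_rV_invariance.
Context {R : realType}.

Lemma preserves_cons n (f : 'rV[R]_n.+1 -> 'rV[R]_n.+1)
    (g : measurableTypeR R * 'rV[R]_n -> measurableTypeR R * 'rV[R]_n) :
  measurable_fun setT f ->
  preserves (@lebesgue_measure R \x @lebesgue_rV R n)%E g ->
  (forall p, f (cons_rV p) = cons_rV (g p)) ->
  preserves (@lebesgue_rV R n.+1) f.
Proof.
move=> mf [mg pg] fg; split => // A mA.
rewrite /= /pushforward -[RHS]pg; last first.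
  by rewrite -[X in measurable X]setTI; exact: measurable_cons_rV.
by congr product_measure1; apply/seteqP; split => p /=; rewrite fg.
Qed.

Lemma cons_rV0 n (p : measurableTypeR R * 'rV[R]_n) : cons_rV p ord0 ord0 = p.1.
Proof.
rewrite /cons_rV (_ : ord0 = lshift n (ord0 : 'I_1)); last exact/val_inj.
by apply: etrans (row_mxEl _ _ _ _) _; rewrite mxE eqxx.
Qed.

Lemma cons_rVS n (p : measurableTypeR R * 'rV[R]_n) i :
  cons_rV p ord0 (lift ord0 i) = p.2 ord0 i.
Proof.
rewrite /cons_rV (_ : lift (ord0 : 'I_n.+1) i = rshift 1 i); last exact/val_inj.
exact: row_mxEr.
Qed.

Lemma cons_rV_eq n (x : 'rV[R]_n.+1) (p : measurableTypeR R * 'rV[R]_n) :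
  x ord0 ord0 = p.1 -> (forall i, x ord0 (lift ord0 i) = p.2 ord0 i) ->
  x = cons_rV p.
Proof.
move=> x0 xS; apply/rowP => i.
by case: (unliftP ord0 i) => [j ->|->]; rewrite ?cons_rV0 ?cons_rVS.
Qed.

Lemma measurable_addr_rV n (v : 'rV[R]_n) :
  measurable_fun setT (fun x : 'rV[R]_n => x + v).
Proof.
apply: measurable_fun_rV => i.
under eq_fun do rewrite mxE.
by apply: measurable_funD => //; exact: measurable_coord.
Qed.

Lemma lebesgue_rV_shift n (v : 'rV[R]_n) :
  preserves (@lebesgue_rV R n) (fun x => x + v).
Proof.
elim: n v => [|n IH] v.
  split; first exact: measurable_addr_rV.
  move=> A mA; congr (_ _); apply/seteqP; split => x /=;
  by rewrite (_ : x + v = x)//; apply/rowP => -[].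
pose v0 := v ord0 ord0; pose w : 'rV[R]_n := \row_j v ord0 (lift ord0 j).
apply: (@preserves_cons _ _ (fun p => (p.1 + v0 : measurableTypeR R, p.2 + w : 'rV[R]_n))).
- exact: measurable_addr_rV.
- pose F (p : measurableTypeR R * 'rV[R]_n) := (p.1, p.2 + w : 'rV[R]_n).
  pose G (p : measurableTypeR R * 'rV[R]_n) := (p.1 + v0 : measurableTypeR R, p.2).
  rewrite (_ : (fun p => _) = G \o F)//.
  apply: preserves_comp.
    apply: (@preserves_snd _ _ _ _ _ _ _ (fun (_ : 'rV[R]_n) (t : measurableTypeR R) => t + v0 : measurableTypeR R)).
      by apply: measurable_funD => //; exact: measurable_fst.
    by move=> _; exact: lebesgue_measure_shift.
  apply: (@preserves_fst _ _ _ _ _ _ _ (fun (_ : measurableTypeR R) (t : 'rV[R]_n) => t + w : 'rV[R]_n)).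
    exact: measurableT_comp (measurable_addr_rV w) measurable_snd.
  by move=> _; exact: IH.
- move=> p; apply: cons_rV_eq; first by rewrite mxE cons_rV0.
  by move=> i; rewrite mxE cons_rVS/= !mxE.
Qed.

Definition shear n (i j : 'I_n) (a : R) (x : 'rV[R]_n) : 'rV[R]_n :=
  x + (a * x ord0 j) *: delta_mx ord0 i.

Lemma shearE n (i j : 'I_n) a x k :
  shear i j a x ord0 k = x ord0 k + a * x ord0 j * (k == i)%:R.
Proof. by rewrite !mxE eqxx. Qed.

Lemma measurable_shear n (i j : 'I_n) a : measurable_fun setT (shear i j a).
Proof.
apply: measurable_fun_rV => k; under eq_fun do rewrite shearE.
apply: measurable_funD; first exact: measurable_coord.
apply: measurable_funM => //.
by apply: measurable_funM => //; exact: measurable_coord.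
Qed.

(** The amount added to coordinate i does not depend on that coordinate, so with the others frozen a
    shear is a translation. The cases ask whether the split-off coordinate 0 is i, j or neither;
    only the last one recurses. *)
Lemma lebesgue_rV_shear n (i j : 'I_n) a : i != j ->
  preserves (@lebesgue_rV R n) (shear i j a).
Proof.
elim: n i j => [[]//|n IH] i j ij.
case: (unliftP ord0 i) ij => [i' ->|->]; case: (unliftP ord0 j) => [j' ->|->] ij.
- apply: (@preserves_cons _ _ (fun p => (p.1, shear i' j' a p.2))).
  + exact: measurable_shear.
  + apply: (@preserves_fst _ _ _ _ _ _ _ (fun _ => shear i' j' a)).
      exact: measurableT_comp (measurable_shear _ _ _) measurable_snd.
    by move=> _; apply: IH; apply: contra ij => /eqP ->.
  + move=> p; apply: cons_rV_eq; rewrite ?shearE ?cons_rV0/= ?mulr0 ?addr0//.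
    move=> k; rewrite !shearE !cons_rVS.
    by rewrite (inj_eq (@lift_inj _ ord0)).
- apply: (@preserves_cons _ _ (fun p => (p.1, p.2 + (a * p.1) *: delta_mx ord0 i' : 'rV[R]_n))).
  + exact: measurable_shear.
  + apply: (@preserves_fst _ _ _ _ _ _ _ (fun (t : measurableTypeR R) (x : 'rV[R]_n) => x + (a * t) *: delta_mx ord0 i' : 'rV[R]_n)).
      apply: measurable_fun_rV => k.
      rewrite (_ : (fun _ => _) = (fun p : measurableTypeR R * 'rV[R]_n =>
        p.2 ord0 k + a * p.1 * (k == i')%:R)); last first.
        by apply/funext => p; rewrite !mxE eqxx.
      apply: measurable_funD.
        exact: (measurableT_comp (measurable_coord k) measurable_snd).
      apply: measurable_funM => //.
      by apply: measurable_funM => //; exact: measurable_fst.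
    by move=> t; exact: lebesgue_rV_shift.
  + move=> p; apply: cons_rV_eq; rewrite ?shearE ?cons_rV0/= ?mulr0 ?addr0//.
    move=> k; rewrite !shearE !cons_rVS cons_rV0 !mxE eqxx.
    by rewrite (inj_eq (@lift_inj _ ord0)).
- apply: (@preserves_cons _ _ (fun p => (p.1 + a * p.2 ord0 j' : measurableTypeR R, p.2))).
  + exact: measurable_shear.
  + apply: (@preserves_snd _ _ _ _ _ _ _ (fun (x : 'rV[R]_n) (t : measurableTypeR R) => t + a * x ord0 j' : measurableTypeR R)).
      apply: measurable_funD; first exact: measurable_fst.
      apply: measurable_funM => //.
      exact: (measurableT_comp (measurable_coord j') measurable_snd).
    by move=> x; exact: lebesgue_measure_shift.
  + move=> p; apply: cons_rV_eq; rewrite ?shearE ?cons_rV0/= ?cons_rVS ?mulr1//.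
    by move=> k; rewrite shearE !cons_rVS/= mulr0 addr0.
- by rewrite eqxx in ij.
Qed.

(** The matrix with rows (c, -s) and (s, c) acting on the coordinates i and j, written as the
    identity plus a correction; a rotation when [c ^+ 2 + s ^+ 2 = 1]. *)
Definition prot n (i j : 'I_n) (c s : R) (x : 'rV[R]_n) : 'rV[R]_n :=
  x + ((c - 1) * x ord0 i - s * x ord0 j) *: delta_mx ord0 i
    + (s * x ord0 i + (c - 1) * x ord0 j) *: delta_mx ord0 j.

Lemma protE n (i j : 'I_n) c s x k :
  prot i j c s x ord0 k = x ord0 k
    + ((c - 1) * x ord0 i - s * x ord0 j) * (k == i)%:R
    + (s * x ord0 i + (c - 1) * x ord0 j) * (k == j)%:R.
Proof. by rewrite !mxE eqxx. Qed.

(* A plane rotation with c <> -1 is a product of three shears. *)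
Lemma lebesgue_rV_prot n (i j : 'I_n) c s : i != j -> 0 < 1 + c ->
  c ^+ 2 + s ^+ 2 = 1 -> preserves (@lebesgue_rV R n) (prot i j c s).
Proof.
move=> ij c1 cs1.
have ji : j != i by rewrite eq_sym.
(* The tangent of half the angle: rotation = shear by -t, shear by s, shear by -t. *)
pose t := s / (1 + c).
rewrite (_ : prot i j c s = shear i j (- t) \o (shear j i s \o shear i j (- t))).
  by apply: preserves_comp; [|apply: preserves_comp]; exact: lebesgue_rV_shear.
apply/funext => x; apply/rowP => k.
have ts : t * s = 1 - c.
  rewrite /t mulrAC -expr2 -(addrK (c ^+ 2) (s ^+ 2)) [_ + c ^+ 2]addrC cs1.
  by field; rewrite gt_eqF.
have tc : t * (1 + c) = s by rewrite mulfVK// gt_eqF.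
rewrite /comp protE !shearE !eqxx (negbTE ji).
have -> : (c - 1) = - (t * s) by rewrite ts opprB.
have [->|ki] := eqVneq k i; last by rewrite /=; ring.
have e : 2 * t - t * (t * s) - s = 0 by rewrite ts -[X in _ - X]tc; ring.
apply/eqP; rewrite (negbTE ij) /= -subr_eq0.
by rewrite -(mul0r (x ord0 j)) -e; apply/eqP; ring.
Qed.

End lebesgue_rV_invariance.

(** * Euclidean geometry and the normalized surface measure *)

Section sphere.
Context {R : realType}.

Lemma dotvC n (x y : 'rV[R]_n) : dotv x y = dotv y x.
Proof. by apply: eq_bigr => i _; rewrite mulrC. Qed.

Lemma dotvDl n (x y z : 'rV[R]_n) : dotv (x + y) z = dotv x z + dotv y z.
Proof. by rewrite -big_split; apply: eq_bigr => i _; rewrite mxE mulrDl. Qed.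

Lemma dotvZl n a (x y : 'rV[R]_n) : dotv (a *: x) y = a * dotv x y.
Proof. by rewrite mulr_sumr; apply: eq_bigr => i _; rewrite mxE mulrA. Qed.

Lemma dotvDr n (x y z : 'rV[R]_n) : dotv z (x + y) = dotv z x + dotv z y.
Proof. by rewrite dotvC dotvDl !(dotvC z). Qed.

Lemma dotvZr n a (x y : 'rV[R]_n) : dotv x (a *: y) = a * dotv x y.
Proof. by rewrite dotvC dotvZl dotvC. Qed.

Lemma dotv_delta n (x : 'rV[R]_n) i : dotv x (delta_mx ord0 i) = x ord0 i.
Proof.
rewrite /dotv (bigD1 i)//= big1 ?addr0; last first.
  by move=> j ji; rewrite mxE eqxx/= (negbTE ji) mulr0.
by rewrite mxE !eqxx mulr1.
Qed.

Lemma dotv_ge0 n (x : 'rV[R]_n) : 0 <= dotv x x.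
Proof. by apply: sumr_ge0 => i _; rewrite -expr2 sqr_ge0. Qed.

Lemma dotv_eq0 n (x : 'rV[R]_n) : (dotv x x == 0) = (x == 0).
Proof.
apply/eqP/eqP => [|->]; last by rewrite /dotv big1// => i _; rewrite mxE mul0r.
move/eqP; rewrite psumr_eq0 => [/allP xi|i _]; last by rewrite -expr2 sqr_ge0.
apply/rowP => i; rewrite mxE; apply/eqP.
by have := xi i; rewrite mem_index_enum mulf_eq0 orbb => /(_ isT).
Qed.

Lemma enorm_ge0 n (x : 'rV[R]_n) : 0 <= enorm x.
Proof. exact: sqrtr_ge0. Qed.

Lemma sqr_enorm n (x : 'rV[R]_n) : enorm x ^+ 2 = dotv x x.
Proof. by rewrite sqr_sqrtr// dotv_ge0. Qed.

Lemma enormZ n a (x : 'rV[R]_n) : enorm (a *: x) = `|a| * enorm x.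
Proof.
rewrite /enorm dotvZl dotvZr mulrA -expr2 sqrtrM ?sqr_ge0// sqrtr_sqr//.
Qed.

Lemma enorm_eq0 n (x : 'rV[R]_n) : (enorm x == 0) = (x == 0).
Proof. by rewrite -dotv_eq0 -sqr_enorm sqrf_eq0. Qed.

Lemma unit_ballE n (x : 'rV[R]_n) : unit_ball x <-> dotv x x < 1.
Proof.
rewrite /unit_ball/= -sqr_enorm; have := enorm_ge0 x => x0; split=> x1.
  by rewrite expr_lt1.
by rewrite expr_lt1 in x1.
Qed.

Lemma unit_sphereE n (x : 'rV[R]_n) : unit_sphere x <-> dotv x x = 1.
Proof.
rewrite /unit_sphere/= -sqr_enorm; split=> [->|/eqP]; first by rewrite expr1n.
by rewrite sqrf_eq1 => /orP[/eqP//|/eqP x1]; have := enorm_ge0 x; rewrite x1; lra.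
Qed.

Lemma cauchy_schwarz n (x y : 'rV[R]_n) :
  dotv x y ^+ 2 <= dotv x x * dotv y y.
Proof.
have [->|y0] := eqVneq y 0.
  have -> : dotv x 0 = 0 by rewrite /dotv big1// => i _; rewrite mxE mulr0.
  by rewrite expr0n/= mulr_ge0// dotv_ge0.
have yy : 0 < dotv y y by rewrite lt_neqAle dotv_ge0 eq_sym dotv_eq0 y0.
have := dotv_ge0 (dotv y y *: x + (- dotv x y) *: y).
rewrite !(dotvDl, dotvDr, dotvZl, dotvZr) (dotvC y x) => h.
have : 0 <= dotv y y * (dotv x x * dotv y y - dotv x y ^+ 2).
  by apply: le_trans h _; rewrite le_eqVlt; apply/orP; left; apply/eqP; ring.
by rewrite pmulr_rge0// subr_ge0.
Qed.

Lemma dotv_le n (x y : 'rV[R]_n) : `|dotv x y| <= enorm x * enorm y.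
Proof.
rewrite -ler_sqr ?nnegrE ?mulr_ge0 ?enorm_ge0// exprMn !sqr_enorm.
by rewrite real_normK ?num_real// cauchy_schwarz.
Qed.

Lemma coord_le_enorm n (x : 'rV[R]_n) i : `|x ord0 i| <= enorm x.
Proof.
rewrite -sqrtr_sqr; apply: ler_wsqrtr; rewrite /dotv (bigD1 i)//= -expr2 lerDl.
by apply: sumr_ge0 => j _; rewrite -expr2 sqr_ge0.
Qed.

Lemma measurable_unit_ball n : measurable (@unit_ball R n).
Proof.
rewrite [X in measurable X](_ : _ = (@enorm R n) @^-1` `]-oo, 1[).
  rewrite -[X in measurable X]setTI.
  by apply: (measurable_enorm measurableT); exact: measurable_itv.
by apply/seteqP; split => x; rewrite /unit_ball/= in_itv.
Qed.

Lemma measurable_unit_sphere n : measurable (@unit_sphere R n).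
Proof.
rewrite [X in measurable X](_ : _ = (@enorm R n) @^-1` [set 1]).
  rewrite -[X in measurable X]setTI.
  by apply: (measurable_enorm measurableT); exact: measurable_set1.
by apply/seteqP; split => x.
Qed.

Lemma dotv_prot n (i j : 'I_n) (c s : R) (x y : 'rV[R]_n) : i != j ->
  c ^+ 2 + s ^+ 2 = 1 -> dotv (prot i j c s x) (prot i j c s y) = dotv x y.
Proof.
move=> ij cs1; rewrite /prot !(dotvDl, dotvDr, dotvZl, dotvZr).
rewrite !(dotv_delta, dotvC (delta_mx _ _)) !mxE !eqxx (negbTE ij) eq_sym (negbTE ij) /=.
set d := dotv x y; set a := x _ _; set b := x _ _; set e := y _ _; set f := y _ _.
have s2 : s * s = 1 - c ^+ 2 by rewrite -cs1 -expr2; ring.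
ring: s2.
Qed.

Lemma enorm_prot n (i j : 'I_n) (c s : R) (x : 'rV[R]_n) : i != j ->
  c ^+ 2 + s ^+ 2 = 1 -> enorm (prot i j c s x) = enorm x.
Proof. by move=> ij cs; rewrite /enorm dotv_prot. Qed.

Lemma protZ n (i j : 'I_n) (c s a : R) (x : 'rV[R]_n) :
  prot i j c s (a *: x) = a *: prot i j c s x.
Proof. by apply/rowP => k; rewrite [RHS]mxE !protE !mxE; ring. Qed.

Lemma measurable_coords n (A : set (measurableTypeR R)) : measurable A ->
  measurable [set x : 'rV[R]_n | forall i, A (x ord0 i)].
Proof.
move=> mA; rewrite (_ : [set _ | _] = \bigcap_(i in [set: 'I_n])
  (fun x : 'rV[R]_n => x ord0 i : measurableTypeR R) @^-1` A).
  apply: fin_bigcap_measurable => // i _.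
  rewrite -[X in measurable X]setTI.
  exact: (measurable_coord i measurableT).
by apply/seteqP; split => x /= h i => [_|]; exact: h.
Qed.

Lemma measurable_box n (a : R) :
  measurable [set x : 'rV[R]_n | forall i, `|x ord0 i| <= a].
Proof.
rewrite (_ : [set _ | _] = [set x : 'rV[R]_n | forall i, `[-a, a]%classic (x ord0 i)]).
  by apply: measurable_coords; exact: measurable_itv.
by apply/seteqP; split => x /= h i; have := h i; rewrite /= in_itv/= -ler_norml.
Qed.

Lemma measurable_rV_set1 n (v : 'rV[R]_n) : measurable [set v].
Proof.
rewrite (_ : [set v] = (fun x => x + (- v)) @^-1` [set x | forall i, [set 0] (x ord0 i)]).
  rewrite -[X in measurable X]setTI; apply: measurable_addr_rV => //.
  by apply: measurable_coords; exact: measurable_set1.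
apply/seteqP; split => x /=; first by move=> -> i; rewrite subrr mxE.
by move=> h; apply/eqP; rewrite -subr_eq0; apply/eqP/rowP => i; rewrite h mxE.
Qed.

Lemma measurable_cone n (A : set 'rV[R]_n) : measurable A ->
  measurable [set x : 'rV[R]_n | [/\ unit_ball x, x != 0 & A ((enorm x)^-1 *: x)]].
Proof.
move=> mA; rewrite (_ : [set _ | _] =
  (unit_ball (n:=n) `\` [set 0]) `&` (fun x => (enorm x)^-1 *: x) @^-1` A).
  apply: measurableI.
    by apply: measurableD; [exact: measurable_unit_ball|exact: measurable_rV_set1].
  rewrite -[X in measurable X]setTI.
  have : measurable_fun setT (fun x : 'rV[R]_n => (enorm x)^-1 *: x); last exact.
  apply: measurable_fun_rV => i.
  rewrite (_ : (fun _ => _) =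
    (fun x : 'rV[R]_n => powR (enorm x) (-1) * x ord0 i : measurableTypeR R)).
    apply: measurable_funM; last exact: measurable_coord.
    apply: (measurableT_comp
      (f := (@powR R ^~ (-1)) : measurableTypeR R -> measurableTypeR R)).
      exact: measurable_powR.
    exact: measurable_enorm.
  by apply/funext => x; rewrite mxE powR_inv1// sqrtr_ge0.
by apply/seteqP; split => x /= => [[? /eqP ? ?]|[[? /eqP ?] ?]].
Qed.

Lemma lebesgue_rV_box n (a : R) : 0 <= a ->
  lebesgue_rV [set x : 'rV[R]_n | forall i, `|x ord0 i| <= a] = ((2 * a) ^+ n)%:E.
Proof.
move=> a0; elim: n => [|n IH].
  rewrite /= diracE mem_set// => -[]//.
rewrite /= /pushforward.
rewrite (_ : _ @^-1` _ = `[- a, a]%classic `*` [set x : 'rV[R]_n | forall i, `|x ord0 i| <= a]); last first.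
  apply/seteqP; split => -[t x] /=.
    move=> h; split; first by have := h ord0; rewrite cons_rV0/= ler_norml in_itv.
    by move=> i; have := h (lift ord0 i); rewrite cons_rVS.
  move=> [ta xa] i; case: (unliftP ord0 i) => [j ->|->]; first by rewrite cons_rVS/=.
  by rewrite cons_rV0/= ler_norml; move: ta; rewrite in_itv.
rewrite product_measure1E//=; last exact: measurable_box.
rewrite IH lebesgue_measure_itv/= lte_fin exprS.
have [a0'|a0'] := ltrP (- a) a; first by rewrite -EFinM; congr EFin; ring.
have -> : a = 0 by lra.
by rewrite mulr0 mul0e mul0r.
Qed.

Lemma lebesgue_rV_ball_fin n : lebesgue_rV (@unit_ball R n) \is a fin_num.
Proof.
rewrite ge0_fin_numE//; apply: le_lt_trans (ltry ((2 * 1) ^+ n)).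
rewrite -(@lebesgue_rV_box n 1)//; apply: le_measure; rewrite ?inE.
- exact: measurable_unit_ball.
- exact: measurable_box.
- by move=> x /= x1 i; apply: le_trans (coord_le_enorm x i) (ltW x1).
Qed.

Lemma lebesgue_rV_ball_gt0 n : (0 < lebesgue_rV (@unit_ball R n))%E.
Proof.
pose a : R := (n.+1%:R)^-1.
have a0 : 0 < a by rewrite invr_gt0.
apply: (@lt_le_trans _ _ ((2 * a) ^+ n)%:E).
  by rewrite lte_fin exprn_gt0// mulr_gt0.
rewrite -(@lebesgue_rV_box n a (ltW a0)); apply: le_measure; rewrite ?inE.
- exact: measurable_box.
- exact: measurable_unit_ball.
- move=> x /= xa; apply/unit_ballE.
  apply: (@le_lt_trans _ _ (\sum_(i < n) a)).
    apply: ler_sum => i _; rewrite -expr2 -real_normK ?num_real//.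
    apply: (@le_trans _ _ `|x ord0 i|) => //.
    rewrite expr2 ler_piMl//; apply: le_trans (xa i) _.
    by rewrite invf_le1// ler1n.
  rewrite sumr_const card_ord -mulr_natr mulrC.
  by rewrite ltr_pdivrMr// mul1r ltr_nat.
Qed.

Lemma lebesgue_rV_set0 n : (0 < n)%N -> lebesgue_rV [set (0 : 'rV[R]_n)] = 0%E.
Proof.
move=> n0; rewrite (_ : [set 0] = [set x : 'rV[R]_n | forall i, `|x ord0 i| <= 0]).
  by rewrite lebesgue_rV_box// mulr0 expr0n gtn_eqF.
apply/seteqP; split => x /=.
  by move=> -> i; rewrite mxE normr0.
by move=> h; apply/rowP => i; have := h i; rewrite normr_le0 mxE => /eqP.
Qed.

(** The cone over the whole sphere is the punctured ball, and the origin is a null set once n >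
    0. *)
Lemma sphere_measure1 n : (0 < n)%N -> sphere_measure (@unit_sphere R n) = 1%E.
Proof.
move=> n0; rewrite /sphere_measure.
have -> : lebesgue_rV [set x : 'rV[R]_n | [/\ unit_ball x, x != 0 &
    unit_sphere ((enorm x)^-1 *: x)]] = lebesgue_rV (@unit_ball R n).
  have -> : [set x : 'rV[R]_n | [/\ unit_ball x, x != 0 &
      unit_sphere ((enorm x)^-1 *: x)]] = unit_ball (n:=n) `\` [set 0].
    apply/seteqP; split => x /=; first by move=> [? /eqP].
    move=> [xB /eqP x0]; split => //.
    by rewrite /unit_sphere/= enormZ ger0_norm ?invr_ge0 ?enorm_ge0// mulVf// enorm_eq0.
  have B0 : unit_ball (n:=n) `&` [set 0] = [set (0 : 'rV[R]_n)].
    apply/seteqP; split => x //=; first by case.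
    move=> ->; split => //; apply/unit_ballE.
    have /eqP-> : dotv (0 : 'rV[R]_n) 0 == 0 by rewrite dotv_eq0.
    by [].
  rewrite measureD; last 3 first.
  - exact: measurable_unit_ball.
  - exact: measurable_rV_set1.
  - by rewrite -ge0_fin_numE// lebesgue_rV_ball_fin.
  by rewrite /= B0 lebesgue_rV_set0// sube0.
have f := lebesgue_rV_ball_fin n.
rewrite -{1}(fineK f) -EFinM mulfV//.
have := lebesgue_rV_ball_gt0 n; rewrite -{1}(fineK f) lte_fin => /gt_eqF.
by move/negbT.
Qed.

(** A rotation is linear and preserves the norm, so the cone over a preimage is the preimage of the
    cone, and invariance of Lebesgue measure applies. *)
Lemma sphere_measure_prot n (i j : 'I_n) (c s : R) : i != j -> 0 < 1 + c ->
  c ^+ 2 + s ^+ 2 = 1 -> preserves (@sphere_measure R n) (prot i j c s).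
Proof.
move=> ij c1 cs1; have [mf pf] := lebesgue_rV_prot ij c1 cs1.
split => // A mA; rewrite /sphere_measure; congr (_ * _)%E.
rewrite -[RHS]pf.
  congr lebesgue_rV; apply/seteqP; split => x /=.
    move=> [xB x0 xA]; rewrite /unit_ball/= enorm_prot//; split => //.
      by rewrite -enorm_eq0 enorm_prot// enorm_eq0.
    by rewrite -protZ.
  move=> []; rewrite /unit_ball/= enorm_prot// => xB.
  by rewrite -enorm_eq0 enorm_prot// enorm_eq0 -protZ; split.
exact: measurable_cone.
Qed.

End sphere.

(** * Integrals over the sphere *)

Section sphere_integral.
Context {R : realType}.

Definition on_sphere n (P : 'rV[R]_n -> Prop) := forall e, unit_sphere e -> P e.

(** Continuity in the ambient space at the points of the sphere, stronger than continuity of the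
    restriction; limits along [nbhs e] can then be combined directly. *)
Definition scont n (g : 'rV[R]_n -> R) := on_sphere (fun e => {for e, continuous g}).

Definition sint n (g : 'rV[R]_n -> R) : R :=
  \int[@sphere_measure R n]_(e in @unit_sphere R n) g e.

Lemma cvg_sumr (T : Type) (F : set_system T) (FF : Filter F) (I : Type)
    (r : seq I) (P : pred I) (f : I -> T -> R) (l : I -> R) :
  (forall i, P i -> f i t @[t --> F] --> l i) ->
  (\sum_(i <- r | P i) f i t) @[t --> F] --> \sum_(i <- r | P i) l i.
Proof.
move=> fl; elim: r => [|i r IH].
  by rewrite big_nil; under eq_fun do rewrite big_nil; exact: cvg_cst.
rewrite big_cons; under eq_fun do rewrite big_cons.
by case: (boolP (P i)) => // Pi; apply: cvgD => //; exact: fl.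
Qed.

Lemma cvg_coord n (T : Type) (F : set_system T) (FF : Filter F)
    (f : T -> 'rV[R]_n) (x : 'rV[R]_n) i :
  f t @[t --> F] --> x -> f t ord0 i @[t --> F] --> x ord0 i.
Proof.
move=> fx; apply: (@cvg_comp _ _ _ f (fun x : 'rV[R]_n => x ord0 i) _ (nbhs x)) => //.
exact: coord_continuous.
Qed.

Lemma cvg_dotv n (T : Type) (F : set_system T) (FF : Filter F)
    (f g : T -> 'rV[R]_n) (x y : 'rV[R]_n) :
  f t @[t --> F] --> x -> g t @[t --> F] --> y ->
  dotv (f t) (g t) @[t --> F] --> dotv x y.
Proof. by move=> fx gy; apply: cvg_sumr => i _; apply: cvgM; exact: cvg_coord. Qed.

Lemma continuous_enorm n : continuous (@enorm R n).
Proof.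
move=> x; apply: (@cvg_comp _ _ _ (fun x => dotv x x) Num.sqrt _ (nbhs (dotv x x))).
  exact: (@cvg_dotv n _ (nbhs x) _ id id x x cvg_id cvg_id).
exact: sqrt_continuous.
Qed.

Lemma coord_le_norm n (x : 'rV[R]_n) i : `|x ord0 i| <= `|x|.
Proof. by rewrite [leRHS]mx_normrE; apply: (le_bigmax _ _ (ord0, i)). Qed.

Lemma norm_le_enorm n (x : 'rV[R]_n) : `|x| <= enorm x.
Proof.
rewrite [leLHS]mx_normrE; apply/bigmax_leP; split => [|[i j] _]; first exact: enorm_ge0.
by rewrite (ord1 i) coord_le_enorm.
Qed.

Lemma compact_enorm_le n (r : R) : compact [set x : 'rV[R]_n | enorm x <= r].
Proof.
apply: bounded_closed_compact.
  exists r; split; first exact: num_real.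
  by move=> M rM x /= xr; apply: le_trans (norm_le_enorm x) (le_trans xr (ltW rM)).
apply: (@closed_comp _ _ (@enorm R n) [set y | y <= r]) => [x _|].
  exact: continuous_enorm.
exact: closed_le.
Qed.

Lemma compact_sphere n : compact (@unit_sphere R n).
Proof.
apply: (subclosed_compact _ (@compact_enorm_le n 1)); last by move=> x /= ->.
apply: (@closed_comp _ _ (@enorm R n) [set 1]) => [x _|].
  exact: continuous_enorm.
exact: closed_eq.
Qed.

Lemma open_unit_ball n : open (@unit_ball R n).
Proof.
apply: (@open_comp _ _ (@enorm R n) [set y | y < 1]) => [x _|].
  exact: continuous_enorm.
exact: open_lt.
Qed.

(** The sigma-algebra is generated by the coordinates, not by the topology, so open preimages are
    rebuilt as countable unions of boxes with rational centre and radius 1/(k+1). *)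
Lemma scont_measurable n (g : 'rV[R]_n -> R) : scont g ->
  measurable_fun (@unit_sphere R n) g.
Proof.
move=> cg; have mS := @measurable_unit_sphere R n.
apply: (measurability _ (RGenOpens.measurableE R)).
move=> _ [_ [a [b ->] <-]].
have oab : open `]a, b[%classic by exact: interval_open.
pose box (q : 'rV[rat]_n * nat) :=
  [set x : 'rV[R]_n | forall i, `|x ord0 i - ratr (q.1 ord0 i)| < q.2.+1%:R^-1].
have mbox q : measurable (box q).
  rewrite (_ : box q = \bigcap_(i in [set: 'I_n])
    (fun x : 'rV[R]_n => x ord0 i : measurableTypeR R) @^-1`
      `]ratr (q.1 ord0 i) - q.2.+1%:R^-1, ratr (q.1 ord0 i) + q.2.+1%:R^-1[).
    apply: fin_bigcap_measurable => // i _.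
    rewrite -[X in measurable X]setTI.
    by apply: (measurable_coord i measurableT); exact: measurable_itv.
  by apply/seteqP; split => x /= h i => [_|]; have := h i; rewrite /= in_itv/= ltr_distl// => /(_ I).
pose Q q := box q `&` unit_sphere (n:=n) `<=` g @^-1` `]a, b[%classic.
rewrite (_ : _ `&` _ = unit_sphere (n:=n) `&`
    \bigcup_q (if `[< Q q >] then box q else set0)); last first.
  apply/seteqP; split => x [Sx /= gx]; split => //; last first.
    by case: gx => q _; case: asboolP => // Qq bx; exact: (Qq x).
  have : nbhs x (g @^-1` `]a, b[%classic).
    by apply: (cg x Sx); exact: open_nbhs_nbhs.
  move=> /nbhs_ballP[e /= e0 xe].
  (* Two points of a box of radius 1/(k+1) are at sup distance at most 2/(k+1) < e. *)
  have [k ke] : exists k : nat, k.+1%:R^-1 < e / 2.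
    have e2 : 0 < e / 2 by lra.
    by have [k] := ltr_add_invr e2; rewrite add0r; exists k.
  have k0 : 0 < k.+1%:R^-1 :> R by rewrite invr_gt0.
  have /choice[q hq] : forall i : 'I_n, exists q : rat, `|x ord0 i - ratr q| < k.+1%:R^-1.
    move=> i.
    have : x ord0 i - k.+1%:R^-1 < x ord0 i + k.+1%:R^-1.
      by apply: (@lt_trans _ _ (x ord0 i)); rewrite ?gtrBl ?ltrDl.
    move=> /rat_in_itvoo[q]; rewrite in_itv/= => h; exists q; rewrite distrC ltr_distl//.
  exists (\row_i q i, k) => //; rewrite asboolT.
    by move=> i /=; rewrite mxE.
  move=> y [by_ Sy]; apply: xe; rewrite -ball_normE /=.
  apply: le_lt_trans (_ : k.+1%:R^-1 + k.+1%:R^-1 < e); last by move: ke; set d := _^-1; lra.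
  rewrite [leLHS]mx_normrE; apply/bigmax_leP; split; first by rewrite addr_ge0// ltW.
  move=> [i j] _ /=; rewrite (ord1 i) !mxE.
  have := by_ j; have := hq j; rewrite /= mxE => h1 h2.
  rewrite (_ : _ - _ = (x ord0 j - ratr (q j)) - (y ord0 j - ratr (q j))); last by ring.
  by apply: le_trans (ler_normB _ _) _; rewrite lerD// ltW.
apply: measurableI => //; apply: countable_bigcupT_measurable => // q.
by case: ifP.
Qed.

Lemma scont_bounded n (g : 'rV[R]_n -> R) : scont g ->
  exists M, on_sphere (fun e => `|g e| <= M).
Proof.
move=> cg; have : compact (g @` unit_sphere (n:=n)).
  apply: continuous_compact; last exact: compact_sphere.
  by apply: continuous_in_subspaceT => e /set_mem; exact: cg.
move=> /compact_bounded[M [_ h]]; exists (M + 1) => e Se.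
by apply: h; [rewrite ltrDl|exists e].
Qed.

Lemma sint_integrable n (g : 'rV[R]_n -> R) : (0 < n)%N -> scont g ->
  (@sphere_measure R n).-integrable (@unit_sphere R n) (EFin \o g).
Proof.
move=> n0 cg; apply: measurable_bounded_integrable.
- exact: measurable_unit_sphere.
- by rewrite [ltLHS]sphere_measure1// ltry.
- exact: scont_measurable.
- have [M hM] := scont_bounded cg.
  exists M; split; first exact: num_real.
  by move=> N MN e /= Se; apply: le_trans (hM _ Se) (ltW MN).
Qed.

Lemma eq_sint n (f g : 'rV[R]_n -> R) : on_sphere (fun e => f e = g e) ->
  sint f = sint g.
Proof. by move=> fg; apply: eq_Rintegral => e /set_mem; exact: fg. Qed.

Lemma scont_cst n (c : R) : scont (fun _ : 'rV[R]_n => c).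
Proof. by move=> e _; exact: (@cvg_cst _ c _ (nbhs e)). Qed.

Lemma scontD n (f g : 'rV[R]_n -> R) : scont f -> scont g -> scont (fun e => f e + g e).
Proof. by move=> cf cg e Se; exact: cvgD (cf e Se) (cg e Se). Qed.

Lemma scontB n (f g : 'rV[R]_n -> R) : scont f -> scont g -> scont (fun e => f e - g e).
Proof. by move=> cf cg e Se; exact: cvgB (cf e Se) (cg e Se). Qed.

Lemma scontM n (f g : 'rV[R]_n -> R) : scont f -> scont g -> scont (fun e => f e * g e).
Proof. by move=> cf cg e Se; exact: cvgM (cf e Se) (cg e Se). Qed.

Lemma scont_norm n (f : 'rV[R]_n -> R) : scont f -> scont (fun e => `|f e|).
Proof. by move=> cf e Se; exact: cvg_norm (cf e Se). Qed.

Lemma scont_sum n (I : Type) (r : seq I) (P : pred I) (f : I -> 'rV[R]_n -> R) :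
  (forall i, P i -> scont (f i)) -> scont (fun e => \sum_(i <- r | P i) f i e).
Proof.
move=> cf e Se.
exact: (@cvg_sumr _ (nbhs e) _ I r P f (f ^~ e) (fun i Pi => cf i Pi e Se)).
Qed.

Lemma sint_cst n c : (0 < n)%N -> sint (fun _ : 'rV[R]_n => c) = c.
Proof.
move=> n0; rewrite /sint Rintegral_cst; last exact: measurable_unit_sphere.
by rewrite [X in fine X]sphere_measure1//= mulr1.
Qed.

Lemma sintD n (f g : 'rV[R]_n -> R) : (0 < n)%N -> scont f -> scont g ->
  sint (fun e => f e + g e) = sint f + sint g.
Proof.
move=> n0 cf cg; apply: RintegralD; first exact: measurable_unit_sphere.
  exact: sint_integrable.
exact: sint_integrable.
Qed.

Lemma sintB n (f g : 'rV[R]_n -> R) : (0 < n)%N -> scont f -> scont g ->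
  sint (fun e => f e - g e) = sint f - sint g.
Proof.
move=> n0 cf cg; apply: RintegralB; first exact: measurable_unit_sphere.
  exact: sint_integrable.
exact: sint_integrable.
Qed.

Lemma sintZl n c (f : 'rV[R]_n -> R) : (0 < n)%N -> scont f ->
  sint (fun e => c * f e) = c * sint f.
Proof.
move=> n0 cf; apply: RintegralZl; first exact: measurable_unit_sphere.
exact: sint_integrable.
Qed.

Lemma sint_sum n (I : Type) (r : seq I) (P : pred I) (f : I -> 'rV[R]_n -> R) :
  (0 < n)%N -> (forall i, P i -> scont (f i)) ->
  sint (fun e => \sum_(i <- r | P i) f i e) = \sum_(i <- r | P i) sint (f i).
Proof.
move=> n0 cf; elim: r => [|i r IH].
  rewrite big_nil -[RHS](sint_cst 0 n0).
  by apply: eq_sint => e _; rewrite big_nil.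
rewrite big_cons; case: ifPn => Pi; last first.
  by rewrite -IH; apply: eq_sint => e _; rewrite big_cons (negbTE Pi).
rewrite -IH -sintD//; [|exact: cf|exact: scont_sum].
by apply: eq_sint => e _; rewrite big_cons Pi.
Qed.

Lemma le_sint n (f g : 'rV[R]_n -> R) : (0 < n)%N -> scont f -> scont g ->
  on_sphere (fun e => f e <= g e) -> sint f <= sint g.
Proof.
move=> n0 cf cg fg; apply: le_Rintegral; first exact: measurable_unit_sphere.
- exact: sint_integrable.
- exact: sint_integrable.
- exact: fg.
Qed.

Lemma le_norm_sint n (f : 'rV[R]_n -> R) : (0 < n)%N -> scont f ->
  `|sint f| <= sint (fun e => `|f e|).
Proof.
move=> n0 cf; apply: le_normr_Rintegral; first exact: measurable_unit_sphere.
exact: sint_integrable.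
Qed.

Lemma norm_sint_le n (f : 'rV[R]_n -> R) M : (0 < n)%N -> scont f ->
  on_sphere (fun e => `|f e| <= M) -> `|sint f| <= M.
Proof.
move=> n0 cf fM; apply: le_trans (le_norm_sint n0 cf) _.
rewrite -[leRHS](sint_cst M n0); apply: le_sint => //; first exact: scont_norm.
exact: scont_cst.
Qed.

Lemma sint_prot n (f : 'rV[R]_n -> R) (i j : 'I_n) (c s : R) : (0 < n)%N ->
  scont f -> i != j -> 0 < 1 + c -> c ^+ 2 + s ^+ 2 = 1 ->
  sint (fun e => f (prot i j c s e)) = sint f.
Proof.
move=> n0 cf ij c1 cs1; have [mr pr] := sphere_measure_prot ij c1 cs1.
have mS := @measurable_unit_sphere R n.
have mf := scont_measurable cf.
have rS : prot i j c s @^-1` unit_sphere (n:=n) = unit_sphere (n:=n).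
  by apply/seteqP; split => x; rewrite /unit_sphere/= enorm_prot.
(* The change of variables is applied to nonnegative functions, hence to the positive and negative
   parts of [f] separately. *)
have E (h : 'rV[R]_n -> \bar R) : measurable_fun (unit_sphere (n:=n)) h ->
    (forall x, 0 <= h x)%E ->
    (\int[@sphere_measure R n]_(e in @unit_sphere R n) h e =
     \int[@sphere_measure R n]_(e in @unit_sphere R n) (h (prot i j c s e)))%E.
  move=> mh h0.
  have := @ge0_integral_pushforward _ _ _ _ R _ mr (@sphere_measure R n)
    (unit_sphere (n:=n)) h mS mh (fun x _ => h0 x).
  rewrite rS => <-; apply: eq_measure_integral => A mA _.
  by rewrite /= /pushforward pr.
have mEf : measurable_fun (unit_sphere (n:=n)) (EFin \o f) by exact/measurable_EFinP.
have Ep := E (fun e => (EFin \o f)^\+ e)%E (measurable_funepos mEf) (funepos_ge0 _).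
have En := E (fun e => (EFin \o f)^\- e)%E (measurable_funeneg mEf) (funeneg_ge0 _).
rewrite /sint /Rintegral; congr fine.
apply: etrans (integralE _ _ _) _; apply: etrans (esym (integralE _ _ _)).
congr (_ - _)%E.
  by apply: etrans (etrans _ (esym Ep)) _; apply: eq_integral => x _; rewrite !funeposE.
by apply: etrans (etrans _ (esym En)) _; apply: eq_integral => x _; rewrite !funenegE.
Qed.

(** Joint continuity along the compact slice of the sphere at parameter [t]; it takes the place of a
    dominating function when limits pass under the integral. *)
Definition jcont n (T : topologicalType) (F : 'rV[R]_n -> T -> R) (t : T) :=
  on_sphere (fun e => {for (e, t), continuous (fun p => F p.1 p.2)}).

Lemma jcont_scont n (T : topologicalType) (F : 'rV[R]_n -> T -> R) t :
  jcont F t -> scont (F ^~ t).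
Proof.
move=> cF e Se.
have h := cF e Se.
exact: (cvg_comp2 (@cvg_id _ (nbhs e)) (@cvg_cst _ t _ (nbhs e) _) h).
Qed.

(** Tube lemma: compactness of the sphere makes the neighbourhood of [t0] uniform in [e]. Half of
    [eps] is spent at (e', t), half at (e', t0). *)
Lemma jcont_near n (T : topologicalType) (F : 'rV[R]_n -> T -> R) t0 (eps : R) :
  0 < eps -> jcont F t0 ->
  \forall t \near t0, on_sphere (fun e => `|F e t - F e t0| <= eps).
Proof.
move=> eps0 cF.
have /compact_near_coveringP := @compact_sphere n.
apply; move=> e Se.
have /cvgr_dist_lt/(_ (eps / 2))/(_ ltac:(lra)) h := cF e Se.
case: h => -[/= A B] [nA nB] AB.
exists (A, B) => //= -[e' t] /= [Ae' Bt].
have h1 := AB (e', t) (conj Ae' Bt).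
have h2 := AB (e', t0) (conj Ae' (nbhs_singleton nB)).
rewrite /= in h1 h2.
rewrite (_ : _ - _ = (F e t0 - F e' t0) - (F e t0 - F e' t)); last by ring.
by apply: le_trans (ler_normB _ _) _; lra.
Qed.

(** The filter is arbitrary so that it also covers parameters restricted to a set by [within]. *)
Lemma sint_cvg n (T : Type) (G : set_system T) (FG : Filter G)
    (F : 'rV[R]_n -> T -> R) (F0 : 'rV[R]_n -> R) : (0 < n)%N -> scont F0 ->
  (\forall t \near G, scont (F ^~ t)) ->
  (forall e, unit_sphere e -> F p.1 p.2 @[p --> (nbhs e, G)] --> F0 e) ->
  sint (F ^~ t) @[t --> G] --> sint F0.
Proof.
move=> n0 c0 cF cvF; apply/cvgrPdist_le => eps eps0.
have : \forall t \near G, on_sphere (fun e => `|F e t - F0 e| <= eps).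
  have /compact_near_coveringP := @compact_sphere n.
  apply; move=> e Se.
  have e2 : 0 < eps / 2 by lra.
  have /cvgr_dist_lt/(_ _ e2) h := cvF e Se.
  have /cvgr_dist_lt/(_ _ e2) h0 := c0 e Se.
  case: h => -[/= A B] [nA nB] AB.
  exists (A `&` [set e' | `|F0 e - F0 e'| < eps / 2], B) => /=.
    by split => //; apply: filterI.
  move=> -[e' t] /= [[Ae' h2] Bt].
  have h1 := AB (e', t) (conj Ae' Bt).
  rewrite /= in h1.
  rewrite (_ : _ - _ = (F0 e - F0 e') - (F0 e - F e' t)); last by ring.
  by apply: le_trans (ler_normB _ _) _; lra.
apply: filterS2 cF => t cFt h.
rewrite distrC -sintB//; apply: norm_sint_le => //; exact: scontB.
Qed.

Lemma sint_continuous n (T : topologicalType) (F : 'rV[R]_n -> T -> R) t0 :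
  (0 < n)%N -> (\forall t \near t0, jcont F t) ->
  {for t0, continuous (fun t => sint (F ^~ t))}.
Proof.
move=> n0 cF; have cF0 := nbhs_singleton cF.
apply: (sint_cvg _ n0 (jcont_scont cF0)).
  by apply: filterS cF => t; exact: jcont_scont.
by move=> e Se; exact: (cF0 e Se).
Qed.

(** Stated with a radius instead of an interval, so that [h] may have either sign. *)
Lemma mean_value (F dF : R -> R) (t0 h : R) :
  (forall x, `|x - t0| <= `|h| -> is_derive x 1 F (dF x)) ->
  exists2 c, `|c - t0| <= `|h| & F (t0 + h) - F t0 = dF c * h.
Proof.
move=> hF.
have mvt a b : a < b -> (forall x, a <= x <= b -> `|x - t0| <= `|h|) ->
    exists2 c, a <= c <= b & F b - F a = dF c * (b - a).
  move=> ab hab.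
  have [] := @MVT R F dF a b ab.
  - by move=> x; rewrite in_itv/= => /andP[ax xb]; apply: hF; apply: hab; rewrite !ltW.
  - apply: derivable_within_continuous => x; rewrite in_itv/= => axb.
    by have [] := hF x (hab x axb).
  - by move=> c; rewrite in_itv/= => /andP[ac cb] ->; exists c => //; rewrite !ltW.
have [hp|hn] := ltrP 0 h.
  have [||c /andP[c1 c2] E] := mvt t0 (t0 + h); first by rewrite ltrDl.
    by move=> x /andP[x1 x2]; rewrite !ger0_norm; lra.
  by exists c; [rewrite !ger0_norm; lra|rewrite E; ring].
have [->|h0] := eqVneq h 0.
  by exists t0; rewrite ?subrr ?normr0// addr0 subrr mulr0.
have hn' : h < 0 by rewrite lt_neqAle h0.
have [||c /andP[c1 c2] E] := mvt (t0 + h) t0; first by rewrite gtrDl.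
  by move=> x /andP[x1 x2]; rewrite !ler0_norm; lra.
exists c; first by rewrite !ler0_norm; lra.
by rewrite -opprB E; ring.
Qed.

(** For each [e] the difference quotient is [dF e c] at some [c] between, depending on [e]; by
    [jcont_near] it is close to [dF e t0] uniformly in [e], so the integrals converge. *)
Lemma sint_is_derive n (F dF : 'rV[R]_n -> R -> R) t0 : (0 < n)%N ->
  (\forall t \near t0, [/\ jcont F t, jcont dF t &
     on_sphere (fun e => is_derive t 1 (F e) (dF e t))]) ->
  is_derive t0 1 (fun t => sint (F ^~ t)) (sint (dF ^~ t0)).
Proof.
move=> n0 cF.
have [cF0 cdF0 dF0] := nbhs_singleton cF.
have cvgq : (fun h : R => h^-1 *: (sint (F ^~ (h *: 1 + t0)) - sint (F ^~ t0)))
    @ 0^' --> sint (dF ^~ t0).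
  apply/cvgrPdist_le => eps eps0.
  have : \forall t \near t0, [/\ jcont F t,
      on_sphere (fun e => is_derive t 1 (F e) (dF e t)) &
      on_sphere (fun e => `|dF e t - dF e t0| <= eps)].
    by have := jcont_near eps0 cdF0; apply: filterS2 cF => t [].
  move=> /nbhs_ballP[d /= d0 hd].
  near=> h.
  have h0 : h != 0 by near: h; exact: nbhs_dnbhs_neq.
  have hlt : `|h| < d.
    near: h; apply: nbhs_dnbhs; exists d => //= x; rewrite /ball_/= sub0r normrN//.
  have hball x : `|x - t0| <= `|h| -> ball t0 d x.
    by move=> xt; rewrite -ball_normE/= distrC (le_lt_trans xt).
  have Eh : h *: (1 : R) + t0 = t0 + h by rewrite addrC [_ *: _]mulr1.
  rewrite Eh.
  have [cFh _ _] := hd (t0 + h) (hball (t0 + h) ltac:(by rewrite addrAC subrr add0r)).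
  rewrite -sintB//; [|exact: jcont_scont|exact: jcont_scont].
  rewrite [_ *: _](_ : _ = h^-1 * sint (fun e => F e (t0 + h) - F e t0))//.
  have cB : scont (fun e => F e (t0 + h) - F e t0).
    by apply: scontB; exact: jcont_scont.
  rewrite -sintZl// -sintB//; [|exact: jcont_scont|by apply: scontM => //; exact: scont_cst].
  apply: norm_sint_le => //.
    apply: scontB; first exact: jcont_scont.
    by apply: scontM => //; exact: scont_cst.
  move=> e Se.
  have [c tc ->] : exists2 c, `|c - t0| <= `|h| & F e (t0 + h) - F e t0 = dF e c * h.
    by apply: mean_value => x xt; have [_ /(_ e Se)] := hd x (hball x xt).
  rewrite mulrCA mulVf// mulr1 distrC.
  by have [_ _ /(_ e Se)] := hd c (hball _ tc).
split; first by apply/cvg_ex; exists (sint (dF ^~ t0)).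
by apply: cvg_lim.
Unshelve. all: by end_near.
Qed.

End sphere_integral.

(** * Second derivatives along curves and polar form *)

Section calculus.
Context {R : realType}.

Lemma is_derive_line n (f : 'rV[R]_n -> R) (w e : 'rV[R]_n) (s d : R) :
  is_derive (w + s *: e) e f d -> is_derive s 1 (fun s => f (w + s *: e)) d.
Proof.
have E : (fun h : R => h^-1 *: (((fun s => f (w + s *: e)) \o shift s) (h *: 1) - f (w + s *: e)))
    = (fun h : R => h^-1 *: ((f \o shift (w + s *: e)) (h *: e) - f (w + s *: e))).
  by apply/funext => h /=; rewrite [h *: 1]mulr1 scalerDl addrCA.
by case=> df fd; split; [rewrite /derivable E|rewrite /derive E].
Qed.

(** [class_C1] speaks of partial derivatives only. The increment is therefore split along a path
    that changes one coordinate at a time, with the mean value theorem on each edge. *)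
Lemma C1_increment n (f : 'rV[R]_n -> R) (x v : 'rV[R]_n) :
  (forall z, `|z - x| <= `|v| -> forall i, derivable f z (delta_mx ord0 i)) ->
  exists xi : 'I_n -> 'rV[R]_n, (forall k, `|xi k - x| <= `|v|) /\
    f (x + v) - f x = \sum_k v ord0 k * pderive k f (xi k).
Proof.
move=> df.
(* Vertices of the path: the first m coordinates have been moved. In the sup norm the whole path
   stays within distance |v| of x. *)
pose w m : 'rV[R]_n := x + \row_i (if (i < m)%N then v ord0 i else 0).
have wS (k : 'I_n) : w k.+1 = w k + v ord0 k *: delta_mx ord0 k.
  apply/rowP => i; rewrite !mxE eqxx/= -addrA; congr (_ + _).
  rewrite ltnS leq_eqVlt -[(val i == val k)]/(i == k).
  have [->|ik] := eqVneq i k; first by rewrite ltnn/= mulr1 add0r.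
  by rewrite /= mulr0 addr0.
have wk (k : 'I_n) s : `|s| <= `|v ord0 k| -> `|w k + s *: delta_mx ord0 k - x| <= `|v|.
  move=> sv; rewrite [leLHS]mx_normrE; apply/bigmax_leP; split => // -[i j] _ /=.
  rewrite (ord1 i) (_ : _ _ j = (if (j < k)%N then v ord0 j else 0) + s * (j == k)%:R); last first.
    by rewrite !mxE eqxx/=; ring.
  have [->|jk] := eqVneq j k.
    by rewrite ltnn add0r mulr1; apply: le_trans sv _; exact: coord_le_norm.
  rewrite mulr0 addr0; case: ifP => _; first exact: coord_le_norm.
  by rewrite normr0.
have /choice[c hc] : forall k : 'I_n, exists c, `|c| <= `|v ord0 k| /\
    f (w k.+1) - f (w k) = v ord0 k * pderive k f (w k + c *: delta_mx ord0 k).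
  move=> k.
  have [|c] := @mean_value _ (fun s => f (w k + s *: delta_mx ord0 k))
    (fun s => pderive k f (w k + s *: delta_mx ord0 k)) 0 (v ord0 k).
    move=> s; rewrite subr0 => sv; apply: is_derive_line.
    by apply: DeriveDef => //; apply: df; exact: wk.
  rewrite subr0 add0r scale0r addr0 -wS mulrC => cv E; exists c; split => //.
exists (fun k : 'I_n => w k + c k *: delta_mx ord0 k); split.
  by move=> k; apply: wk; have [] := hc k.
transitivity (\sum_(0 <= k < n) (f (w k.+1) - f (w k))).
  rewrite telescope_sumr//; congr (f _ - f _).
    by apply/rowP => i; rewrite !mxE ltn_ord.
  by apply/rowP => i; rewrite !mxE ltn0 addr0.
by rewrite big_mkord; apply: eq_bigr => k _; have [] := hc k.
Qed.

Lemma chain_rule n (U : set 'rV[R]_n) (f : 'rV[R]_n -> R) (c : R -> 'rV[R]_n)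
    (c1 : 'rV[R]_n) t : open U -> class_C1 U f -> U (c t) ->
  (forall i, is_derive t 1 (fun s => c s ord0 i) (c1 ord0 i)) ->
  is_derive t 1 (f \o c) (dotv c1 (gradient f (c t))).
Proof.
move=> oU Cf Ux dc.
pose x := c t.
have /nbhs_ballP[d /= d0 dU] : nbhs x U by exact: open_nbhs_nbhs.
have ct : c (t + h) @[h --> 0^'] --> x.
  have h1 : {for t, continuous c}.
    apply/differentiable_continuous/derivable1_diffP/derivable_mxP => i j.
    by rewrite (ord1 i); have [] := dc j.
  apply: (@cvg_comp _ _ _ (fun h => t + h) c _ (nbhs t)) => //.
  apply/cvgrPdist_lt => eps eps0; near=> h.
  rewrite opprD addrA subrr add0r normrN.
  by near: h; exact: dnbhs0_lt.
have vt : (c (t + h) - x) @[h --> 0^'] --> (0 : 'rV[R]_n).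
  by rewrite -(subrr x); apply: cvgB => //; exact: cvg_cst.
pose good h (xi : 'I_n -> 'rV[R]_n) := (forall k, `|xi k - x| <= `|c (t + h) - x|) /\
    f (c (t + h)) - f x = \sum_k (c (t + h) - x) ord0 k * pderive k f (xi k).
(* The intermediate points are chosen for all [h] at once; when the curve has left the ball of
   radius [d] the value 0 is a mere default. *)
have /choice[xi hxi] : forall h, exists xi, `|c (t + h) - x| < d -> good h xi.
  move=> h; have [hd|] := boolP (`|c (t + h) - x| < d); last by exists (fun=> 0).
  have [|xi [h1 h2]] := @C1_increment n f x (c (t + h) - x).
    move=> z zx i; have /Cf[_ /(_ i)[]//] : U z.
    by apply: dU; rewrite -ball_normE/= distrC (le_lt_trans zx).
  exists xi => _; split => //; rewrite -h2.
  by have -> : x + (c (t + h) - x) = c (t + h) by rewrite addrC subrK.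
have near_good : \forall h \near (0 : R)^', good h (xi h).
  have /cvgrPdist_lt/(_ d d0) := vt; apply: filterS => h.
  by rewrite sub0r normrN => /hxi.
have xit k : xi h k @[h --> (0 : R)^'] --> x.
  apply/cvgrPdist_le => eps eps0.
  have /cvgrPdist_le/(_ eps eps0) := vt; apply: filterS2 near_good => h [hx _].
  rewrite sub0r normrN => ce; rewrite distrC; exact: le_trans (hx k) ce.
have L : (\sum_k (h^-1 * (c (t + h) - x) ord0 k) * pderive k f (xi h k))
    @[h --> (0 : R)^'] --> dotv c1 (gradient f x).
  apply: cvg_sumr => k _; rewrite mxE; apply: cvgM; last first.
    apply: (@cvg_comp _ _ _ (fun h => xi h k) (pderive k f) _ (nbhs x)); first exact: xit.
    by have [_ /(_ k)[]] := Cf x Ux.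
  have [dck ck] := dc k; rewrite -ck.
  apply: cvg_trans dck; apply: near_eq_cvg; near=> h.
  by rewrite !mxE /= [h *: 1]mulr1 [h + t]addrC.
have L2 : (fun h => h^-1 *: (((f \o c) \o shift t) (h *: 1) - (f \o c) t))
    @ (0 : R)^' --> dotv c1 (gradient f x).
  apply: cvg_trans L; apply: near_eq_cvg; apply: filterS near_good => h [_ E].
  rewrite /= [h *: 1]mulr1 [h + t]addrC E -[_ *: _]/(_ * _) mulr_sumr.
  by apply: eq_bigr => k _; rewrite mulrA.
split; first by apply/cvg_ex; exists (dotv c1 (gradient f x)).
exact: cvg_lim.
Unshelve. all: by end_near. Qed.

Lemma cvg_rV n (T : Type) (F : set_system T) (FF : Filter F)
    (f : T -> 'rV[R]_n) (x : 'rV[R]_n) :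
  (forall i, f t ord0 i @[t --> F] --> x ord0 i) -> f t @[t --> F] --> x.
Proof.
move=> fx; apply/cvgrPdist_le => e e0.
have : \forall t \near F, forall i, `|x ord0 i - f t ord0 i| <= e.
  apply: filter_forall => i; have /cvgrPdist_le := fx i; exact.
apply: filterS => t h; rewrite [leLHS]mx_normrE; apply/bigmax_leP.
split; first exact: ltW.
by move=> [i j] _ /=; rewrite (ord1 i) !mxE.
Qed.

(** The second derivative of [f] along a curve through [x] with velocity [u] and acceleration [w]:
    the Hessian form at [u] plus the gradient paired with [w]. *)
Definition second_order n (f : 'rV[R]_n -> R) (x u w : 'rV[R]_n) : R :=
  dotv w (gradient f x) + \sum_k u ord0 k * dotv u (gradient (pderive k f) x).

Lemma chain_rule2 n (U : set 'rV[R]_n) (f : 'rV[R]_n -> R) (c c1 : R -> 'rV[R]_n)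
    (c2 : 'rV[R]_n) t : open U -> class_C2 U f -> U (c t) ->
  (forall i, is_derive t 1 (fun s => c s ord0 i) (c1 t ord0 i)) ->
  (forall i, is_derive t 1 (fun s => c1 s ord0 i) (c2 ord0 i)) ->
  is_derive t 1 (fun s => dotv (c1 s) (gradient f (c s)))
    (second_order f (c t) (c1 t) c2).
Proof.
move=> oU [Cf Cf2] Ux dc dc1.
have dk k : is_derive t 1 (pderive k f \o c) (dotv (c1 t) (gradient (pderive k f) (c t))).
  exact: (@chain_rule _ U).
rewrite (_ : (fun s => _) = \sum_k (fun s => c1 s ord0 k * pderive k f (c s))); last first.
  by apply/funext => s; rewrite fct_sumE; apply: eq_bigr => k _; rewrite mxE.
apply: is_derive_eq.
rewrite /second_order /dotv -big_split; apply: eq_bigr => k _ /=.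
by rewrite !mxE -![_ *: _]/(_ * _) addrC; congr (_ + _); rewrite mulrC.
Qed.

(** [prot] without the identity on the other coordinates. It is linear in (c, s), so derivatives of
    a rotation in its angle are obtained by differentiating c and s: (0, 1) is the velocity and (-1,
    0) the acceleration at angle 0. *)
Definition prot_part n (i j : 'I_n) (c s : R) (x : 'rV[R]_n) : 'rV[R]_n :=
  (c * x ord0 i - s * x ord0 j) *: delta_mx ord0 i
    + (s * x ord0 i + c * x ord0 j) *: delta_mx ord0 j.

Lemma prot_partE n (i j : 'I_n) (c s : R) (x : 'rV[R]_n) k :
  prot_part i j c s x ord0 k = (c * x ord0 i - s * x ord0 j) * (k == i)%:R
    + (s * x ord0 i + c * x ord0 j) * (k == j)%:R.
Proof. by rewrite !mxE eqxx. Qed.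

Lemma prot10 n (i j : 'I_n) (x : 'rV[R]_n) : prot i j 1 0 x = x.
Proof. by apply/rowP => k; rewrite protE; ring. Qed.

(** [g] and [H] stand for the gradient and the Hessian. The sum over all pairs factors; on the
    diagonal the [H] terms cancel and -2 x_i g_i is left, which turns n into n - 1. *)
Lemma sum_offdiag n (x g : 'I_n -> R) (H : 'I_n -> 'I_n -> R) :
  \sum_(p : 'I_n * 'I_n | p.1 != p.2)
    (- (x p.1 * g p.1 + x p.2 * g p.2)
     + (x p.2 ^+ 2 * H p.1 p.1 + x p.1 ^+ 2 * H p.2 p.2
        - (x p.1 * x p.2 * H p.1 p.2 + x p.1 * x p.2 * H p.2 p.1))) =
  2 * ((\sum_i x i ^+ 2) * (\sum_i H i i) - \sum_i \sum_j x i * x j * H i j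
       - (n%:R - 1) * \sum_i x i * g i).
Proof.
pose A (i j : 'I_n) := x i * g i.
pose B (i j : 'I_n) := x j * g j.
pose C (i j : 'I_n) := x j ^+ 2 * H i i.
pose D (i j : 'I_n) := x i ^+ 2 * H j j.
pose E1 (i j : 'I_n) := x i * x j * H i j.
pose E2 (i j : 'I_n) := x i * x j * H j i.
pose T i j := - (A i j + B i j) + (C i j + D i j - (E1 i j + E2 i j)).
have ei : \sum_i \sum_j A i j = n%:R * \sum_i x i * g i.
  rewrite mulr_sumr; apply: eq_bigr => i _.
  by rewrite sumr_const card_ord mulr_natl.
have ej : \sum_i \sum_j B i j = n%:R * \sum_i x i * g i.
  by rewrite /B sumr_const card_ord mulr_natl.
have h1 : \sum_i \sum_j C i j = (\sum_i x i ^+ 2) * (\sum_i H i i).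
  by rewrite mulr_sumr; apply: eq_bigr => i _; rewrite -mulr_suml.
have h2 : \sum_i \sum_j D i j = (\sum_i x i ^+ 2) * (\sum_i H i i).
  by rewrite mulr_suml; apply: eq_bigr => i _; rewrite -mulr_sumr.
have h3 : \sum_i \sum_j E2 i j = \sum_i \sum_j E1 i j.
  rewrite [LHS]exchange_big; apply: eq_bigr => i _; apply: eq_bigr => j _.
  by rewrite /E1 /E2 [x _ * x _]mulrC.
have S : \sum_i \sum_j T i j = 2 * ((\sum_i x i ^+ 2) * (\sum_i H i i)
    - \sum_i \sum_j E1 i j - n%:R * \sum_i x i * g i).
  transitivity (- (\sum_i \sum_j A i j + \sum_i \sum_j B i j)
    + (\sum_i \sum_j C i j + \sum_i \sum_j D i j
       - (\sum_i \sum_j E1 i j + \sum_i \sum_j E2 i j))); last first.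
    by rewrite ei ej h1 h2 h3; ring.
  rewrite -!big_split -!sumrN -!big_split; apply: eq_bigr => i _ /=.
  by rewrite -!big_split -!sumrN -!big_split.
have DD : \sum_i T i i = - 2 * \sum_i x i * g i.
  rewrite mulr_sumr; apply: eq_bigr => i _; rewrite /T /A /B /C /D /E1 /E2.
  by ring.
transitivity (\sum_(p : 'I_n * 'I_n | p.1 != p.2) T p.1 p.2); first by [].
have -> : \sum_(p : 'I_n * 'I_n | p.1 != p.2) T p.1 p.2 =
    \sum_i \sum_j T i j - \sum_i T i i.
  rewrite pair_big_dep/= [X in _ = X - _](bigID (fun p : 'I_n * 'I_n => p.1 == p.2))/=.
  rewrite [X in _ = X + _ - _](_ : _ = \sum_i T i i); first by rewrite addrAC subrr add0r.
  rewrite -(pair_big_dep xpredT (fun i j => i == j) T)/=.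
  by apply: eq_bigr => i _; under eq_bigl do rewrite eq_sym; rewrite big_pred1_eq.
by rewrite S DD /E1; ring.
Qed.

(** At y = x this is the expression of the spherical Laplacian by squares of the fields x_i d_j -
    x_j d_i; the factor 2 comes from summing over ordered pairs. *)
Lemma sum_second_order_prot n (f : 'rV[R]_n -> R) (x y : 'rV[R]_n) :
  \sum_(p : 'I_n * 'I_n | p.1 != p.2)
     second_order f y (prot_part p.1 p.2 0 1 x) (prot_part p.1 p.2 (-1) 0 x) =
  2 * (dotv x x * laplacian f y - second_order f y x 0
       - (n%:R - 1) * dotv x (gradient f y)).
Proof.
pose g k := pderive k f y; pose H k l := pderive l (pderive k f) y.
have dsum k (a : 'I_n -> R) : \sum_l a l * (l == k)%:R = a k.
  rewrite (bigD1 k)//= eqxx mulr1 big1 ?addr0// => l /negbTE ->.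
  by rewrite mulr0.
have E (p : 'I_n * 'I_n) : second_order f y (prot_part p.1 p.2 0 1 x)
    (prot_part p.1 p.2 (-1) 0 x) = - (x ord0 p.1 * g p.1 + x ord0 p.2 * g p.2)
     + (x ord0 p.2 ^+ 2 * H p.1 p.1 + x ord0 p.1 ^+ 2 * H p.2 p.2
        - (x ord0 p.1 * x ord0 p.2 * H p.1 p.2 + x ord0 p.1 * x ord0 p.2 * H p.2 p.1)).
  case: p => i j /=.
  have dp c s (a : 'I_n -> R) : \sum_k prot_part i j c s x ord0 k * a k =
      (c * x ord0 i - s * x ord0 j) * a i + (s * x ord0 i + c * x ord0 j) * a j.
    transitivity (\sum_k ((c * x ord0 i - s * x ord0 j) * a k * (k == i)%:R
        + (s * x ord0 i + c * x ord0 j) * a k * (k == j)%:R)).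
      by apply: eq_bigr => k _; rewrite prot_partE; ring.
    by rewrite big_split/= !dsum.
  have dpg c s (h : 'rV[R]_n -> R) : dotv (prot_part i j c s x) (gradient h y) =
      (c * x ord0 i - s * x ord0 j) * pderive i h y + (s * x ord0 i + c * x ord0 j) * pderive j h y.
    by rewrite -(dp c s (fun k => pderive k h y)); apply: eq_bigr => k _; congr (_ * _); rewrite mxE.
  rewrite /second_order dpg.
  under eq_bigr do rewrite dpg.
  rewrite (dp 0 1 (fun k => (0 * x ord0 i - 1 * x ord0 j) * pderive i (pderive k f) y
    + (1 * x ord0 i + 0 * x ord0 j) * pderive j (pderive k f) y)).
  rewrite -/(g i) -/(g j) -/(H i i) -/(H i j) -/(H j i) -/(H j j).
  move: (x ord0 i) (x ord0 j) (g i) (g j) (H i i) (H i j) (H j i) (H j j) => *.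
  by ring.
under eq_bigr do rewrite E.
rewrite (sum_offdiag (fun i => x ord0 i) g H); congr (2 * (_ - _ - _ * _)).
- rewrite /second_order (_ : dotv 0 _ = 0) ?add0r; last first.
    by rewrite /dotv big1// => k _; rewrite mxE mul0r.
  apply: eq_bigr => k _; rewrite /dotv mulr_sumr; apply: eq_bigr => l _.
  by rewrite mxE mulrA.
- by apply: eq_bigr => k _; rewrite mxE.
Qed.

(** The Laplacian is f'' + (n-1)/s f' in the radius plus 1/(2 s^2) times the sum of the squared
    rotation fields over ordered pairs. One factor 1 - s^2 of the hyperbolic Laplacian, nonzero
    here, is cancelled. *)
Lemma H_harmonic_polar n (f : 'rV[R]_n -> R) (e : 'rV[R]_n) (s : R) :
  H_harmonic f -> unit_sphere e -> 0 < s < 1 ->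
  (1 - s ^+ 2) * (second_order f (s *: e) e 0
     + (n%:R - 1) / s * dotv e (gradient f (s *: e))
     + 2^-1 * s ^- 2 * \sum_(p : 'I_n * 'I_n | p.1 != p.2)
        second_order f (s *: e) (s *: prot_part p.1 p.2 0 1 e)
          (s *: prot_part p.1 p.2 (-1) 0 e))
  + 2 * (n%:R - 2) * s * dotv e (gradient f (s *: e)) = 0.
Proof.
move=> [_ hf] Se /andP[s0 s1].
have es : enorm (s *: e) = s by rewrite enormZ Se mulr1 gtr0_norm.
have xB : unit_ball (s *: e) by rewrite /unit_ball/= es.
have := hf _ xB; rewrite /hyperbolic_laplacian es => /eqP.
rewrite mulf_eq0 => /orP[/eqP s2|/eqP h].
  have : s ^+ 2 < 1 by rewrite expr_lt1// ltW.
  lra.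
have protZ' c d p : s *: prot_part p.1 p.2 c d e = prot_part (n:=n) p.1 p.2 c d (s *: e).
  by apply/rowP => k; rewrite [LHS]mxE !prot_partE !mxE; ring.
under eq_bigr do rewrite !protZ'.
rewrite sum_second_order_prot dotvZl dotvZr (unit_sphereE e).1// mulr1.
have -> : second_order f (s *: e) (s *: e) 0 = s ^+ 2 * second_order f (s *: e) e 0.
  rewrite /second_order.
  have d0 y : dotv 0 y = 0 :> R by rewrite /dotv big1// => k _; rewrite mxE mul0r.
  rewrite !d0 !add0r mulr_sumr; apply: eq_bigr => k _.
  by rewrite mxE dotvZl; ring.
rewrite dotvZl in h *.
rewrite -[RHS]h; field; rewrite gt_eqF//.
Qed.

End calculus.

(** * Rules of differentiation *)

Section derivation_rules.
Context {R : realType} {V : normedModType R}.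
Implicit Types (f g : V -> R) (x v : V).

Lemma is_derive_to f x v (d d' : R) : is_derive x v f d -> d = d' -> is_derive x v f d'.
Proof. by move=> + <-. Qed.

Lemma is_derive_const (c : R) x v : is_derive x v (fun=> c) 0.
Proof. exact: is_derive_cst. Qed.

Lemma is_derive_add f g x v df dg : is_derive x v f df -> is_derive x v g dg ->
  is_derive x v (fun y => f y + g y) (df + dg).
Proof. by move=> hf hg; exact: is_deriveD. Qed.

Lemma is_derive_sub f g x v df dg : is_derive x v f df -> is_derive x v g dg ->
  is_derive x v (fun y => f y - g y) (df - dg).
Proof. by move=> hf hg; exact: is_deriveB. Qed.

Lemma is_derive_mul f g x v df dg : is_derive x v f df -> is_derive x v g dg ->
  is_derive x v (fun y => f y * g y) (df * g x + f x * dg).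
Proof.
move=> hf hg; rewrite addrC [df * _]mulrC; exact: is_deriveM.
Qed.

Lemma is_derive_exp f x v df k : is_derive x v f df ->
  is_derive x v (fun y => f y ^+ k) (k%:R * f x ^+ k.-1 * df).
Proof.
move=> hf; elim: k => [|k IH].
  by rewrite !mul0r; exact: is_derive_cst.
under eq_fun do rewrite exprS.
apply: (is_derive_to (is_derive_mul hf IH)).
case: k {IH} => [|k] /=; first by rewrite !expr0; ring.
by rewrite -[k.+2%:R]natr1 exprS; ring.
Qed.

Lemma is_derive_inv f x v df : f x != 0 -> is_derive x v f df ->
  is_derive x v (fun y => (f y)^-1) (- df / f x ^+ 2).
Proof.
move=> fx [hf <-]; split; first exact: derivableV.
rewrite deriveV// -[_ *: _]/(_ * _); field.
by [].
Qed.

Lemma is_derive_mulc f c x v df : is_derive x v f df ->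
  is_derive x v (fun y => c * f y) (c * df).
Proof.
move=> hf; apply: (is_derive_to (is_derive_mul (is_derive_const c x v) hf)).
by rewrite mul0r add0r.
Qed.

End derivation_rules.

(** * Criteria for differentiability and C2 regularity *)

Section regularity.
Context {R : realType}.

Lemma is_derive_dotvl n (z x v : 'rV[R]_n) :
  is_derive x v (fun y => dotv y z) (dotv v z).
Proof.
have E : (fun h : R => h^-1 *: (((fun y => dotv y z) \o shift x) (h *: v) - dotv x z))
    @ 0^' --> dotv v z.
  have : (fun=> dotv v z) h @[h --> (0 : R)^'] --> dotv v z by exact: cvg_cst.
  apply: cvg_trans; apply: near_eq_cvg; near=> h.
  have h0 : h != 0 by near: h; exact: nbhs_dnbhs_neq.
  rewrite /= dotvDl dotvZl addrK -[_ *: _]/(_ * _) mulKf//.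
split; first by apply/cvg_ex; exists (dotv v z).
exact: cvg_lim.
Unshelve. all: by end_near. Qed.

Lemma is_derive_dotvv n (x v : 'rV[R]_n) :
  is_derive x v (fun y => dotv y y) (2 * dotv x v).
Proof.
have E : (fun h : R => h^-1 *: (((fun y => dotv y y) \o shift x) (h *: v) - dotv x x))
    @ 0^' --> 2 * dotv x v.
  have : 2 * dotv x v + h * dotv v v @[h --> (0 : R)^'] --> 2 * dotv x v + 0 * dotv v v.
    apply: cvgD; first exact: cvg_cst.
    apply: cvgM; last exact: cvg_cst.
    exact: nbhs_dnbhs.
  rewrite mul0r addr0; apply: cvg_trans; apply: near_eq_cvg; near=> h.
  have h0 : h != 0 by near: h; exact: nbhs_dnbhs_neq.
  rewrite /= dotvDl !dotvDr !dotvZl !dotvZr (dotvC v x) -[_ *: _]/(_ * _).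
  by field.
split; first by apply/cvg_ex; exists (2 * dotv x v).
exact: cvg_lim.
Unshelve. all: by end_near. Qed.

Lemma is_derive_of_line n (f : 'rV[R]_n -> R) (x e : 'rV[R]_n) (d : R) :
  is_derive (0 : R) 1 (fun s => f (x + s *: e)) d -> is_derive x e f d.
Proof.
have E : (fun h : R => h^-1 *: (((fun s => f (x + s *: e)) \o shift 0) (h *: 1) - f (x + 0 *: e)))
    = (fun h : R => h^-1 *: ((f \o shift x) (h *: e) - f x)).
  by apply/funext => h /=; rewrite [h *: 1]mulr1 addr0 scale0r addr0 [x + _]addrC.
by case=> df fd; split; [rewrite /derivable -E|rewrite /derive -E].
Qed.

Lemma near_eq_continuous (T : topologicalType) (f g : T -> R) x :
  (\forall y \near x, f y = g y) -> {for x, continuous f} -> {for x, continuous g}.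
Proof.
move=> fg cf; rewrite /prop_for /continuous_at -(nbhs_singleton fg).
by apply: cvg_trans cf; apply: near_eq_cvg; apply: filterS fg.
Qed.

(** The formulas [f1] agree with [pderive i f] only on [U]; openness makes the agreement hold near
    each point, which is what transfers derivatives and continuity. *)
Lemma C2_intro n (U : set 'rV[R]_n) (f : 'rV[R]_n -> R)
    (f1 : 'I_n -> 'rV[R]_n -> R) (f2 : 'I_n -> 'I_n -> 'rV[R]_n -> R) : open U ->
  (forall x i, U x -> is_derive x (delta_mx ord0 i) f (f1 i x)) ->
  (forall x i j, U x -> is_derive x (delta_mx ord0 j) (f1 i) (f2 i j x)) ->
  (forall x i j, U x -> {for x, continuous (f2 i j)}) ->
  (forall x i, U x -> {for x, continuous (f1 i)}) ->
  (forall x, U x -> {for x, continuous f}) ->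
  [/\ class_C2 U f, forall x i, U x -> pderive i f x = f1 i x &
      forall x i j, U x -> pderive j (pderive i f) x = f2 i j x].
Proof.
move=> oU h1 h2 c2 c1 c0.
have near_U x : U x -> \forall y \near x, U y by move=> Ux; exact: open_nbhs_nbhs.
have e1 x i : U x -> pderive i f x = f1 i x by move=> Ux; have [] := h1 x i Ux.
have h2' x i j : U x -> is_derive x (delta_mx ord0 j) (pderive i f) (f2 i j x).
  move=> Ux; apply: (near_eq_is_derive _ (h2 x i j Ux)).
  by apply: filterS (near_U x Ux) => y Uy; rewrite e1.
have e2 x i j : U x -> pderive j (pderive i f) x = f2 i j x.
  by move=> Ux; have [] := h2' x i j Ux.
have c1' x i : U x -> {for x, continuous (pderive i f)}.
  move=> Ux; apply: near_eq_continuous (c1 x i Ux).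
  by apply: filterS (near_U x Ux) => y Uy; rewrite e1.
have c2' x i j : U x -> {for x, continuous (pderive j (pderive i f))}.
  move=> Ux; apply: near_eq_continuous (c2 x i j Ux).
  by apply: filterS (near_U x Ux) => y Uy; rewrite e2.
split => //; split => [x Ux|i x Ux]; (split => [|j]; [|split]).
- exact: c0.
- by have [] := h1 x j Ux.
- exact: c1'.
- exact: c1'.
- by have [] := h2' x i j Ux.
- exact: c2'.
Qed.

End regularity.

(** * The hyperbolic Poisson kernel *)

Section poisson.
Context {R : realType} (n : nat).
Implicit Types x z : 'rV[R]_n.

(** Equal to |x - z|^2 when z is a unit vector; as a polynomial it makes sense for every z. *)
Definition pden z x : R := 1 + dotv x x - 2 * dotv x z.
Definition pquo z x : R := (1 - dotv x x) / pden z x.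
Definition poisson z x : R := pquo z x ^+ (n - 1).

(** The partial derivative of [pquo] in x_i, simplified with [pden z x] + (1 - |x|^2) = 2 (1 -
    <x,z>). *)
Definition pquo1 (i : 'I_n) z x : R :=
  (2 * z ord0 i * (1 - dotv x x) - 4 * (1 - dotv x z) * x ord0 i) * (pden z x ^+ 2)^-1.

Definition pquo2 (i j : 'I_n) z x : R :=
  (4 * z ord0 j * x ord0 i - 4 * z ord0 i * x ord0 j
    - 4 * (1 - dotv x z) * (i == j)%:R) * (pden z x ^+ 2)^-1
  - 4 * (x ord0 j - z ord0 j) * (2 * z ord0 i * (1 - dotv x x) - 4 * (1 - dotv x z) * x ord0 i)
    * (pden z x ^+ 3)^-1.

Definition poisson1 i z x : R := (n - 1)%:R * pquo z x ^+ (n - 1).-1 * pquo1 i z x.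

Definition poisson2 i j z x : R :=
  (n - 1)%:R * ((n - 1).-1%:R * pquo z x ^+ (n - 1).-2 * pquo1 j z x * pquo1 i z x
     + pquo z x ^+ (n - 1).-1 * pquo2 i j z x).

Lemma pden_ge z x : unit_sphere z -> (1 - enorm x) ^+ 2 <= pden z x.
Proof.
move=> Sz; rewrite /pden -sqr_enorm.
have := ler_norm (dotv x z); have := dotv_le x z; rewrite Sz mulr1.
have -> : (1 - enorm x) ^+ 2 = 1 + enorm x ^+ 2 - 2 * enorm x by ring.
lra.
Qed.

Lemma pden_gt0 z x : unit_sphere z -> unit_ball x -> 0 < pden z x.
Proof.
move=> Sz xB; apply: lt_le_trans (pden_ge x Sz).
by rewrite exprn_gt0// subr_gt0.
Qed.

Lemma pden_neq0 z x : unit_sphere z -> unit_ball x -> pden z x != 0.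
Proof. by move=> Sz xB; rewrite gt_eqF// pden_gt0. Qed.

Lemma pdenC z x r : unit_sphere z -> unit_sphere x -> pden z (r *: x) = pden x (r *: z).
Proof.
move=> /unit_sphereE Sz /unit_sphereE Sx.
by rewrite /pden !dotvZl !dotvZr Sz Sx (dotvC z x).
Qed.

(** |z - r x| = |x - r z| for unit vectors. This lets pole and direction trade places, so an
    integral over poles becomes an integral over a sphere of radius r. *)
Lemma poissonC z x r : unit_sphere z -> unit_sphere x ->
  poisson z (r *: x) = poisson x (r *: z).
Proof.
move=> Sz Sx; rewrite /poisson /pquo pdenC// !dotvZl !dotvZr.
by rewrite (unit_sphereE z).1// (unit_sphereE x).1.
Qed.

Lemma poisson_ge0 z x : unit_sphere z -> unit_ball x -> 0 <= poisson z x.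
Proof.
move=> Sz xB; apply: exprn_ge0; apply: divr_ge0; last exact/ltW/pden_gt0.
by rewrite subr_ge0; apply/ltW/unit_ballE.
Qed.

Lemma is_derive_pden z x v : is_derive x v (pden z) (2 * dotv x v - 2 * dotv v z).
Proof.
apply: (is_derive_to (is_derive_sub (is_derive_add (is_derive_const 1 x v)
  (is_derive_dotvv x v)) (is_derive_mulc 2 (is_derive_dotvl z x v)))).
by rewrite add0r.
Qed.

Lemma is_derive_coord x v i : is_derive x v (fun y : 'rV[R]_n => y ord0 i) (v ord0 i).
Proof.
rewrite -dotv_delta; under eq_fun do rewrite -dotv_delta.
exact: is_derive_dotvl.
Qed.

Lemma is_derive_pquo z x i : unit_sphere z -> unit_ball x ->
  is_derive x (delta_mx ord0 i) (pquo z) (pquo1 i z x).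
Proof.
move=> Sz xB; have q0 := pden_neq0 Sz xB.
apply: (is_derive_to (is_derive_mul
  (is_derive_sub (is_derive_const 1 x _) (is_derive_dotvv x _))
  (is_derive_inv q0 (is_derive_pden z x _)))).
rewrite /pquo1 !dotv_delta (dotvC _ z) dotv_delta.
move: q0; rewrite /pden; set b := dotv x z; set X := dotv x x => q0.
by field; rewrite q0.
Qed.

Lemma is_derive_pquo1 z x i j : unit_sphere z -> unit_ball x ->
  is_derive x (delta_mx ord0 j) (pquo1 i z) (pquo2 i j z x).
Proof.
move=> Sz xB; have q0 := pden_neq0 Sz xB.
have q2 : pden z x ^+ 2 != 0 by rewrite expf_neq0.
pose v : 'rV[R]_n := delta_mx ord0 j.
have h1 := is_derive_mulc (2 * z ord0 i)
  (is_derive_sub (is_derive_const 1 x v) (is_derive_dotvv x v)).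
have h2 := is_derive_mul (is_derive_mulc 4
  (is_derive_sub (is_derive_const 1 x v) (is_derive_dotvl z x v))) (is_derive_coord x v i).
have h3 := @is_derive_inv _ _ (fun y => pden z y ^+ 2) x v _ q2
  (is_derive_exp 2 (is_derive_pden z x v)).
apply: (is_derive_to (is_derive_mul (is_derive_sub h1 h2) h3)).
rewrite /v {h1 h2 h3 v}.
rewrite /pquo2 !dotv_delta (dotvC _ z) dotv_delta mxE eqxx/=.
move: q0; rewrite /pden; set b := dotv x z; set X := dotv x x => q0.
by field; rewrite q0.
Qed.

Lemma is_derive_poisson z x i : unit_sphere z -> unit_ball x ->
  is_derive x (delta_mx ord0 i) (poisson z) (poisson1 i z x).
Proof. by move=> Sz xB; apply: is_derive_exp; exact: is_derive_pquo. Qed.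

Lemma is_derive_poisson1 z x i j : unit_sphere z -> unit_ball x ->
  is_derive x (delta_mx ord0 j) (poisson1 i z) (poisson2 i j z x).
Proof.
move=> Sz xB.
apply: (is_derive_to (is_derive_mul
  (is_derive_mulc (n - 1)%:R (is_derive_exp (n - 1).-1 (is_derive_pquo j Sz xB)))
  (is_derive_pquo1 i j Sz xB))).
by rewrite /poisson2; ring.
Qed.

(** * Joint continuity of the kernel and its derivatives in pole and point *)

Section limits.
Variables (T : Type) (F : set_system T) (FF : Filter F).
Variables (f g : T -> 'rV[R]_n) (z x : 'rV[R]_n).
Hypotheses (fz : f t @[t --> F] --> z) (gx : g t @[t --> F] --> x).
Hypotheses (Sz : unit_sphere z) (xB : unit_ball x).

Let cst (c : R) : (fun=> c) t @[t --> F] --> c.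
Proof. exact: cvg_cst. Qed.

Let exps (h : T -> R) (l : R) k : h t @[t --> F] --> l -> h t ^+ k @[t --> F] --> l ^+ k.
Proof.
move=> hl; elim: k => [|k IH]; first exact: cst.
by rewrite exprS; under eq_fun do rewrite exprS; exact: cvgM.
Qed.

Let cvg_xx := cvg_dotv FF gx gx.
Let cvg_xz := cvg_dotv FF gx fz.

Lemma cvg_pden : pden (f t) (g t) @[t --> F] --> pden z x.
Proof.
apply: cvgB; last by apply: cvgM; [exact: cst|exact: cvg_xz].
by apply: cvgD; [exact: cst|exact: cvg_xx].
Qed.

Lemma cvg_pquo : pquo (f t) (g t) @[t --> F] --> pquo z x.
Proof.
apply: cvgM; first by apply: cvgB; [exact: cst|exact: cvg_xx].
by apply: cvgV; [exact: pden_neq0|exact: cvg_pden].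
Qed.

Lemma cvg_poisson : poisson (f t) (g t) @[t --> F] --> poisson z x.
Proof. exact: exps cvg_pquo. Qed.

Let cvg_num i : 2 * f t ord0 i * (1 - dotv (g t) (g t))
    - 4 * (1 - dotv (g t) (f t)) * g t ord0 i @[t --> F] -->
  2 * z ord0 i * (1 - dotv x x) - 4 * (1 - dotv x z) * x ord0 i.
Proof.
apply: cvgB; apply: cvgM.
- by apply: cvgM; [exact: cst|exact: cvg_coord].
- by apply: cvgB; [exact: cst|exact: cvg_xx].
- by apply: cvgM; [exact: cst|apply: cvgB; [exact: cst|exact: cvg_xz]].
- exact: cvg_coord.
Qed.

Let cvg_denV k : (pden (f t) (g t) ^+ k)^-1 @[t --> F] --> (pden z x ^+ k)^-1.
Proof.
apply: cvgV; first by rewrite expf_neq0// pden_neq0.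
exact: exps cvg_pden.
Qed.

Lemma cvg_pquo1 i : pquo1 i (f t) (g t) @[t --> F] --> pquo1 i z x.
Proof. by apply: cvgM; [exact: cvg_num|exact: cvg_denV]. Qed.

Lemma cvg_pquo2 i j : pquo2 i j (f t) (g t) @[t --> F] --> pquo2 i j z x.
Proof.
apply: cvgB; apply: cvgM; [|exact: cvg_denV| |exact: cvg_denV].
- apply: cvgB; [apply: cvgB|].
  + by apply: cvgM; [apply: cvgM; [exact: cst|]|]; exact: cvg_coord.
  + by apply: cvgM; [apply: cvgM; [exact: cst|]|]; exact: cvg_coord.
  + apply: cvgM; last exact: cst.
    by apply: cvgM; [exact: cst|apply: cvgB; [exact: cst|exact: cvg_xz]].
- apply: cvgM; last exact: cvg_num.
  by apply: cvgM; [exact: cst|apply: cvgB; exact: cvg_coord].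
Qed.

Lemma cvg_poisson1 i : poisson1 i (f t) (g t) @[t --> F] --> poisson1 i z x.
Proof.
apply: cvgM; last exact: cvg_pquo1.
by apply: cvgM; [exact: cst|exact: exps cvg_pquo].
Qed.

Lemma cvg_poisson2 i j : poisson2 i j (f t) (g t) @[t --> F] --> poisson2 i j z x.
Proof.
apply: cvgM; first exact: cst.
apply: cvgD; apply: cvgM.
- apply: cvgM; last exact: cvg_pquo1.
  by apply: cvgM; [exact: cst|exact: exps cvg_pquo].
- exact: cvg_pquo1.
- exact: exps cvg_pquo.
- exact: cvg_pquo2.
Qed.

End limits.

Lemma poisson_C2 z : unit_sphere z ->
  [/\ class_C2 (@unit_ball R n) (poisson z),
      forall x i, unit_ball x -> pderive i (poisson z) x = poisson1 i z x &
      forall x i j, unit_ball x -> pderive j (pderive i (poisson z)) x = poisson2 i j z x].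
Proof.
move=> Sz; have idc (x : 'rV[R]_n) : id y @[y --> x] --> x by exact: cvg_id.
have zc (x : 'rV[R]_n) : (fun=> z) y @[y --> x] --> z by exact: (@cvg_cst _ z _ (nbhs x)).
apply: (C2_intro (f1 := fun i => poisson1 i z) (f2 := fun i j => poisson2 i j z)).
- exact: open_unit_ball.
- by move=> x i; exact: is_derive_poisson.
- by move=> x i j; exact: is_derive_poisson1.
- by move=> x i j xB; exact: (@cvg_poisson2 _ (nbhs x) _ (fun=> z) id z x (zc x) (idc x) Sz xB i j).
- by move=> x i xB; exact: (@cvg_poisson1 _ (nbhs x) _ (fun=> z) id z x (zc x) (idc x) Sz xB i).
- by move=> x xB; exact: (@cvg_poisson _ (nbhs x) _ (fun=> z) id z x (zc x) (idc x) Sz xB).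
Qed.

(** P is the power n - 1 of w = [pquo], so its Laplacian and radial derivative involve only <x, grad
    w>, |grad w|^2 and the Laplacian of w. These are [S1], [S2], [S3], rational functions of |x|^2
    and <x,z>, and the equation is a rational identity. *)
Lemma hyperbolic_poisson z x : (2 < n)%N -> unit_sphere z -> unit_ball x ->
  (1 - dotv x x) * ((1 - dotv x x) * (\sum_i poisson2 i i z x)
    + 2 * (n%:R - 2) * (\sum_i x ord0 i * poisson1 i z x)) = 0.
Proof.
move=> n2 Sz xB; have q0 := pden_neq0 Sz xB.
set X := dotv x x; set b := dotv x z; set q := pden z x in q0 *; set w := pquo z x.
have zz : dotv z z = 1 by exact/unit_sphereE.
have qE : q = 1 + X - 2 * b by [].
have S1 : \sum_i x ord0 i * pquo1 i z x = (2 * (1 - X) * b - 4 * (1 - b) * X) / q ^+ 2.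
  transitivity (\sum_i (2 * (1 - X) / q ^+ 2 * (x ord0 i * z ord0 i)
      - 4 * (1 - b) / q ^+ 2 * (x ord0 i * x ord0 i))).
    by apply: eq_bigr => i _; rewrite /pquo1 -/X -/b -/q; ring.
  by rewrite sumrB -!mulr_sumr -/(dotv x z) -/(dotv x x) -/X -/b; ring.
have S2 : \sum_i pquo1 i z x ^+ 2 = 4 / q ^+ 2.
  transitivity (\sum_i ((2 * (1 - X) / q ^+ 2) ^+ 2 * (z ord0 i * z ord0 i)
      - 16 * (1 - X) * (1 - b) / q ^+ 4 * (x ord0 i * z ord0 i)
      + (4 * (1 - b) / q ^+ 2) ^+ 2 * (x ord0 i * x ord0 i))).
    apply: eq_bigr => i _; rewrite /pquo1 -/X -/b -/q.
    by field; rewrite q0.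
  rewrite big_split/= sumrB -!mulr_sumr -/(dotv x z) -/(dotv x x) -/(dotv z z) -/X -/b zz.
  by move: q0; rewrite qE => q0; field; rewrite q0.
have S3 : \sum_i pquo2 i i z x = - 4 * n%:R * (1 - b) / q ^+ 2
    - 8 * ((1 - X) * (b - 1) - 2 * (1 - b) * (X - b)) / q ^+ 3.
  transitivity (\sum_i (- 4 * (1 - b) / q ^+ 2
      - 8 * (1 - X) / q ^+ 3 * (x ord0 i * z ord0 i)
      + 8 * (1 - X) / q ^+ 3 * (z ord0 i * z ord0 i)
      + 16 * (1 - b) / q ^+ 3 * (x ord0 i * x ord0 i)
      - 16 * (1 - b) / q ^+ 3 * (x ord0 i * z ord0 i))).
    apply: eq_bigr => i _; rewrite /pquo2 eqxx -/X -/b -/q /=.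
    by field; rewrite q0.
  rewrite !big_split/= !sumrN -!mulr_sumr sumr_const card_ord -mulr_natr.
  rewrite -/(dotv x z) -/(dotv x x) -/(dotv z z) -/X -/b zz.
  by field; rewrite q0.
(* With n = m + 3 the truncated exponents (n-1).-1 and (n-1).-2 are the genuine m + 1 and m. *)
have [m nE] : exists m, n = m.+3 by exists (n - 3)%N; rewrite -addn3 subnK.
have e2 : (n - 1).-2 = m by rewrite nE subn1.
have e1 : (n - 1).-1 = m.+1 by rewrite nE subn1.
have r1 : (n - 1)%:R = n%:R - 1 :> R by rewrite natrB// (ltn_trans _ n2).
have r2 : m.+1%:R = n%:R - 2 :> R by rewrite -e1 -subn1 -subnDA natrB// ltnW.
have E2 : \sum_i poisson2 i i z x = (n%:R - 1) * ((n%:R - 2) * w ^+ m * (\sum_i pquo1 i z x ^+ 2)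
    + w ^+ m.+1 * \sum_i pquo2 i i z x).
  rewrite mulrDr !mulr_sumr -big_split; apply: eq_bigr => i _ /=.
  rewrite /poisson2 -/w e2 e1 r1 r2.
  by ring.
have E1 : \sum_i x ord0 i * poisson1 i z x = (n%:R - 1) * w ^+ m.+1 * \sum_i x ord0 i * pquo1 i z x.
  rewrite mulr_sumr; apply: eq_bigr => i _ /=.
  rewrite /poisson1 -/w e1 r1.
  by ring.
rewrite E1 E2 S1 S2 S3 (exprS w m); move: (w ^+ m) => c.
rewrite /w /pquo -/X -/q.
by move: q0; rewrite qE => q0; field; rewrite q0.
Qed.

Lemma H_harmonic_poisson z : (2 < n)%N -> unit_sphere z -> H_harmonic (poisson z).
Proof.
move=> n2 Sz; have [C e1 e2] := poisson_C2 Sz; split => // x xB.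
rewrite -(hyperbolic_poisson n2 Sz xB) /hyperbolic_laplacian sqr_enorm.
congr (_ * (_ * _ + _ * _)); first by apply: eq_bigr => i _; rewrite e2.
by apply: eq_bigr => i _; rewrite mxE e1.
Qed.

End poisson.

(** * Symmetry of the Poisson transform *)

Section curves.
Context {R : realType} (n : nat).
Hypothesis n0 : (0 < n)%N.

Lemma cvg_at (T : Type) (F : set_system T) (U V : topologicalType) (f : T -> U)
    (h : U -> V) x :
  f t @[t --> F] --> x -> {for x, continuous h} -> h (f t) @[t --> F] --> h x.
Proof. by move=> fx hc; apply: (@cvg_comp _ _ _ f h F (nbhs x)). Qed.

(** If d2 > 0, then [dphi] is positive just to the right of t0, where it starts from 0, and [phi]
    rises above its maximum. *)
Lemma second_derivative_max (phi dphi : R -> R) (t0 d2 : R) :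
  (\forall t \near t0, is_derive (t : R) 1 phi (dphi t)) ->
  is_derive t0 1 dphi d2 ->
  (\forall t \near t0, phi t <= phi t0) -> dphi t0 = 0 /\ d2 <= 0.
Proof.
move=> d1 [dd ddE] mx.
have /nbhs_ballP[d /= dp hd] : \forall t \near t0, is_derive (t : R) 1 phi (dphi t) /\ phi t <= phi t0.
  by move: mx; apply: filterS2 d1 => t; split.
have tin t : t \in `]t0 - d, t0 + d[ -> ball t0 d t.
  by rewrite in_itv/= -ball_normE/= -ltr_distl distrC.
have z : dphi t0 = 0.
  have h : is_derive t0 1 phi 0.
    apply: (@derive1_at_max _ phi (t0 - d) (t0 + d)).
    - by lra.
    - by move=> t /tin /hd [[]].
    - by rewrite in_itv/=; apply/andP; split; lra.
    - by move=> t /tin /hd [].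
  have [[_ <-] _] := hd t0 (ballxx _ dp).
  by case: h.
split => //; rewrite leNgt; apply/negP => d2p.
have : \forall h \near (0 : R)^', 0 < h^-1 * dphi (t0 + h).
  have : h^-1 * dphi (t0 + h) @[h --> (0 : R)^'] --> d2.
    rewrite -ddE; apply: cvg_trans dd; apply: near_eq_cvg; near=> h.
    by rewrite /= z subr0 [h *: 1]mulr1 [h + t0]addrC.
  by move=> /cvgr_gt/(_ 0); apply.
move=> /nbhs_ballP[d' /= dp' hd'].
pose h := Num.min d d' / 2.
have hp : 0 < h by rewrite divr_gt0// lt_min dp dp'.
have hdd : h < d.
  by apply: (@lt_le_trans _ _ (Num.min d d')); rewrite ?ge_min ?lexx// ltr_pdivrMr// ltr_pMr ?lt_min ?dp ?dp'//; lra.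
have hdd' : h < d'.
  by apply: (@lt_le_trans _ _ (Num.min d d')); rewrite ?ge_min ?lexx ?orbT// ltr_pdivrMr// ltr_pMr ?lt_min ?dp ?dp'//; lra.
have ballt t : t0 <= t <= t0 + h -> ball t0 d t.
  by move=> /andP[t1 t2]; apply: tin; rewrite in_itv/=; apply/andP; split; lra.
have [|||c] := @MVT R phi dphi t0 (t0 + h).
- by lra.
- move=> t; rewrite in_itv/= => /andP[t1 t2].
  by have [] := hd t (ballt t ltac:(by apply/andP; split; exact: ltW)).
- apply: derivable_within_continuous => t; rewrite in_itv/= => t12.
  by have [[]] := hd t (ballt t t12).
rewrite in_itv/= => /andP[c1 c2] E.
have cp : 0 < dphi c.
  have := hd' (c - t0); rewrite -ball_normE/= sub0r normrN => /(_ _ _).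
  have -> : t0 + (c - t0) = c by rewrite addrC subrK.
  rewrite ger0_norm; last by lra.
  have ct : c - t0 < d' by lra.
  have ct0 : c - t0 != 0 by rewrite subr_eq0 gt_eqF.
  move=> /(_ ct ct0).
  by rewrite pmulr_rgt0// invr_gt0; lra.
have hb : t0 <= t0 + h <= t0 + h by apply/andP; split; lra.
have [_] := hd (t0 + h) (ballt (t0 + h) hb).
have : 0 < phi (t0 + h) - phi t0 by rewrite E addrC addKr mulr_gt0.
lra.
Unshelve. all: by end_near. Qed.

Lemma cvg_gradient (T : Type) (F : set_system T) (FF : Filter F) (U : set 'rV[R]_n)
    (h : 'rV[R]_n -> R) (c : T -> 'rV[R]_n) x : class_C1 U h -> U x ->
  c t @[t --> F] --> x -> gradient h (c t) @[t --> F] --> gradient h x.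
Proof.
move=> Ch Ux cx; apply: cvg_rV => i; rewrite mxE; under eq_fun do rewrite mxE.
by have [_ /(_ i)[_ hc]] := Ch _ Ux; exact: (cvg_at cx hc).
Qed.

Lemma cvg_second_order (T : Type) (F : set_system T) (FF : Filter F)
    (U : set 'rV[R]_n) (h : 'rV[R]_n -> R) (c u w : T -> 'rV[R]_n) x u0 w0 :
  class_C2 U h -> U x -> c t @[t --> F] --> x ->
  u t @[t --> F] --> u0 -> w t @[t --> F] --> w0 ->
  second_order h (c t) (u t) (w t) @[t --> F] --> second_order h x u0 w0.
Proof.
move=> Ch Ux cx uu ww; apply: cvgD.
  by apply: cvg_dotv => //; exact: cvg_gradient Ch.1 Ux cx.
apply: cvg_sumr => i _; apply: cvgM; first exact: cvg_coord.
by apply: cvg_dotv => //; exact: cvg_gradient (Ch.2 i) Ux cx.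
Qed.

Variables (U : set 'rV[R]_n) (g : 'rV[R]_n -> R) (k : 'rV[R]_n -> R).
Variables (c c1 c2 : 'rV[R]_n -> R -> 'rV[R]_n) (t0 : R).
Hypotheses (oU : open U) (Cg : class_C2 U g) (ck : scont k).
Hypothesis cU : \forall t \near t0, on_sphere (fun e => U (c e t)).
Hypothesis cc : forall (e : 'rV[R]_n) (t : R), c p.1 p.2 @[p --> (e, t)] --> c e t.
Hypothesis cc1 : forall (e : 'rV[R]_n) (t : R), c1 p.1 p.2 @[p --> (e, t)] --> c1 e t.
Hypothesis cc2 : forall (e : 'rV[R]_n) (t : R), c2 p.1 p.2 @[p --> (e, t)] --> c2 e t.
Hypothesis dc : forall (e : 'rV[R]_n) (t : R) i, is_derive t 1 (fun s => c e s ord0 i) (c1 e t ord0 i).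
Hypothesis dc1 : forall (e : 'rV[R]_n) (t : R) i, is_derive t 1 (fun s => c1 e s ord0 i) (c2 e t ord0 i).

Let kc (e : 'rV[R]_n) (t : R) : unit_sphere e -> k p.1 @[p --> (e, t)] --> k e.
Proof.
move=> Se; have h := ck Se.
exact: (cvg_at (@cvg_fst _ _ (nbhs e) (nbhs t) _) h).
Qed.

Let j0 t : on_sphere (fun e => U (c e t)) -> jcont (fun e t => g (c e t) * k e) t.
Proof.
move=> Ut e Se; apply: cvgM; last exact: kc.
have [h _] := Cg.1 _ (Ut e Se).
exact: (cvg_at (@cc e t) h).
Qed.

Let j1 t : on_sphere (fun e => U (c e t)) ->
  jcont (fun e t => dotv (c1 e t) (gradient g (c e t)) * k e) t.
Proof.
move=> Ut e Se; apply: cvgM; last exact: kc.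
apply: cvg_dotv; first exact: cc1.
exact: cvg_gradient Cg.1 (Ut e Se) (@cc e t).
Qed.

Let j2 t : on_sphere (fun e => U (c e t)) ->
  jcont (fun e t => second_order g (c e t) (c1 e t) (c2 e t) * k e) t.
Proof.
move=> Ut e Se; apply: cvgM; last exact: kc.
exact: cvg_second_order Cg (Ut e Se) (@cc e t) (@cc1 e t) (@cc2 e t).
Qed.

(** The first derivative is given near t0 and the second at t0 alone, exactly the input of
    [second_derivative_max]. Radial lines and rotations are the two families of curves used. *)
Lemma curve_integral :
  (\forall t \near t0, is_derive (t : R) 1 (fun t : R => sint (fun e => g (c e t) * k e))
     (sint (fun e => dotv (c1 e t) (gradient g (c e t)) * k e))) /\
  is_derive t0 1 (fun t : R => sint (fun e => dotv (c1 e t) (gradient g (c e t)) * k e))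
    (sint (fun e => second_order g (c e t0) (c1 e t0) (c2 e t0) * k e)).
Proof.
split.
  have := near_join cU; apply: filterS => t cUt.
  apply: (@sint_is_derive _ n (fun e t => g (c e t) * k e)
    (fun e t => dotv (c1 e t) (gradient g (c e t)) * k e) t n0); apply: filterS cUt => s Us.
  split; [exact: j0|exact: j1|] => e Se.
  apply: (is_derive_to (is_derive_mul (chain_rule oU Cg.1 (Us e Se) (fun i => dc e s i))
    (is_derive_const (k e) s 1))).
  by rewrite mulr0 addr0.
apply: (@sint_is_derive _ n (fun e t => dotv (c1 e t) (gradient g (c e t)) * k e)
  (fun e t => second_order g (c e t) (c1 e t) (c2 e t) * k e) t0 n0); apply: filterS cU => s Us.
split; [exact: j1|exact: j2|] => e Se.
apply: (is_derive_to (is_derive_mul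
  (chain_rule2 oU Cg (Us e Se) (fun i => dc e s i) (fun i => dc1 e s i))
  (is_derive_const (k e) s 1))).
by rewrite mulr0 addr0.
Qed.

End curves.

(** * Plane rotations as functions of the angle *)

Section rotations.
Context {R : realType} (n : nat).

Lemma cvg_prot (T : Type) (F : set_system T) (FF : Filter F) (i j : 'I_n)
    (f : T -> 'rV[R]_n) (a b : T -> R) (x : 'rV[R]_n) (a0 b0 : R) :
  f t @[t --> F] --> x -> a t @[t --> F] --> a0 -> b t @[t --> F] --> b0 ->
  prot i j (a t) (b t) (f t) @[t --> F] --> prot i j a0 b0 x.
Proof.
move=> fx aa bb; apply: cvg_rV => k; rewrite protE; under eq_fun do rewrite protE.
have c1 : (fun=> (1 : R)) t @[t --> F] --> (1 : R) by exact: cvg_cst.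
have cb (q : bool) : (fun=> (q%:R : R)) t @[t --> F] --> (q%:R : R) by exact: cvg_cst.
have xi l := cvg_coord (i := l) FF fx.
by apply: cvgD; [apply: cvgD => //|]; (apply: cvgM; last exact: cb);
  [apply: cvgB|apply: cvgD]; apply: cvgM => //; exact: cvgB.
Qed.

Lemma cvg_prot_part (T : Type) (F : set_system T) (FF : Filter F) (i j : 'I_n)
    (f : T -> 'rV[R]_n) (a b : T -> R) (x : 'rV[R]_n) (a0 b0 : R) :
  f t @[t --> F] --> x -> a t @[t --> F] --> a0 -> b t @[t --> F] --> b0 ->
  prot_part i j (a t) (b t) (f t) @[t --> F] --> prot_part i j a0 b0 x.
Proof.
move=> fx aa bb; apply: cvg_rV => k; rewrite prot_partE; under eq_fun do rewrite prot_partE.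
have cb (q : bool) : (fun=> (q%:R : R)) t @[t --> F] --> (q%:R : R) by exact: cvg_cst.
have xi l := cvg_coord (i := l) FF fx.
by apply: cvgD; (apply: cvgM; last exact: cb);
  [apply: cvgB|apply: cvgD]; apply: cvgM.
Qed.

Lemma is_derive_prot (i j : 'I_n) (a b : R -> R) (a1 b1 : R) (x : 'rV[R]_n) (t : R) k :
  is_derive t 1 a a1 -> is_derive t 1 b b1 ->
  is_derive t 1 (fun t => prot i j (a t) (b t) x ord0 k) (prot_part i j a1 b1 x ord0 k).
Proof.
move=> da db; rewrite prot_partE; under eq_fun do rewrite protE.
pose K (c : R) := is_derive_const c t (1 : R).
have da1 := is_derive_sub da (K 1).
apply: (is_derive_to (is_derive_add (is_derive_add (K (x ord0 k))
  (is_derive_mul (is_derive_sub (is_derive_mul da1 (K (x ord0 i)))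
     (is_derive_mul db (K (x ord0 j)))) (K (k == i)%:R)))
  (is_derive_mul (is_derive_add (is_derive_mul db (K (x ord0 i)))
     (is_derive_mul da1 (K (x ord0 j)))) (K (k == j)%:R)))).
by ring.
Qed.

Lemma is_derive_prot_part (i j : 'I_n) (a b : R -> R) (a1 b1 : R) (x : 'rV[R]_n) (t : R) k :
  is_derive t 1 a a1 -> is_derive t 1 b b1 ->
  is_derive t 1 (fun t => prot_part i j (a t) (b t) x ord0 k)
    (prot_part i j a1 b1 x ord0 k).
Proof.
move=> da db; rewrite prot_partE; under eq_fun do rewrite prot_partE.
pose K (c : R) := is_derive_const c t (1 : R).
apply: (is_derive_to (is_derive_add
  (is_derive_mul (is_derive_sub (is_derive_mul da (K (x ord0 i)))
     (is_derive_mul db (K (x ord0 j)))) (K (k == i)%:R))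
  (is_derive_mul (is_derive_add (is_derive_mul db (K (x ord0 i)))
     (is_derive_mul da (K (x ord0 j)))) (K (k == j)%:R)))).
by ring.
Qed.

Lemma dotv_prot_adj (i j : 'I_n) (c s : R) (x y : 'rV[R]_n) : i != j ->
  dotv (prot i j c s x) y = dotv x (prot i j c (- s) y).
Proof.
move=> ij; rewrite /prot !(dotvDl, dotvDr, dotvZl, dotvZr).
by rewrite !(dotv_delta, dotvC (delta_mx _ _)); ring.
Qed.

End rotations.

(** * Exchanging the two radii *)

Section exchange.
Context {R : realType} (n : nat).
Hypothesis n2 : (2 < n)%N.

Let n0 : (0 < n)%N. Proof. exact: ltn_trans n2. Qed.

Lemma cvg_scalev (T : Type) (F : set_system T) (f : T -> 'rV[R]_n)
    (x : 'rV[R]_n) (s : R) : f t @[t --> F] --> x -> s *: f t @[t --> F] --> s *: x.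
Proof.
by move=> fx; apply: (@cvg_at _ F _ _ f (fun x => s *: x) x fx); exact: scaler_continuous.
Qed.

Lemma unit_ballZ (s : R) (e : 'rV[R]_n) : `|s| < 1 -> unit_sphere e -> unit_ball (s *: e).
Proof. by move=> s1 Se; rewrite /unit_ball/= enormZ Se mulr1. Qed.

Lemma scont_scale (g : 'rV[R]_n -> R) (s : R) : `|s| < 1 ->
  (forall x, unit_ball x -> {for x, continuous g}) -> scont (fun e => g (s *: e)).
Proof.
move=> s1 cg e Se; apply: (@cvg_at _ (nbhs e) _ _ (fun e => s *: e)).
  exact: scaler_continuous.
by apply: cg; exact: unit_ballZ.
Qed.

Lemma scont_harmonic (g : 'rV[R]_n -> R) (s : R) : `|s| < 1 -> H_harmonic g ->
  scont (fun e => g (s *: e)).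
Proof. by move=> s1 [Cg _]; apply: scont_scale => // x xB; have [] := Cg.1 x xB. Qed.

Lemma scont_poisson (z : 'rV[R]_n) (s : R) : `|s| < 1 -> unit_sphere z ->
  scont (fun e => poisson z (s *: e)).
Proof. by move=> s1 Sz; apply: scont_harmonic => //; exact: H_harmonic_poisson. Qed.

Lemma poisson_prot (i j : 'I_n) (c s r : R) (z e : 'rV[R]_n) : i != j ->
  c ^+ 2 + s ^+ 2 = 1 ->
  poisson (prot i j c s z) (r *: e) = poisson z (r *: prot i j c (- s) e).
Proof.
move=> ij cs; rewrite /poisson /pquo /pden -protZ dotv_prot//; last by rewrite sqrrN.
by rewrite -[s]opprK -dotv_prot_adj// opprK.
Qed.

Lemma protK (i j : 'I_n) (c s : R) (e : 'rV[R]_n) : i != j ->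
  c ^+ 2 + s ^+ 2 = 1 -> prot i j c (- s) (prot i j c s e) = e.
Proof.
have := eq_sym i j; move=> + ij cs; rewrite (negbTE ij) => /esym/negbT/negbTE ji.
apply/rowP => k; rewrite !protE !eqxx (negbTE ij) ji /=.
apply/eqP; rewrite -subr_eq0; apply/eqP.
transitivity ((c ^+ 2 + s ^+ 2 - 1) * (e ord0 i * (k == i)%:R + e ord0 j * (k == j)%:R)).
  by ring.
by rewrite cs subrr mul0r.
Qed.

Lemma unit_sphere_prot (i j : 'I_n) (c s : R) (z : 'rV[R]_n) : i != j ->
  c ^+ 2 + s ^+ 2 = 1 -> unit_sphere z -> unit_sphere (prot i j c s z).
Proof. by move=> ij cs Sz; rewrite /unit_sphere/= enorm_prot. Qed.

Section radial_and_rotational_derivatives.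
Variables (g : 'rV[R]_n -> R) (k : 'rV[R]_n -> R).
Hypotheses (hg : H_harmonic g) (ck : scont k).

(** [sint1] and [sint2] are the first two derivatives in s of the integral of g(s e) k(e); [sintp]
    is its second derivative at angle 0 when the argument of g is rotated in the plane of [p]. *)
Definition sint1 s := sint (fun e => dotv e (gradient g (s *: e)) * k e).
Definition sint2 s := sint (fun e => second_order g (s *: e) e 0 * k e).
Definition sintp s (p : 'I_n * 'I_n) :=
  sint (fun e => second_order g (s *: e) (s *: prot_part p.1 p.2 0 1 e)
          (s *: prot_part p.1 p.2 (-1) 0 e) * k e).

Lemma sint_radial (s : R) : 0 < s < 1 ->
  (\forall t \near s, is_derive (t : R) 1 (fun t : R => sint (fun e => g (t *: e) * k e)) (sint1 t)) /\
  is_derive s 1 sint1 (sint2 s).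
Proof.
move=> /andP[s0 s1].
apply: (@curve_integral _ _ n0 (@unit_ball R n) g k (fun e t => t *: e) (fun e _ => e)
  (fun _ _ => 0) s (@open_unit_ball R n) hg.1 ck).
- have : \forall t \near s, `|t| < 1.
    have : {for s, continuous (@Num.norm R R)} by exact: norm_continuous.
    move=> /(_ [set y | y < 1]); apply.
    by apply: open_nbhs_nbhs; split; [exact: open_lt|rewrite /= ger0_norm// ltW].
  by apply: filterS => t t1 e Se; exact: unit_ballZ.
- by move=> e t; apply: cvgZ; [exact: cvg_snd|exact: cvg_fst].
- by move=> e t; exact: cvg_fst.
- by move=> e t; exact: cvg_cst.
- move=> e t i; under eq_fun do rewrite mxE.
  apply: (is_derive_to (is_derive_mul (is_derive_id t 1) (is_derive_const (e ord0 i) t 1))).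
  by rewrite mulr0 addr0 mul1r.
- by move=> e t i; rewrite mxE; exact: is_derive_const.
Qed.

(** The sign [b] fixes the sense of rotation: in the defect, f and the Poisson kernel rotate in
    opposite senses. At angle 0 the velocity carries a factor b, squared away in the Hessian form,
    and the acceleration is free of b. *)
Lemma sint_rotational (i j : 'I_n) (b s : R) : i != j -> b ^+ 2 = 1 -> 0 < s < 1 ->
  exists dphi : R -> R,
  (\forall t \near (0 : R), is_derive (t : R) 1
     (fun t : R => sint (fun e => g (s *: prot i j (cos t) (b * sin t) e) * k e)) (dphi t)) /\
  is_derive (0 : R) 1 dphi (sintp s (i, j)).
Proof.
move=> ij b1 /andP[s0 s1].
have bb : b * b = 1 by rewrite -expr2.
pose c e t : 'rV[R]_n := s *: prot i j (cos t) (b * sin t) e.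
pose c1 e t : 'rV[R]_n := s *: prot_part i j (- sin t) (b * cos t) e.
pose c2 e t : 'rV[R]_n := s *: prot_part i j (- cos t) (b * - sin t) e.
exists (fun t => sint (fun e => dotv (c1 e t) (gradient g (c e t)) * k e)).
have csin (e : 'rV[R]_n) (t : R) : sin p.2 @[p --> (e, t)] --> sin t.
  by apply: (@cvg_at _ (nbhs (e, t)) _ _ snd); [exact: cvg_snd|exact: continuous_sin].
have ccos (e : 'rV[R]_n) (t : R) : cos p.2 @[p --> (e, t)] --> cos t.
  by apply: (@cvg_at _ (nbhs (e, t)) _ _ snd); [exact: cvg_snd|exact: continuous_cos].
have cfst (e : 'rV[R]_n) (t : R) : p.1 @[p --> (e, t)] --> e by exact: cvg_fst.
have scl (q : 'rV[R]_n -> R -> 'rV[R]_n) (e : 'rV[R]_n) (t : R) :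
    q p.1 p.2 @[p --> (e, t)] --> q e t -> s *: q p.1 p.2 @[p --> (e, t)] --> s *: q e t.
  exact: cvg_scalev.
have dscl (q : R -> 'rV[R]_n) (d : 'rV[R]_n) (t : R) l :
    is_derive t 1 (fun t => q t ord0 l) (d ord0 l) ->
    is_derive t 1 (fun t => (s *: q t) ord0 l) ((s *: d) ord0 l).
  by move=> h; rewrite mxE; under eq_fun do rewrite mxE; exact: is_derive_mulc.
have bmul (e : 'rV[R]_n) (t : R) (h : R -> R) : h p.2 @[p --> (e, t)] --> h t ->
    b * h p.2 @[p --> (e, t)] --> b * h t.
  by move=> hh; apply: cvgM => //; exact: cvg_cst.
have ncv (e : 'rV[R]_n) (t : R) (h : R -> R) : h p.2 @[p --> (e, t)] --> h t ->
    - h p.2 @[p --> (e, t)] --> - h t by move=> hh; exact: cvgN.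
have dsin := fun t : R => is_derive_mulc b (is_derive_sin t).
have dNsin (t : R) : is_derive t 1 (fun t : R => - sin t) (- cos t).
  exact: (is_deriveN (is_derive_sin t)).
have dbcos := fun t : R => is_derive_mulc b (is_derive_cos t).
have cB : \forall t \near (0 : R), on_sphere (fun e => unit_ball (c e t)).
  have H t : on_sphere (fun e => unit_ball (c e t)).
    move=> e Se; apply: unit_ballZ; first by rewrite ger0_norm// ltW.
    by apply: unit_sphere_prot => //; rewrite exprMn b1 mul1r cos2Dsin2.
  exact: (@filterE _ (nbhs (0 : R)) _ _ H).
have H0 (e : 'rV[R]_n) (t : R) : c p.1 p.2 @[p --> (e, t)] --> c e t.
  apply: (scl (fun e t => prot i j (cos t) (b * sin t) e)).
  exact: (cvg_prot _ (cfst e t) (ccos e t) (bmul e t sin (csin e t))).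
have H1 (e : 'rV[R]_n) (t : R) : c1 p.1 p.2 @[p --> (e, t)] --> c1 e t.
  apply: (scl (fun e t => prot_part i j (- sin t) (b * cos t) e)).
  exact: (cvg_prot_part _ (cfst e t) (ncv e t sin (csin e t)) (bmul e t cos (ccos e t))).
have H2 (e : 'rV[R]_n) (t : R) : c2 p.1 p.2 @[p --> (e, t)] --> c2 e t.
  apply: (scl (fun e t => prot_part i j (- cos t) (b * - sin t) e)).
  exact: (cvg_prot_part _ (cfst e t) (ncv e t cos (ccos e t))
    (bmul e t (fun t => - sin t) (ncv e t sin (csin e t)))).
have D0 (e : 'rV[R]_n) (t : R) l :
    is_derive t 1 (fun s => c e s ord0 l) (c1 e t ord0 l).
  exact: (dscl (fun t => prot i j (cos t) (b * sin t) e) _ t l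
    (is_derive_prot i j e l (is_derive_cos t) (dsin t))).
have D1 (e : 'rV[R]_n) (t : R) l :
    is_derive t 1 (fun s => c1 e s ord0 l) (c2 e t ord0 l).
  exact: (dscl (fun t => prot_part i j (- sin t) (b * cos t) e) _ t l
    (is_derive_prot_part i j e l (dNsin t) (dbcos t))).
have [h1 h2] := @curve_integral _ _ n0 (@unit_ball R n) g k c c1 c2 0
  (@open_unit_ball R n) hg.1 ck cB H0 H1 H2 D0 D1.
split; first exact: h1.
have E (e : 'rV[R]_n) : second_order g (c e 0) (c1 e 0) (c2 e 0) =
    second_order g (s *: e) (s *: prot_part i j 0 1 e) (s *: prot_part i j (-1) 0 e).
  rewrite /c /c1 /c2 cos0 sin0 oppr0 !mulr0 mulr1 prot10.
  have -> : prot_part i j 0 b e = b *: prot_part i j 0 1 e.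
    by apply/rowP => l; rewrite [RHS]mxE !prot_partE; ring.
  rewrite /second_order; congr (_ + _); apply: eq_bigr => l _.
  have -> : s *: (b *: prot_part i j 0 1 e) = b *: (s *: prot_part i j 0 1 e).
    by rewrite !scalerA mulrC.
  set w := s *: prot_part i j 0 1 e.
  rewrite dotvZl (_ : (b *: w) ord0 l = b * w ord0 l); last by rewrite mxE.
  by rewrite mulrACA bb mul1r.
apply: (is_derive_to h2); rewrite /sintp /=.
by apply: eq_sint => e Se; rewrite E.
Qed.

Lemma polar_integral (s : R) : 0 < s < 1 ->
  (1 - s ^+ 2) * (sint2 s + (n%:R - 1) / s * sint1 s
     + 2^-1 * s ^- 2 * \sum_(p : 'I_n * 'I_n | p.1 != p.2) sintp s p)
  + 2 * (n%:R - 2) * s * sint1 s = 0.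
Proof.
move=> s01; have /andP[s0 s1] := s01.
have ns : `|s| < 1 by rewrite ger0_norm// ltW.
have idc (e : 'rV[R]_n) : id x @[x --> e] --> e by exact: cvg_id.
have sc (u : 'rV[R]_n -> 'rV[R]_n) (e : 'rV[R]_n) : u x @[x --> e] --> u e ->
    s *: u x @[x --> e] --> s *: u e by exact: cvg_scalev.
have Be (e : 'rV[R]_n) : unit_sphere e -> unit_ball (s *: e) by exact: unit_ballZ.
have k1 : scont (fun e => dotv e (gradient g (s *: e)) * k e).
  apply: scontM => // e Se.
  exact: (cvg_dotv _ (idc e) (cvg_gradient _ hg.1.1 (Be e Se) (sc id e (idc e)))).
have k2 : scont (fun e => second_order g (s *: e) e 0 * k e).
  apply: scontM => // e Se.
  have z : (fun=> (0 : 'rV[R]_n)) x @[x --> e] --> (0 : 'rV[R]_n) by exact: (@cvg_cst _ _ _ (nbhs e)).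
  exact: (cvg_second_order _ hg.1 (Be e Se) (sc id e (idc e)) (idc e) z).
have kp p : scont (fun e => second_order g (s *: e) (s *: prot_part p.1 p.2 0 1 e)
    (s *: prot_part p.1 p.2 (-1) 0 e) * k e).
  apply: scontM => // e Se.
  have pp (a b : R) : prot_part p.1 p.2 a b x @[x --> e] --> prot_part p.1 p.2 a b e.
    exact: (@cvg_prot_part _ _ _ (nbhs e) _ p.1 p.2 id (fun=> a) (fun=> b) e a b (idc e)
      (@cvg_cst _ a _ (nbhs e) _) (@cvg_cst _ b _ (nbhs e) _)).
  exact: (cvg_second_order _ hg.1 (Be e Se) (sc id e (idc e)) (sc _ e (pp 0 1)) (sc _ e (pp (-1) 0))).
have cs c : scont (fun _ : 'rV[R]_n => c) := @scont_cst R n c.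
have kz c h : scont h -> scont (fun e : 'rV[R]_n => c * h e) by move=> hh; exact: scontM.
have ksum : scont (fun e => \sum_(p : 'I_n * 'I_n | p.1 != p.2)
  (second_order g (s *: e) (s *: prot_part p.1 p.2 0 1 e)
    (s *: prot_part p.1 p.2 (-1) 0 e) * k e)) by apply: scont_sum => p _.
rewrite /sint1 /sint2 /sintp -(sint_sum _ n0 (fun p _ => kp p)).
rewrite -(sintZl ((n%:R - 1) / s) n0 k1) -(sintD n0 k2 (kz _ _ k1)).
rewrite -(sintZl (2^-1 * s ^- 2) n0 ksum).
rewrite -(sintD n0 (scontD k2 (kz _ _ k1)) (kz _ _ ksum)).
have kk := scontD (scontD k2 (kz ((n%:R - 1) / s) _ k1)) (kz (2^-1 * s ^- 2) _ ksum).
rewrite -(sintZl (1 - s ^+ 2) n0 kk) -(sintZl (2 * (n%:R - 2) * s) n0 k1).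
rewrite -(sintD n0 (kz _ _ kk) (kz _ _ k1)).
rewrite -[RHS](sint_cst 0 n0); apply: eq_sint => e Se.
have P := H_harmonic_polar hg Se s01.
apply: (@etrans _ _ (0 * k e)); last by rewrite mul0r.
rewrite -mulr_suml -[X in _ = X * _]P.
by move: (dotv _ _) (second_order _ _ _ _) (\sum_(_ | _) _) => *; ring.
Qed.

End radial_and_rotational_derivatives.

Section maximum_principle.
Variables (f : 'rV[R]_n -> R) (hf : H_harmonic f) (r : R) (r01 : 0 < r < 1).

Let nr : `|r| < 1. Proof. by case/andP: r01 => r0 r1; rewrite ger0_norm// ltW. Qed.

(** Here r is fixed while s and z vary, as the radius and direction of a point. Both radii stay
    below 1, so f enters only through continuous functions on the sphere. *)
Definition exchange_defect s z :=
  sint (fun e => f (s *: e) * poisson z (r *: e))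
  - sint (fun e => poisson z (s *: e) * f (r *: e)).

Let cfr : scont (fun e => f (r *: e)).
Proof. exact: scont_harmonic. Qed.

(** The limit is taken within admissible pairs: for z off the sphere the denominator of P(z, .) may
    vanish inside the ball. *)
Lemma exchange_defect_continuous (s : R) (z : 'rV[R]_n) : unit_sphere z -> 0 < s < 1 ->
  exchange_defect p.1 p.2 @[p --> within [set p | 0 < p.1 < 1 /\ unit_sphere p.2] (nbhs (s, z))]
    --> exchange_defect s z.
Proof.
move=> Sz /andP[s0 s1]; set A := [set p | _].
have ns : `|s| < 1 by rewrite ger0_norm// ltW.
have nearA : \forall p \near within A (nbhs (s, z)), A p by exact: withinT.
have wn : within A (nbhs (s, z)) `=>` nbhs (s, z) by exact: cvg_within.
have c1 (e : 'rV[R]_n) : q.2.1 @[q --> (nbhs e, within A (nbhs (s, z)))] --> s.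
  apply: (@cvg_comp _ _ _ snd fst _ (nbhs (s, z))).
    by apply: cvg_trans wn; exact: cvg_snd.
  exact: cvg_fst.
have c2 (e : 'rV[R]_n) : q.2.2 @[q --> (nbhs e, within A (nbhs (s, z)))] --> z.
  apply: (@cvg_comp _ _ _ snd snd _ (nbhs (s, z))).
    by apply: cvg_trans wn; exact: cvg_snd.
  exact: cvg_snd.
have c0 (e : 'rV[R]_n) : q.1 @[q --> (nbhs e, within A (nbhs (s, z)))] --> e.
  exact: cvg_fst.
have nA p : A p -> `|p.1| < 1.
  by case: p => t y /= [/andP[t0 t1] _]; rewrite ger0_norm// ltW.
apply: cvgB.
  apply: (@sint_cvg _ n _ (within A (nbhs (s, z))) _
    (fun e p => f (p.1 *: e) * poisson p.2 (r *: e))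
    (fun e => f (s *: e) * poisson z (r *: e)) n0).
  - by apply: scontM; [exact: scont_harmonic|exact: scont_poisson].
  - apply: filterS nearA => -[t y] /= Ap.
    by apply: scontM; [apply: scont_harmonic => //; exact: nA Ap|apply: scont_poisson => //; exact: Ap.2].
  - move=> e Se; apply: cvgM.
      have [h _] := hf.1.1 _ (unit_ballZ ns Se).
      exact: (cvg_at (cvgZ (c1 e) (c0 e)) h).
    have rc : r *: q.1 @[q --> (nbhs e, within A (nbhs (s, z)))] --> r *: e.
      exact: (@cvg_scalev _ _ _ e r (c0 e)).
    exact: (cvg_poisson _ (c2 e) rc Sz (unit_ballZ nr Se)).
apply: (@sint_cvg _ n _ (within A (nbhs (s, z))) _
  (fun e p => poisson p.2 (p.1 *: e) * f (r *: e))
  (fun e => poisson z (s *: e) * f (r *: e)) n0).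
- by apply: scontM; [exact: scont_poisson|exact: cfr].
- apply: filterS nearA => -[t y] /= Ap.
  by apply: scontM; [apply: scont_poisson; [exact: nA Ap|exact: Ap.2]|exact: cfr].
- move=> e Se; apply: cvgM.
    have rc : q.2.1 *: q.1 @[q --> (nbhs e, within A (nbhs (s, z)))] --> s *: e.
      exact: (cvgZ (c1 e) (c0 e)).
    exact: (cvg_poisson _ (c2 e) rc Sz (unit_ballZ ns Se)).
  exact: (cvg_at (c0 e) (cfr Se)).
Qed.

Lemma exchange_defect_bounded : exists M, forall (s : R) (z : 'rV[R]_n), 0 < s <= r -> unit_sphere z ->
  `|exchange_defect s z| <= M.
Proof.
have /andP[r0 r1] := r01.
have [Mf hMf] : exists M, forall x : 'rV[R]_n, enorm x <= r -> `|f x| <= M.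
  have : compact (f @` [set x : 'rV[R]_n | enorm x <= r]).
    apply: continuous_compact; last exact: compact_enorm_le.
    apply: continuous_in_subspaceT => x /set_mem /= xr.
    by have [] := hf.1.1 x (le_lt_trans xr r1).
  move=> /compact_bounded[M [_ h]]; exists (M + 1) => x xr.
  by apply: h; [rewrite ltrDl|exists x].
(* On |x| <= r the denominator |x - z|^2 is at least (1 - r)^2 and the numerator at most 1. The
   bound does not degenerate as s tends to 0. *)
pose Mp := ((1 - r) ^+ 2)^-1 ^+ (n - 1) : R.
have hMp (z x : 'rV[R]_n) : unit_sphere z -> enorm x <= r -> `|poisson z x| <= Mp.
  move=> Sz xr; have xB : unit_ball x by exact: le_lt_trans xr r1.
  rewrite ger0_norm ?poisson_ge0// /poisson /Mp /pquo; apply: lerXn2r.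
  - rewrite nnegrE; apply: divr_ge0; last exact/ltW/pden_gt0.
    by rewrite subr_ge0; apply/ltW/unit_ballE.
  - by rewrite nnegrE invr_ge0 sqr_ge0.
  - have p0 := pden_gt0 Sz xB.
    have h1 : (1 - r) ^+ 2 <= pden z x.
      apply: le_trans (pden_ge x Sz); rewrite lerXn2r ?nnegrE ?subr_ge0//; first exact: ltW.
        exact/ltW.
      by rewrite lerB.
    apply: (@le_trans _ _ (pden z x)^-1).
      by apply: ler_piMl; [rewrite invr_ge0 ltW|rewrite gerBl dotv_ge0].
    by rewrite lef_pV2// posrE// exprn_gt0// subr_gt0.
have Mp0 : 0 <= Mp by rewrite exprn_ge0// invr_ge0 sqr_ge0.
exists (Mf * Mp + Mp * Mf) => s z /andP[s0 sr] Sz.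
have ns : `|s| < 1 by rewrite ger0_norm ?ltW// (le_lt_trans sr).
have er (e : 'rV[R]_n) (t : R) : 0 <= t <= r -> unit_sphere e -> enorm (t *: e : 'rV[R]_n) <= r.
  by move=> /andP[t0 tr] Se; rewrite enormZ Se mulr1 ger0_norm.
have s0r : 0 <= s <= r by rewrite ltW.
have rr : 0 <= r <= r by rewrite ltW/=.
apply: le_trans (ler_normB _ _) _; apply: lerD; apply: norm_sint_le => //.
- by apply: scontM; [exact: scont_harmonic|exact: scont_poisson].
- by move=> e Se; rewrite normrM ler_pM ?hMf ?hMp ?er.
- by apply: scontM; [exact: scont_poisson|exact: cfr].
- by move=> e Se; rewrite normrM ler_pM ?hMf ?hMp ?er.
Qed.

(* Rotating z amounts to rotating the argument of f or of the Poisson kernel, so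
   that angular derivatives in z turn into angular derivatives of f. *)
Lemma exchange_defect_rotate (i j : 'I_n) (s : R) (z : 'rV[R]_n) (t : R) : i != j -> unit_sphere z ->
  0 < s < 1 -> 0 < 1 + cos t ->
  exchange_defect s (prot i j (cos t) (sin t) z) =
  sint (fun e => f (s *: prot i j (cos t) (1 * sin t) e) * poisson z (r *: e))
  - sint (fun e => poisson z (s *: prot i j (cos t) (-1 * sin t) e) * f (r *: e)).
Proof.
move=> ij Sz /andP[s0 s1] ct; have cs := cos2Dsin2 t.
have cs' : cos t ^+ 2 + (- sin t) ^+ 2 = 1 by rewrite sqrrN.
have ns : `|s| < 1 by rewrite ger0_norm// ltW.
have SRz := unit_sphere_prot ij cs Sz.
rewrite mulN1r mul1r /exchange_defect; congr (_ - _).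
  rewrite -(sint_prot n0 _ ij ct cs); last first.
    by apply: scontM; [exact: scont_harmonic|exact: scont_poisson].
  apply: eq_sint => e Se; congr (_ * _).
  by rewrite poisson_prot// protK.
by apply: eq_sint => e Se; rewrite poisson_prot.
Qed.

(* The defect, a function of s and z, satisfies the polar form of the H-harmonic
   equation and vanishes at s = r. The maximum principle is applied after adding
   the barrier eps / s, on which the polar operator is negative. *)
Lemma exchange_le (c : R) (s : R) (z : 'rV[R]_n) : unit_sphere z -> 0 < s <= r ->
  c * exchange_defect s z <= 0.
Proof.
move=> Sz /andP[s0 sr]; have /andP[r0 r1] := r01.
apply/ler_addgt0Pr => eps0 eps00.
(* Chosen so that the barrier [eps / t] takes the value [eps0] at t = s. *)
pose eps := eps0 * s.
have epsp : 0 < eps by rewrite mulr_gt0.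
pose E t y := c * exchange_defect t y - eps / t.
suff : E s z <= 0 by rewrite /E subr_le0 /eps mulfK ?gt_eqF// add0r.
rewrite leNgt; apply/negP => Ep.
have [M hM] := exchange_defect_bounded.
have M0 : 0 <= M by apply: le_trans (hM s z _ Sz); rewrite ?s0.
pose L := `|c| * M + 1.
have L0 : 0 < L by rewrite ltr_wpDl// mulr_ge0.
(* At t = d the barrier is at least L = |c| M + 1, more than c times the defect can reach; the
   minimum with s keeps (s, z) in the compact set [A]. *)
pose d := Num.min (eps / L) s.
have d0 : 0 < d by rewrite lt_min s0 divr_gt0.
have ds : d <= s by rewrite ge_min lexx orbT.
have dr : d <= r by exact: le_trans sr.
pose A : set (R * 'rV[R]_n) := `[d, r]%classic `*` @unit_sphere R n.
have cA : compact A by apply: compact_setX; [exact: segment_compact|exact: compact_sphere].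
have A0 : A !=set0 by exists (s, z); split => //=; rewrite in_itv/= ds.
have cE : {within A, continuous (fun p => E p.1 p.2)}.
  apply/subspace_continuousP => -[t y] [/=]; rewrite in_itv/= => /andP[dt tr] Sy.
  have t0 : 0 < t by exact: lt_le_trans dt.
  have t01 : 0 < t < 1 by rewrite t0 (le_lt_trans tr).
  have h := exchange_defect_continuous Sy t01.
  have wA : within A (nbhs (t, y)) `=>` within [set p | 0 < p.1 < 1 /\ unit_sphere p.2] (nbhs (t, y)).
    move=> P; rewrite /within/=; apply: filterS => -[t' y'] /= HP [/=].
    rewrite in_itv/= => /andP[dt' tr'] Sy'; apply: HP; split => //.
    by rewrite (lt_le_trans d0)//= (le_lt_trans tr').
  apply: cvgB; apply: cvgM.
  - exact: cvg_cst.
  - exact: (cvg_trans (cvg_app _ wA) h).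
  - exact: cvg_cst.
  - apply: cvgV; first by rewrite gt_eqF.
    apply: (@cvg_comp _ _ _ id fst _ (nbhs (t, y))); first exact: cvg_within.
    exact: cvg_fst.
have [[s1 z1] /set_mem[/=]] := compact_EVT_max A0 cA cE.
rewrite in_itv/= => /andP[ds1 s1r] Sz1 mx.
have {mx}mx t y : d <= t <= r -> unit_sphere y -> E t y <= E s1 z1.
  by move=> dtr Sy; apply: (mx (t, y)); rewrite inE; split => //=; rewrite in_itv.
have Ep1 : 0 < E s1 z1 by apply: lt_le_trans Ep (mx s z _ Sz); rewrite ds.
have s10 : 0 < s1 by exact: lt_le_trans ds1.
(* A positive maximum is attained at neither end of [d, r]: at r the defect vanishes, at d the
   barrier wins. So the radius [s1] is interior and derivative tests apply. *)
have s1lt : s1 < r.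
  rewrite lt_neqAle s1r andbT; apply/eqP => s1E; move: Ep1.
  have D0 : exchange_defect s1 z1 = 0.
    by rewrite /exchange_defect s1E (eq_sint (fun e _ => mulrC _ _)) subrr.
  by rewrite /E D0 mulr0 add0r oppr_gt0 pmulr_llt0 ?invr_gt0// ltNge ltW.
have ds1lt : d < s1.
  rewrite lt_neqAle ds1 andbT; apply/eqP => s1E; move: Ep1.
  have hD : c * exchange_defect s1 z1 <= `|c| * M.
    apply: le_trans (ler_norm _) _; rewrite normrM ler_wpM2l//.
    by apply: hM; rewrite ?s10.
  have hL : L <= eps / s1.
    rewrite ler_pdivlMr// -s1E mulrC -ler_pdivlMr//.
    by rewrite ge_min lexx.
  by rewrite /E; move: hL; rewrite /L; lra.
have s101 : 0 < s1 < 1 by rewrite s10 (lt_trans s1lt).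
have hP := H_harmonic_poisson n2 Sz1.
pose k1 (e : 'rV[R]_n) := poisson z1 (r *: e).
have ck1 : scont k1 by exact: scont_poisson.
have [F1 F2] := sint_radial hf ck1 s101.
have [P1 P2] := sint_radial hP cfr s101.
pose k2 (e : 'rV[R]_n) := f (r *: e).
have near_pos : \forall t \near s1, d <= t <= r /\ t != 0.
  have : \forall t \near s1, t \in `]d, r[.
    by apply: near_in_itvoo; rewrite in_itv/= ds1lt.
  apply: filterS => t; rewrite in_itv/= => /andP[dt tr]; split; first by rewrite !ltW.
  by rewrite gt_eqF// (lt_trans d0).
have dinv (t : R) : t != 0 -> is_derive t 1 (fun t : R => eps * t^-1) (eps * (- 1 / t ^+ 2)).
  by move=> t0; apply: is_derive_mulc; exact: (is_derive_inv t0 (is_derive_id t 1)).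
have dinv2 (t : R) : t != 0 ->
    is_derive t 1 (fun t : R => eps * (- 1 / t ^+ 2)) (2 * eps / t ^+ 3).
  move=> t0; have t20 : t ^+ 2 != 0 by rewrite expf_neq0.
  have h := @is_derive_inv _ _ (fun t : R => t ^+ 2) t 1 _ t20 (is_derive_exp 2 (is_derive_id t 1)).
  apply: (is_derive_to (is_derive_mulc eps (is_derive_mulc (-1) h))).
  by field.
pose phi t := c * (sint (fun e => f (t *: e) * k1 e)
  - sint (fun e => poisson z1 (t *: e) * k2 e)) - eps * t^-1.
pose dphi t := c * (sint1 f k1 t - sint1 (poisson z1) k2 t) - eps * (- 1 / t ^+ 2).
have N1 : \forall t \near s1, is_derive (t : R) 1 phi (dphi t).
  move: near_pos F1 P1; apply: filterS3 => t [_ t0] hF hP'.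
  exact: (is_derive_sub (is_derive_mulc c (is_derive_sub hF hP')) (dinv t t0)).
have N2 : is_derive s1 1 dphi
    (c * (sint2 f k1 s1 - sint2 (poisson z1) k2 s1) - 2 * eps / s1 ^+ 3).
  have t0 : s1 != 0 by rewrite gt_eqF.
  exact: (is_derive_sub (is_derive_mulc c (is_derive_sub F2 P2)) (dinv2 s1 t0)).
have N3 : \forall t \near s1, phi t <= phi s1.
  by apply: filterS near_pos => t [dtr _]; exact: mx.
have [a1 a2] := second_derivative_max N1 N2 N3.
rewrite /dphi {phi N1 N2 N3 dphi} in a1.
(* The barrier depends on the radius only, so angle 0 is a maximum among the rotations of [z1] at
   fixed [s1]. Small angles keep 1 + cos t > 0, as rotation invariance requires. *)
have a3 (p : 'I_n * 'I_n) : p.1 != p.2 ->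
    c * (sintp f k1 s1 p - sintp (poisson z1) k2 s1 p) <= 0.
  case: p => i j /= ij.
  have [dF [dF1 dF2]] := sint_rotational hf ck1 ij (expr1n R 2) s101.
  have b1 : (-1 : R) ^+ 2 = 1 by rewrite sqrrN expr1n.
  have [dP [dP1 dP2]] := sint_rotational hP cfr ij b1 s101.
  pose phi t := c * (sint (fun e => f (s1 *: prot i j (cos t) (1 * sin t) e) * k1 e)
    - sint (fun e => poisson z1 (s1 *: prot i j (cos t) (-1 * sin t) e) * k2 e)).
  have phi0 : phi 0 = c * exchange_defect s1 z1.
    rewrite /phi cos0 sin0 !mulr0; congr (c * (_ - _)); apply: eq_sint => e _;
    by rewrite prot10.
  have near_cos : \forall t \near (0 : R), 0 < 1 + cos t.
    have h : cos t @[t --> (0 : R)] --> (cos 0 : R) by exact: continuous_cos.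
    have c0 : 0 < cos 0 :> R by rewrite cos0.
    by have /cvgr_gt/(_ 0 c0) := h; apply: filterS => t ?; lra.
  pose dphi t := c * (dF t - dP t).
  have N1 : \forall t \near (0 : R), is_derive (t : R) 1 phi (dphi t).
    move: dF1 dP1; apply: filterS2 => t hF hP'.
    exact: (is_derive_mulc c (is_derive_sub hF hP')).
  have N2 := is_derive_mulc c (is_derive_sub dF2 dP2).
  have N3 : \forall t \near (0 : R), phi t <= phi 0.
    apply: filterS near_cos => t ct.
    rewrite phi0 /phi -exchange_defect_rotate//.
    have := mx s1 (prot i j (cos t) (sin t) z1).
    rewrite ds1 s1r => /(_ isT (unit_sphere_prot ij (cos2Dsin2 t) Sz1)).
    by rewrite /E; lra.
  by have [] := second_derivative_max N1 N2 N3.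
have QF := polar_integral hf ck1 s101.
have QP := polar_integral hP cfr s101.
rewrite -/k2 in QP.
have {}a3 : c * (\sum_(p : 'I_n * 'I_n | p.1 != p.2) sintp f k1 s1 p
    - \sum_(p : 'I_n * 'I_n | p.1 != p.2) sintp (poisson z1) k2 s1 p) <= 0.
  by rewrite -sumrB mulr_sumr; apply: sumr_le0 => p; exact: a3.
have n3 : 3 <= n%:R :> R by rewrite ler_nat.
move: QF QP a1 a2 a3.
move: (sint1 f k1 s1) (sint2 f k1 s1) (\sum_(p | _) sintp f k1 s1 p).
move: (sint1 _ k2 s1) (sint2 _ k2 s1) (\sum_(p | _) sintp _ k2 s1 p).
move=> p1 p2 p3 f1 f2 f3 QF QP a1 a2 a3.
have u0 : 0 < 1 - s1 ^+ 2 by rewrite subr_gt0 expr_lt1 ?ltW// (lt_trans s1lt).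
have v0 : 0 < s1^-1 by rewrite invr_gt0.
have s1n0 : s1 != 0 by rewrite gt_eqF.
have A1 : c * (f1 - p1) = - eps * s1^-1 ^+ 2.
  by apply/eqP; rewrite -subr_eq0 -[X in _ == X]a1; apply/eqP; field.
have A2 : c * (f2 - p2) <= 2 * eps * s1^-1 ^+ 3.
  by rewrite -subr_le0; apply: le_trans a2; rewrite le_eqVlt; apply/orP; left; apply/eqP; field.
have X0 : (1 - s1 ^+ 2) * (c * (f2 - p2) + (n%:R - 1) * s1^-1 * (c * (f1 - p1))
    + 2^-1 * s1^-1 ^+ 2 * (c * (f3 - p3))) + 2 * (n%:R - 2) * s1 * (c * (f1 - p1)) = 0.
  rewrite -[RHS](mulr0 c) -[in RHS](subrr 0) -{1}QF -QP; field.
  by [].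
(* At the maximum the first radial derivative is that of the barrier, -eps/s1^2, and the second is
   at most 2 eps/s1^3; together they contribute at most (3 - n) eps/s1^3 <= 0. The remaining
   first-order term [B2] is strictly negative, which contradicts [X0]. *)
have B1 : c * (f2 - p2) + (n%:R - 1) * s1^-1 * (c * (f1 - p1))
    + 2^-1 * s1^-1 ^+ 2 * (c * (f3 - p3)) <= 0.
  have h1 : 2^-1 * s1^-1 ^+ 2 * (c * (f3 - p3)) <= 0.
    by rewrite mulr_ge0_le0// mulr_ge0 ?invr_ge0// sqr_ge0.
  have h2 : (n%:R - 3) * (eps * s1^-1 ^+ 3) >= 0.
    by rewrite mulr_ge0 ?subr_ge0// mulr_ge0 ?ltW// exprn_gt0.
  have h3 : 2 * eps * s1^-1 ^+ 3 + (n%:R - 1) * s1^-1 * (- eps * s1^-1 ^+ 2)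
      = - ((n%:R - 3) * (eps * s1^-1 ^+ 3)) by ring.
  by rewrite A1; lra.
have B2 : 2 * (n%:R - 2) * s1 * (c * (f1 - p1)) < 0.
  rewrite A1 mulNr mulrN oppr_lt0 mulr_gt0//; last by rewrite mulr_gt0// exprn_gt0.
  by rewrite mulr_gt0// mulr_gt0//; lra.
have B3 := mulr_ge0_le0 (ltW u0) B1.
by move: X0; lra.
Qed.

End maximum_principle.

(** [exchange_le] with c = 1 and c = -1 forces the defect to vanish for s <= r; the other case
    follows by symmetry in the radii. *)
Lemma poisson_exchange (f : 'rV[R]_n -> R) (r s : R) (z : 'rV[R]_n) :
  H_harmonic f -> 0 < r < 1 -> 0 < s < 1 -> unit_sphere z ->
  sint (fun e => f (s *: e) * poisson z (r *: e)) =
  sint (fun e => f (r *: e) * poisson z (s *: e)).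
Proof.
move=> hf.
have H (a b : R) : 0 < a < 1 -> 0 < b <= a -> unit_sphere z ->
    sint (fun e => f (b *: e) * poisson z (a *: e)) =
    sint (fun e => f (a *: e) * poisson z (b *: e)).
  move=> a01 ba Sz.
  have h1 := exchange_le hf a01 1 Sz ba.
  have h2 := exchange_le hf a01 (-1) Sz ba.
  have : exchange_defect f a b z = 0 by lra.
  move/eqP; rewrite subr_eq0 => /eqP ->.
  by apply: eq_sint => e _; rewrite mulrC.
move=> r01 s01 Sz; have [sr|rs] := lerP s r.
  by apply: H => //; case/andP: s01 => ->.
by apply/esym/H => //; case/andP: r01 => -> _; exact: ltW.
Qed.


End exchange.

(** * Expansion of the Poisson kernel *)

Section binomial_series.
Context {R : realType}.
Implicit Types (a j k N : nat) (t rho : R).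

(** The coefficient of t^j in (1 - t)^(-a). *)
Definition binom_coef a j : R := pochhammer (a%:R : R) j / j`!%:R.

Definition binom_sum a N t : R := \sum_(j < N.+1) binom_coef a j * t ^+ j.

Lemma pochhammer_ge0 (b : R) j : 0 <= b -> 0 <= pochhammer b j.
Proof. by move=> b0; apply: prodr_ge0 => i _; rewrite addr_ge0. Qed.

Lemma pochhammerS (b : R) j : pochhammer b j.+1 = pochhammer b j * (b + j%:R).
Proof. by rewrite /pochhammer big_ord_recr. Qed.

Lemma pochhammer_recl (b : R) j : pochhammer b j.+1 = b * pochhammer (b + 1) j.
Proof.
rewrite /pochhammer big_ord_recl addr0; congr (_ * _); apply: eq_bigr => i _.
by rewrite lift0 -natr1; ring.
Qed.

Lemma fact_neq0 j : (j`!%:R : R) != 0.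
Proof. by rewrite pnatr_eq0 -lt0n fact_gt0. Qed.

Lemma binom_coef0 a : binom_coef a 0 = 1.
Proof. by rewrite /binom_coef /pochhammer big_ord0 fact0 divr1. Qed.

Lemma binom_coef_ge0 a j : 0 <= binom_coef a j.
Proof. by rewrite divr_ge0// pochhammer_ge0. Qed.

Lemma binom_coefS a j : binom_coef a.+1 j.+1 = binom_coef a.+1 j + binom_coef a j.+1.
Proof.
rewrite /binom_coef pochhammerS pochhammer_recl factS natrM -!natr1.
set p := pochhammer _ _; have := fact_neq0 j; set f := j`!%:R => f0.
by field; rewrite f0 natr1 pnatr_eq0.
Qed.

(** The truncation of (1 - t) (1 - t)^(-a-1) = (1 - t)^(-a) with its exact remainder; the binomial
    series can then be handled by induction on [a]. *)
Lemma binom_sum_step a N t : (1 - t) * binom_sum a.+1 N t =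
  binom_sum a N t - binom_coef a.+1 N * t ^+ N.+1.
Proof.
rewrite /binom_sum; elim: N => [|N IH].
  by rewrite !big_ord_recr !big_ord0/= !binom_coef0 expr0 expr1; ring.
rewrite big_ord_recr/= mulrDr IH [in RHS]big_ord_recr/= binom_coefS.
by rewrite (exprS t N.+1); ring.
Qed.

Lemma binom_sum0 N t : binom_sum 0 N t = 1.
Proof.
rewrite /binom_sum big_ord_recl binom_coef0 expr0 mulr1 big1 ?addr0// => i _.
by rewrite /binom_coef lift0 pochhammer_recl !mul0r.
Qed.

Lemma binom_sum_le a N t : 0 <= t < 1 -> binom_sum a N t <= (1 - t)^-1 ^+ a.
Proof.
move=> /andP[t0 t1]; have t10 : 0 < 1 - t by rewrite subr_gt0.
elim: a => [|a IH]; first by rewrite binom_sum0 expr0.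
rewrite exprS -ler_pdivrMl ?invr_gt0// invrK binom_sum_step; apply: le_trans IH.
by rewrite gerBl mulr_ge0 ?binom_coef_ge0 ?exprn_ge0.
Qed.

(** The partial sums at [rho] increase and stay below (1 - rho)^(-a), so the series converges and
    its terms tend to 0. *)
Lemma binom_term_cvg0 a rho : 0 <= rho < 1 ->
  binom_coef a N * rho ^+ N @[N --> \oo] --> 0.
Proof.
move=> hr; have r0 : 0 <= rho by case/andP: hr.
apply: cvg_series_cvg_0; apply: nondecreasing_is_cvgn.
  apply/nondecreasing_seqP => N; rewrite /series/= big_nat_recr//= lerDl.
  by rewrite mulr_ge0 ?binom_coef_ge0 ?exprn_ge0.
exists ((1 - rho)^-1 ^+ a) => _ [N _ <-].
apply: le_trans (binom_sum_le a N hr).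
rewrite /series/= big_mkord /binom_sum big_ord_recr/= lerDl.
by rewrite mulr_ge0 ?binom_coef_ge0 ?exprn_ge0.
Qed.

Lemma binom_sum_cvg_uniform a rho : 0 <= rho < 1 -> exists d : R^nat,
  d N @[N --> \oo] --> 0 /\
  forall N t, `|t| <= rho -> `|binom_sum a N t - (1 - t)^-1 ^+ a| <= d N.
Proof.
move=> hr; have /andP[r0 r1] := hr.
elim: a => [|a [d [d0 hd]]].
  exists (fun=> 0); split; first exact: cvg_cst.
  by move=> N t _; rewrite binom_sum0 expr0 subrr normr0.
(* The error for [a] plus the remainder of [binom_sum_step], divided by 1 - t >= 1 - rho. *)
exists (fun N => (d N + binom_coef a.+1 N * rho ^+ N * rho) * (1 - rho)^-1); split.
  rewrite -(mul0r (1 - rho)^-1); apply: cvgM; last exact: cvg_cst.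
  rewrite -(addr0 0); apply: cvgD => //; rewrite -(mul0r rho).
  by apply: cvgM; [exact: binom_term_cvg0|exact: cvg_cst].
move=> N t tr; have := hd N t tr.
have ht := ler_norm t; have ht' := ler_norm (- t); rewrite normrN in ht'.
have t10 : 0 < 1 - t by lra.
move=> hN.
have -> : binom_sum a.+1 N t - (1 - t)^-1 ^+ a.+1 =
    (binom_sum a N t - (1 - t)^-1 ^+ a - binom_coef a.+1 N * t ^+ N.+1) * (1 - t)^-1.
  rewrite addrAC -binom_sum_step exprS; field; lra.
rewrite normrM; apply: ler_pM => //; last first.
  by rewrite ger0_norm ?invr_ge0 ?(ltW t10)// lef_pV2 ?posrE ?subr_gt0//; lra.
apply: le_trans (ler_normB _ _) _; apply: lerD => //.
rewrite normrM ger0_norm ?binom_coef_ge0// normrX exprSr mulrA.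
apply: ler_pM => //; first by rewrite mulr_ge0 ?binom_coef_ge0 ?exprn_ge0.
by apply: ler_wpM2l; [exact: binom_coef_ge0|exact: lerXn2r].
Qed.

End binomial_series.

(** * Uniform expansion of the Poisson kernel on the sphere *)

Section poisson_expansion.
Context {R : realType} (n : nat).
Implicit Types (x z : 'rV[R]_n) (N : nat).

Definition poisson_scale x : R := 2 / (1 + dotv x x).

Definition poisson_factor x : R := ((1 - dotv x x) / (1 + dotv x x)) ^+ (n - 1).

Definition poisson_sum x N z : R :=
  poisson_factor x * binom_sum (n - 1) N (poisson_scale x * dotv x z).

Lemma poisson_factor_gt0 x : unit_ball x -> 0 < poisson_factor x.
Proof.
move=> /unit_ballE xB; have x0 := dotv_ge0 x.
by rewrite exprn_gt0// divr_gt0//; lra.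
Qed.

(** 2|x| < 1 + |x|^2 because (1 - |x|)^2 > 0. This number bounds the argument of the binomial series
    for all unit z, which makes the expansion uniform. *)
Lemma poisson_scale_lt1 x : unit_ball x -> 0 <= poisson_scale x * enorm x < 1.
Proof.
move=> xB; have x0 := enorm_ge0 x; have := dotv_ge0 x.
rewrite /poisson_scale -sqr_enorm => xx.
apply/andP; split; first by rewrite mulr_ge0// divr_ge0//; lra.
rewrite mulrAC ltr_pdivrMr; last lra.
have : 0 < (1 - enorm x) ^+ 2 by rewrite exprn_gt0// subr_gt0.
rewrite expr2; nra.
Qed.

Lemma poissonE z x : unit_sphere z -> unit_ball x ->
  poisson z x = poisson_factor x * (1 - poisson_scale x * dotv x z)^-1 ^+ (n - 1).
Proof.
move=> Sz xB; rewrite /poisson /poisson_factor -exprMn; congr (_ ^+ _).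
have := pden_neq0 Sz xB; have x0 := dotv_ge0 x.
rewrite /pquo /pden /poisson_scale => q0; field.
by rewrite q0 andbT gt_eqF//; lra.
Qed.

Lemma poisson_sum_cvg_uniform x : unit_ball x -> exists d : R^nat,
  d N @[N --> \oo] --> 0 /\
  forall N, on_sphere (fun z => `|poisson_sum x N z - poisson z x| <= d N).
Proof.
move=> xB; have [d [d0 hd]] := binom_sum_cvg_uniform (n - 1) (poisson_scale_lt1 xB).
exists (fun N => poisson_factor x * d N); split.
  by rewrite -(mulr0 (poisson_factor x)); apply: cvgM => //; exact: cvg_cst.
move=> N z Sz; rewrite poissonE// /poisson_sum -mulrBr normrM.
have f0 := ltW (poisson_factor_gt0 xB); rewrite ger0_norm//; apply: ler_wpM2l => //.
apply: hd; rewrite normrM; have x0 := dotv_ge0 x.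
have s0 : 0 <= poisson_scale x by rewrite divr_ge0//; lra.
rewrite ger0_norm//; apply: ler_wpM2l => //.
by have := dotv_le x z; rewrite Sz mulr1.
Qed.

Lemma scont_dotv x : scont (fun z => dotv x z).
Proof.
move=> e _.
exact: (@cvg_dotv R n _ (nbhs e) _ (fun=> x) id x e (@cvg_cst _ x _ (nbhs e) _) (@cvg_id _ (nbhs e))).
Qed.

Lemma scontX (f : 'rV[R]_n -> R) k : scont f -> scont (fun z => f z ^+ k).
Proof.
move=> cf; elim: k => [|k IH]; first exact: (@scont_cst R n 1).
by under eq_fun do rewrite exprS; exact: scontM.
Qed.

Lemma scont_poisson_sum x N : scont (poisson_sum x N).
Proof.
apply: scontM; first exact: scont_cst.
apply: scont_sum => j _; apply: scontM; first exact: scont_cst.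
by apply: scontX; apply: scontM; [exact: scont_cst|exact: scont_dotv].
Qed.

End poisson_expansion.

(** * Interchanging two integrations over the sphere *)

Section poisson_symmetry.
Context {R : realType} (n : nat).
Hypothesis n2 : (2 < n)%N.

Let n0 : (0 < n)%N. Proof. exact: ltn_trans n2. Qed.

Lemma cvg_pow (T : Type) (F : set_system T) (FF : Filter F) (f : T -> R) (l : R) k :
  f t @[t --> F] --> l -> f t ^+ k @[t --> F] --> l ^+ k.
Proof.
move=> fl; elim: k => [|k IH]; first exact: cvg_cst.
by rewrite exprS; under eq_fun do rewrite exprS; exact: cvgM.
Qed.

Lemma scont_sint_dotv (b : 'rV[R]_n -> R) j : scont b ->
  scont (fun e => sint (fun z => b z * dotv e z ^+ j)).
Proof.
move=> cb e Se.
apply: (@sint_continuous R n _ (fun z e => b z * dotv e z ^+ j) e n0).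
apply: (@filterE _ (nbhs e) _) => e' z Sz; rewrite /continuous_at/=.
apply: cvgM; first exact: (@cvg_at _ (nbhs (z, e')) _ _ fst b z (@cvg_fst _ _ (nbhs z) (nbhs e') _) (cb z Sz)).
have c := @cvg_dotv R n _ (nbhs (z, e')) _ snd fst e' z
   (@cvg_snd _ _ (nbhs z) (nbhs e') _) (@cvg_fst _ _ (nbhs z) (nbhs e') _).
exact: (cvg_pow _ (c _ _ _)).
Qed.

(** Induction on the exponent: <e,z>^(j+1) is the sum of e_i z_i <e,z>^j, and the factors e_i and
    z_i are absorbed into [a] and [b]. At exponent 0 both sides are a product of two integrals. *)
Lemma sint_swap_dotv (a b : 'rV[R]_n -> R) j : scont a -> scont b ->
  sint (fun e => a e * sint (fun z => b z * dotv e z ^+ j)) =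
  sint (fun e => b e * sint (fun z => a z * dotv e z ^+ j)).
Proof.
have cc i : scont (fun e : 'rV[R]_n => e ord0 i).
  move=> e _; exact: (@cvg_coord R n _ (nbhs e) _ id e i (@cvg_id _ (nbhs e))).
have cd x k : scont (fun z : 'rV[R]_n => dotv x z ^+ k) by apply: scontX; exact: scont_dotv.
have half (a1 b1 : 'rV[R]_n -> R) k : scont a1 -> scont b1 ->
    sint (fun e => a1 e * sint (fun z => b1 z * dotv e z ^+ k.+1)) =
    \sum_(i < n) sint (fun e => a1 e * e ord0 i * sint (fun z => b1 z * z ord0 i * dotv e z ^+ k)).
  move=> ca cb; rewrite -sint_sum// => [|i _]; last first.
    by apply: scontM; [exact: scontM|apply: scont_sint_dotv; exact: scontM].
  apply: eq_sint => e Se.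
  rewrite (_ : sint _ = \sum_(i < n) e ord0 i * sint (fun z => b1 z * z ord0 i * dotv e z ^+ k)).
    by rewrite mulr_sumr; apply: eq_bigr => i _; rewrite mulrA.
  rewrite (eq_bigr (fun i => sint (fun z => e ord0 i * (b1 z * z ord0 i * dotv e z ^+ k)))); last first.
    by move=> i _; rewrite sintZl//; apply: scontM; [exact: scontM|exact: cd].
  rewrite -sint_sum// => [|i _]; last first.
    by apply: scontM; [exact: scont_cst|apply: scontM; [exact: scontM|exact: cd]].
  apply: eq_sint => z Sz; rewrite exprS {1}/dotv mulr_suml mulr_sumr.
  by apply: eq_bigr => i _; ring.
elim: j a b => [|j IH] a b ca cb.
  under eq_fun do under eq_fun do rewrite expr0 mulr1.
  under [in RHS]eq_fun do under eq_fun do rewrite expr0 mulr1.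
  under eq_fun do rewrite mulrC; under [in RHS]eq_fun do rewrite mulrC.
  by rewrite !sintZl// mulrC.
rewrite (half a b _ ca cb) (half b a _ cb ca); apply: eq_bigr => i _.
by apply: IH; exact: scontM.
Qed.

(** For unit e and z the kernel P(z, s e) depends on <e,z> only, and 2|s| / (1 + s^2) < 1; hence
    coefficients and error that do not depend on e and z. *)
Lemma poisson_zonal_approx (s : R) : `|s| < 1 -> exists q d : R^nat,
  d N @[N --> \oo] --> 0 /\
  forall N (e z : 'rV[R]_n), unit_sphere e -> unit_sphere z ->
    `|\sum_(j < N.+1) q j * dotv e z ^+ j - poisson z (s *: e)| <= d N.
Proof.
move=> s1; have h : 0 <= 2 * `|s| / (1 + s ^+ 2) < 1.
  rewrite -(real_normK (num_real s)); have s0 := normr_ge0 s; apply/andP; split.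
    by rewrite divr_ge0 ?mulr_ge0// addr_ge0 ?sqr_ge0.
  rewrite ltr_pdivrMr; last by rewrite ltr_wpDr ?sqr_ge0.
  have : 0 < (1 - `|s|) ^+ 2 by rewrite exprn_gt0// subr_gt0.
  rewrite !expr2; nra.
have [d [d0 hd]] := binom_sum_cvg_uniform (n - 1) h.
have s20 : 0 < 1 + s ^+ 2 by rewrite ltr_wpDr ?sqr_ge0.
have s21 : s ^+ 2 < 1 by rewrite -(real_normK (num_real s)) expr_lt1.
pose C : R := ((1 - s ^+ 2) / (1 + s ^+ 2)) ^+ (n - 1).
have C0 : 0 <= C by rewrite exprn_ge0// divr_ge0 ?(ltW s20)// subr_ge0 ltW.
pose lam : R := 2 / (1 + s ^+ 2) * s.
exists (fun j => C * binom_coef (n - 1) j * lam ^+ j), (fun N => C * d N); split.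
  by rewrite -(mulr0 C); apply: cvgM => //; exact: cvg_cst.
move=> N e z Se Sz; have Se1 := (unit_sphereE e).1 Se.
rewrite poissonE//; last exact: unit_ballZ.
rewrite /poisson_factor /poisson_scale !dotvZl !dotvZr Se1 mulr1 -expr2 -/C.
have -> : \sum_(j < N.+1) C * binom_coef (n - 1) j * lam ^+ j * dotv e z ^+ j =
    C * binom_sum (n - 1) N (lam * dotv e z).
  rewrite /binom_sum mulr_sumr; apply: eq_bigr => j _.
  by rewrite -mulrA -(exprMn j lam) -mulrA.
rewrite mulrA -/lam -mulrBr normrM (ger0_norm C0); apply: ler_wpM2l => //.
apply: hd; rewrite normrM /lam normrM ger0_norm; last by rewrite divr_ge0// ltW.
rewrite (mulrAC 2 `|s|) -[leRHS]mulr1; apply: ler_wpM2l.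
  by rewrite mulr_ge0// divr_ge0// ltW.
by have := dotv_le e z; rewrite Se Sz mulr1.
Qed.

Lemma scont_sint_poisson (b : 'rV[R]_n -> R) (s : R) : `|s| < 1 -> scont b ->
  scont (fun e => sint (fun z => b z * poisson z (s *: e))).
Proof.
move=> s1 cb e Se.
apply: (@sint_continuous R n _ (fun z e : 'rV[R]_n => b z * poisson z (s *: e)) e n0).
have hB : nbhs e (fun e' : 'rV[R]_n => unit_ball (s *: e')).
  apply: (@scaler_continuous _ _ s e (@unit_ball R n)).
  exact: (open_nbhs_nbhs (conj (@open_unit_ball R n) (unit_ballZ s1 Se))).
move: hB; apply: filterS => e' Be z Sz; rewrite /continuous_at/=.
apply: cvgM; first exact: (@cvg_at _ (nbhs (z, e')) _ _ fst b z (@cvg_fst _ _ (nbhs z) (nbhs e') _) (cb z Sz)).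
apply: (@cvg_poisson R n _ (nbhs (z, e')) _ fst (fun p => s *: p.2) z (s *: e')) => //.
  exact: (@cvg_fst _ _ (nbhs z) (nbhs e') _).
exact: cvg_scalev (@cvg_snd _ _ (nbhs z) (nbhs e') _).
Qed.

(* Polynomials in <e,z> are sums of products of functions of e and z, so the
   integrals against them commute by linearity; the Poisson kernel is a uniform
   limit of such polynomials. *)
Lemma sint_swap_poisson (a b : 'rV[R]_n -> R) (s : R) : `|s| < 1 -> scont a -> scont b ->
  sint (fun e => a e * sint (fun z => b z * poisson z (s *: e))) =
  sint (fun e => b e * sint (fun z => a z * poisson z (s *: e))).
Proof.
move=> s1 ca cb; have [q [d [d0 hd]]] := poisson_zonal_approx s1.
pose Q N (e z : 'rV[R]_n) := \sum_(j < N.+1) q j * dotv e z ^+ j.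
have cQ N e : scont (Q N e).
  apply: scont_sum => j _; apply: scontM; first exact: scont_cst.
  by apply: scontX; exact: scont_dotv.
have inner (b1 : 'rV[R]_n -> R) N e : scont b1 ->
    sint (fun z => b1 z * Q N e z) = \sum_(j < N.+1) q j * sint (fun z => b1 z * dotv e z ^+ j).
  move=> cb1; rewrite (eq_bigr (fun j : 'I_N.+1 => sint (fun z => q j * (b1 z * dotv e z ^+ j)))); last first.
    by move=> j _; rewrite sintZl//; apply: scontM => //; apply: scontX; exact: scont_dotv.
  rewrite -sint_sum//; last first.
    move=> j _; apply: scontM; first exact: scont_cst.
    by apply: scontM => //; apply: scontX; exact: scont_dotv.
  by apply: eq_sint => z Sz; rewrite mulr_sumr; apply: eq_bigr => j _; ring.
have cinner (b1 : 'rV[R]_n -> R) N : scont b1 -> scont (fun e => sint (fun z => b1 z * Q N e z)).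
  move=> cb1; under eq_fun do rewrite inner//.
  apply: scont_sum => j _; apply: scontM; first exact: scont_cst.
  exact: scont_sint_dotv.
have outer (a1 b1 : 'rV[R]_n -> R) N : scont a1 -> scont b1 ->
    sint (fun e => a1 e * sint (fun z => b1 z * Q N e z)) =
    \sum_(j < N.+1) q j * sint (fun e => a1 e * sint (fun z => b1 z * dotv e z ^+ j)).
  move=> ca1 cb1.
  rewrite (eq_bigr (fun j : 'I_N.+1 => sint (fun e => q j * (a1 e * sint (fun z => b1 z * dotv e z ^+ j))))); last first.
    by move=> j _; rewrite sintZl//; apply: scontM => //; exact: scont_sint_dotv.
  rewrite -sint_sum//; last first.
    move=> j _; apply: scontM; first exact: scont_cst.
    by apply: scontM => //; exact: scont_sint_dotv.
  by apply: eq_sint => e Se; rewrite inner// mulr_sumr; apply: eq_bigr => j _; ring.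
have swapQ N : sint (fun e => a e * sint (fun z => b z * Q N e z)) =
    sint (fun e => b e * sint (fun z => a z * Q N e z)).
  rewrite (outer a b _ ca cb) (outer b a _ cb ca); apply: eq_bigr => j _; congr (_ * _).
  exact: sint_swap_dotv.
have [A hA] := scont_bounded ca; have [B hB] := scont_bounded cb.
have approx (a1 b1 : 'rV[R]_n -> R) A1 B1 N : scont a1 -> scont b1 ->
    on_sphere (fun e => `|a1 e| <= A1) -> on_sphere (fun e => `|b1 e| <= B1) ->
    `|sint (fun e => a1 e * sint (fun z => b1 z * Q N e z))
      - sint (fun e => a1 e * sint (fun z => b1 z * poisson z (s *: e)))| <= A1 * (B1 * d N).
  move=> ca1 cb1 hA1 hB1.
  rewrite -sintB//; [|by apply: scontM => //; exact: cinner|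
    by apply: scontM => //; exact: scont_sint_poisson].
  apply: norm_sint_le => //.
    apply: scontB; apply: scontM => //; [exact: cinner|exact: scont_sint_poisson].
  move=> e Se; rewrite -mulrBr normrM; apply: ler_pM => //; first exact: hA1.
  have sP : scont (fun z => b1 z * poisson z (s *: e)).
    apply: scontM => //; move=> z Sz.
    have zB := unit_ballZ s1 Se.
    exact: (@cvg_poisson R n _ (nbhs z) _ id (fun=> s *: e) z (s *: e) (@cvg_id _ (nbhs z))
      (@cvg_cst _ (s *: e) _ (nbhs z) _) Sz zB).
  rewrite -sintB//; last by apply: scontM.
  apply: norm_sint_le => //; first by apply: scontB => //; exact: scontM.
  by move=> z Sz; rewrite -mulrBr normrM; apply: ler_pM => //; [exact: hB1|exact: hd].
apply/eqP; rewrite -subr_eq0 -normr_le0; apply/ler_addgt0Pr => eps eps0; rewrite add0r.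
have : A * (B * d N) + B * (A * d N) @[N --> \oo] --> A * (B * 0) + B * (A * 0).
  by apply: cvgD; apply: cvgM; [exact: cvg_cst|apply: cvgM => //; exact: cvg_cst|
    exact: cvg_cst|apply: cvgM => //; exact: cvg_cst].
rewrite !mulr0 addr0 => /cvgrPdist_le/(_ eps eps0)[N _ /(_ N (leqnn N))].
rewrite /= sub0r normrN => hN.
have h1 := approx a b A B N ca cb hA hB.
have h2 := approx b a B A N cb ca hB hA.
move: h1 h2; rewrite swapQ; move: (sint _) (sint _) (sint _) => u v w h1 h2.
apply: le_trans (le_trans (ler_norm _) hN); rewrite (_ : v - u = (w - u) - (w - v)); last by ring.
by rewrite [leRHS]addrC; apply: le_trans (ler_normB _ _) _; exact: lerD.
Qed.

End poisson_symmetry.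

(** * Poisson kernels as an approximate identity, and the reproducing property *)

Section reproducing.
Context {R : realType} (n : nat).
Hypothesis n2 : (2 < n)%N.

Let n0 : (0 < n)%N. Proof. exact: ltn_trans n2. Qed.

Let norm01 (r : R) : 0 < r < 1 -> `|r| < 1.
Proof. by move=> /andP[r0 r1]; rewrite ger0_norm// ltW. Qed.

Let nbhs0 (x : 'rV[R]_n) (c : R) : (fun=> c) y @[y --> x] --> c.
Proof. exact: (@cvg_cst _ c _ (nbhs x)). Qed.

Lemma H_harmonic_cst (c : R) : H_harmonic (fun _ : 'rV[R]_n => c).
Proof.
have [C e1 e2] : [/\ class_C2 (@unit_ball R n) (fun _ : 'rV[R]_n => c),
      forall (x : 'rV[R]_n) i, unit_ball x -> pderive i (fun _ : 'rV[R]_n => c) x = 0 &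
      forall (x : 'rV[R]_n) i j, unit_ball x ->
        pderive j (pderive i (fun _ : 'rV[R]_n => c)) x = 0].
  apply: (C2_intro (f1 := fun _ _ => 0) (f2 := fun _ _ _ => 0)).
  - exact: open_unit_ball.
  - by move=> x i j _; exact: nbhs0.
  - by move=> x i _; exact: nbhs0.
  - by move=> x _; exact: nbhs0.
split => // x xB; rewrite /hyperbolic_laplacian /laplacian big1 => [|i _]; last exact: e2.
rewrite (_ : dotv _ _ = 0) ?mulr0 ?addr0 ?mulr0//; apply: big1 => i _.
by rewrite mxE e1// mulr0.
Qed.

Lemma poisson0 (z : 'rV[R]_n) : poisson z 0 = 1.
Proof.
have d0 (w : 'rV[R]_n) : dotv 0 w = 0 by rewrite -(scale0r 0) dotvZl mul0r.
by rewrite /poisson /pquo /pden !d0 mulr0 !subr0 addr0 divr1 expr1n.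
Qed.

(** With f = 1 the exchange symmetry says that the integral does not depend on the radius; as the
    radius tends to 0 it tends to P(z, 0) = 1. *)
Lemma sint_poisson (z : 'rV[R]_n) (r : R) : 0 < r < 1 -> unit_sphere z ->
  sint (fun e => poisson z (r *: e)) = 1.
Proof.
move=> r01 Sz.
have cst s : 0 < s < 1 -> sint (fun e => poisson z (s *: e)) = sint (fun e => poisson z (r *: e)).
  move=> s01; have := poisson_exchange n2 (H_harmonic_cst 1) r01 s01 Sz.
  by under eq_fun do rewrite mul1r; under [in RHS]eq_fun do rewrite mul1r.
have c0 : {for (0 : R), continuous (fun s : R => sint (fun e : 'rV[R]_n => poisson z (s *: e)))}.
  apply: (@sint_continuous R n _ (fun (e : 'rV[R]_n) (s : R) => poisson z (s *: e)) 0 n0).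
  have : \forall s \near (0 : R), `|s| < 1.
    by exists 1 => //= s; rewrite /ball_/= sub0r normrN.
  apply: filterS => s s1 e Se; rewrite /continuous_at/=.
  apply: (@cvg_poisson R n _ (nbhs (e, s)) _ (fun=> z) (fun p => p.2 *: p.1) z (s *: e)) => //.
  - exact: (@cvg_cst _ z _ (nbhs (e, s))).
  - apply: cvgZ; [exact: (@cvg_snd _ _ (nbhs e) (nbhs s) _)|exact: (@cvg_fst _ _ (nbhs e) (nbhs s) _)].
  - exact: unit_ballZ.
have l1 : sint (fun e : 'rV[R]_n => poisson z (s *: e)) @[s --> (0 : R)^'+] --> (1 : R).
  rewrite -(sint_cst 1 n0).
  rewrite -(_ : sint (fun e : 'rV[R]_n => poisson z (0 *: e)) = sint (fun=> 1)); last first.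
    by apply: eq_sint => e _; rewrite scale0r poisson0.
  exact: cvg_at_right_filter c0.
have l2 : sint (fun e : 'rV[R]_n => poisson z (s *: e)) @[s --> (0 : R)^'+] -->
    sint (fun e => poisson z (r *: e)).
  apply: cvg_near_cst; near=> s; apply: cst; apply/andP; split; near: s.
    exact: nbhs_right_gt.
  exact: nbhs_right_lt.
exact: (cvg_unique _ l2 l1).
Unshelve. all: by end_near.
Qed.

(* Away from z the Poisson kernel is small: |z - r e|^2 >= r |e - z|^2. *)
Lemma poisson_far (e z : 'rV[R]_n) (r del : R) : unit_sphere e -> unit_sphere z ->
  2^-1 <= r < 1 -> 0 < del -> del <= enorm (e - z) -> (1 - r) * 4 <= del ^+ 2 ->
  poisson z (r *: e) <= (1 - r) * 4 / del ^+ 2.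
Proof.
move=> Se Sz /andP[r2 r1] del0 far rdel.
have e1 := (unit_sphereE e).1 Se; have z1 := (unit_sphereE z).1 Sz.
have ez : del ^+ 2 <= 2 - 2 * dotv e z.
  apply: (@le_trans _ _ (enorm (e - z) ^+ 2)); first by apply: lerXn2r far; rewrite nnegrE ?enorm_ge0// ltW.
  rewrite sqr_enorm -scaleN1r dotvDl !dotvDr !dotvZl !dotvZr e1 z1 (dotvC z e).
  by lra.
have d20 : 0 < del ^+ 2 by rewrite exprn_gt0.
have q0 : 0 < pden z (r *: e) by apply: pden_gt0 => //; apply: unit_ballZ => //; rewrite ger0_norm//; lra.
have ep : pden z (r *: e) = (1 - r) ^+ 2 + r * (2 - 2 * dotv e z).
  by rewrite /pden !dotvZl !dotvZr e1; ring.
have num : 1 - dotv (r *: e) (r *: e) = (1 - r) * (1 + r) by rewrite dotvZl dotvZr e1; ring.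
have le1 : pquo z (r *: e) <= (1 - r) * 4 / del ^+ 2.
  rewrite /pquo num ler_pdivrMr// mulrAC ler_pdivlMr//.
  have : r * del ^+ 2 <= pden z (r *: e).
    rewrite ep; have := sqr_ge0 (1 - r); have := ler_wpM2l (ltac:(lra) : 0 <= r) ez; lra.
  move: (pden z (r *: e)) q0 => q q0 hq.
  have h1 : 2^-1 * del ^+ 2 <= q by apply: le_trans hq; apply: ler_wpM2r => //; exact: ltW.
  rewrite -!mulrA; apply: ler_wpM2l; first lra.
  apply: (@le_trans _ _ (2 * del ^+ 2)); first by apply: ler_wpM2r; [exact: ltW|lra].
  lra.
have p0 : 0 <= pquo z (r *: e).
  by rewrite /pquo num; apply: divr_ge0; [apply: mulr_ge0; lra|exact: ltW].
(* The assumption (1 - r) * 4 <= del^2 makes the base at most 1, so raising it to the power n - 1 >=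
   1 can only decrease it. *)
have n11 : (1 <= n - 1)%N by rewrite subn_gt0 ltnW.
have lt1 : (1 - r) * 4 / del ^+ 2 <= 1 by rewrite ler_pdivrMr// mul1r.
apply: le_trans (_ : pquo z (r *: e) ^+ 1 <= _); last by rewrite expr1.
by apply: ler_wiXn2l => //; exact: le_trans lt1.
Qed.

Lemma poisson_approx_identity (g : 'rV[R]_n -> R) (eps : R) : scont g -> 0 < eps ->
  \forall r \near (1 : R)^'-, on_sphere (fun z =>
    `|sint (fun e => g e * poisson z (r *: e)) - g z| <= eps).
Proof.
move=> cg eps0; have [M hM] := scont_bounded cg.
have M0 : 0 <= M.
  pose e0 : 'rV[R]_n := delta_mx ord0 (Ordinal n0).
  have Se0 : unit_sphere e0 by apply/unit_sphereE; rewrite dotv_delta mxE !eqxx.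
  exact: le_trans (normr_ge0 _) (hM e0 Se0).
have /compact_near_coveringP cov := @compact_sphere R n.
have : \forall r \near (1 : R)^'-, @unit_sphere R n `<=` (fun z => unit_sphere z ->
    `|sint (fun e => g e * poisson z (r *: e)) - g z| <= eps); last first.
  by apply: filterS => r h z Sz; exact: h.
apply: (cov R _ (fun (r : R) (z : 'rV[R]_n) => unit_sphere z ->
    `|sint (fun e => g e * poisson z (r *: e)) - g z| <= eps)) => z0 Sz0.
have /cvgrPdist_le := cg z0 Sz0.
have e40 : 0 < eps / 4 by lra.
move=> /(_ _ e40) /nbhs_ballP[rho /= rho0 hrho].
pose del := rho / 2; have del0 : 0 < del by rewrite /del; lra.
have d20 : 0 < del ^+ 2 by rewrite exprn_gt0.
(* For 1 - r < c the three entries give r >= 1/2, the smallness assumed in [poisson_far], and 2 M *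
   4 (1 - r) / del^2 <= eps / 2. *)
pose c := Num.min (2^-1) (Num.min (del ^+ 2 / 4) (del ^+ 2 * eps / (16 * (M + 1)))).
have M16 : 0 < 16 * (M + 1) by lra.
have c0 : 0 < c.
  by rewrite /c !lt_min invr_gt0 ltr0n/= divr_gt0//= divr_gt0// mulr_gt0.
exists (ball z0 del, [set r : R | 1 - c < r < 1]).
  split => /=; first exact: nbhsx_ballx.
  near=> r; apply/andP; split; near: r; [apply: nbhs_left_gt; lra|exact: nbhs_left_lt].
move=> [z r] /= [zz0 /andP[r1 r1']] Sz.
have : 1 - r < c by lra.
rewrite /c !lt_min => /and3P[ca cb cc].
have r2 : 2^-1 <= r < 1 by rewrite r1' andbT; lra.
have r01 : 0 < r < 1 by case/andP: r2 => ? ->; rewrite andbT; lra.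
have cP : scont (fun e => poisson z (r *: e)) by apply: scont_poisson => //; exact: norm01.
rewrite -[X in _ - X]mulr1 -(sint_poisson r01 Sz) -sintZl// -sintB//; [|exact: scontM|
  by apply: scontM => //; exact: scont_cst].
have gz : `|g z - g z0| <= eps / 4.
  rewrite distrC; apply: hrho; apply: (le_ball _ zz0); rewrite /del; lra.
(* One bound for both regimes: near z the oscillation of [g] is at most eps / 2, far from z the
   kernel makes the product at most eps / 2. Since the kernel has mass 1, the bound integrates to
   eps. *)
have bound e : unit_sphere e -> `|g e * poisson z (r *: e) - g z * poisson z (r *: e)| <=
    eps / 2 * poisson z (r *: e) + eps / 2.
  move=> Se; rewrite -mulrBl normrM.
  have p0 : 0 <= poisson z (r *: e).
    by apply: poisson_ge0 => //; apply: unit_ballZ => //; exact: norm01.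
  rewrite (ger0_norm p0); have [far|near] := leP del (enorm (e - z)).
    have hp := poisson_far Se Sz r2 del0 far (ltac:(lra) : (1 - r) * 4 <= del ^+ 2).
    have hg : `|g e - g z| <= 2 * M.
      by apply: le_trans (ler_normB _ _) _; have := hM e Se; have := hM z Sz; lra.
    have : `|g e - g z| * poisson z (r *: e) <= 2 * M * ((1 - r) * 4 / del ^+ 2).
      by apply: ler_pM.
    have : 2 * M * ((1 - r) * 4 / del ^+ 2) <= eps / 2.
      have e16 : del ^+ 2 * eps / (16 * (M + 1)) * (16 * (M + 1)) = del ^+ 2 * eps.
        by rewrite divfK// gt_eqF.
      rewrite !mulrA ler_pdivrMr//.
      have : (1 - r) * (16 * (M + 1)) <= del ^+ 2 * eps by rewrite -e16; apply: ler_wpM2r; apply: ltW.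
      nra.
    have : 0 <= eps / 2 * poisson z (r *: e) by rewrite mulr_ge0//; lra.
    lra.
  have ge : `|g e - g z0| <= eps / 4.
    rewrite distrC; apply: hrho; rewrite -ball_normE/=.
    have h1 : `|z0 - z| < del by move: zz0; rewrite -ball_normE.
    have h2 : `|e - z| < del by apply: le_lt_trans near; exact: norm_le_enorm.
    have -> : z0 - e = (z0 - z) - (e - z) by rewrite opprB addrA subrK.
    by apply: le_lt_trans (ler_normB _ _) _; rewrite /del in h1 h2; lra.
  have hg : `|g e - g z| <= eps / 2.
    have -> : g e - g z = (g e - g z0) - (g z - g z0) by ring.
    by apply: le_trans (ler_normB _ _) _; lra.
  have : `|g e - g z| * poisson z (r *: e) <= eps / 2 * poisson z (r *: e) by apply: ler_wpM2r.
  lra.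
apply: le_trans (le_norm_sint n0 _) _.
  by apply: scontB; apply: scontM => //; exact: scont_cst.
apply: (@le_trans _ _ (sint (fun e => eps / 2 * poisson z (r *: e) + eps / 2))).
  apply: le_sint => //.
    by apply: scont_norm; apply: scontB; apply: scontM => //; exact: scont_cst.
  by apply: scontD; [apply: scontM => //; exact: scont_cst|exact: scont_cst].
rewrite sintD//; [|by apply: scontM => //; exact: scont_cst|exact: scont_cst].
by rewrite sintZl// sint_poisson// sint_cst//; lra.
Unshelve. all: by end_near.
Qed.

Definition szego x y : R := sint (fun z : 'rV[R]_n => poisson z x * poisson z y).

(** [poissonC] turns P(z, s y) into P(y, s z), an H-harmonic function of s z with fixed pole, and
    the exchange symmetry then swaps the radii. *)
Lemma szego_scale (y e : 'rV[R]_n) (r s : R) : 0 < r < 1 -> 0 < s < 1 ->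
  unit_sphere y -> unit_sphere e ->
  szego (s *: y) (r *: e) = sint (fun z => poisson y (r *: z) * poisson z (s *: e)).
Proof.
move=> r01 s01 Sy Se.
transitivity (sint (fun z => poisson y (s *: z) * poisson e (r *: z))).
  by apply: eq_sint => z Sz; rewrite poissonC// (poissonC _ Sz Se).
rewrite poisson_exchange//; last exact: H_harmonic_poisson.
by apply: eq_sint => z Sz; rewrite (poissonC _ Sz Se).
Qed.

(* By symmetry of the Poisson transform the integral is the Poisson transform of
   radius r applied twice to f (s .), and Poisson kernels form an approximate
   identity. *)
Lemma szego_reproduces (f : 'rV[R]_n -> R) (y : 'rV[R]_n) (s : R) : H_harmonic f ->
  0 < s < 1 -> unit_sphere y ->
  sint (fun e => f (r *: e) * szego (s *: y) (r *: e)) @[r --> (1 : R)^'-] --> f (s *: y).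
Proof.
move=> hf s01 Sy.
have cf (r : R) : 0 < r < 1 -> scont (fun e => f (r *: e)).
  by move=> r01; apply: scont_harmonic => //; exact: norm01.
have cP (r : R) (z : 'rV[R]_n) : 0 < r < 1 -> unit_sphere z -> scont (fun e => poisson z (r *: e)).
  by move=> r01 Sz; apply: scont_poisson => //; exact: norm01.
(* [sint_swap_poisson] moves the integral of radius s from P(y, r .) onto f(r .), where the exchange
   symmetry turns it into the radius-r transform of f(s .). From then on f is evaluated only on the
   fixed sphere of radius s. *)
have step (r : R) : 0 < r < 1 -> sint (fun e => f (r *: e) * szego (s *: y) (r *: e)) =
    sint (fun z => poisson y (r *: z) * sint (fun e => f (s *: e) * poisson e (r *: z))).
  move=> r01.
  transitivity (sint (fun e => f (r *: e) * sint (fun z => poisson y (r *: z) * poisson z (s *: e)))).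
    by apply: eq_sint => e Se; rewrite szego_scale.
  rewrite (sint_swap_poisson n2 (norm01 s01) (cf r r01) (cP r y r01 Sy)).
  apply: eq_sint => z Sz; congr (_ * _).
  transitivity (sint (fun e => f (r *: e) * poisson z (s *: e))).
    by apply: eq_sint => e Se; rewrite (poissonC s Se Sz).
  rewrite -(poisson_exchange n2 hf r01 s01 Sz).
  by apply: eq_sint => e Se; rewrite (poissonC r Se Sz).
apply/cvgrPdist_le => eps eps0.
near=> r.
have r01 : 0 < r < 1.
  by apply/andP; split; near: r; [exact: nbhs_left_gt|exact: nbhs_left_lt].
have h : on_sphere (fun z =>
    `|sint (fun e => f (s *: e) * poisson z (r *: e)) - f (s *: z)| <= eps / 2).
  by near: r; apply: poisson_approx_identity; [exact: cf|lra].
rewrite step//.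
have cT : scont (fun z => sint (fun e => f (s *: e) * poisson e (r *: z))).
  exact: (scont_sint_poisson n2 (norm01 r01) (cf s s01)).
have hT : on_sphere (fun z =>
    `|sint (fun e => f (s *: e) * poisson e (r *: z)) - f (s *: z)| <= eps / 2).
  move=> z Sz; have -> : sint (fun e => f (s *: e) * poisson e (r *: z)) =
      sint (fun e => f (s *: e) * poisson z (r *: e)).
    by apply: eq_sint => e Se; rewrite (poissonC r Se Sz).
  exact: h.
have cPy := cP r y r01 Sy; have cfs := cf s s01.
have h1 : `|sint (fun z => poisson y (r *: z) * sint (fun e => f (s *: e) * poisson e (r *: z)))
    - sint (fun z => f (s *: z) * poisson y (r *: z))| <= eps / 2.
  rewrite -sintB//; [|exact: scontM|exact: scontM].
  apply: le_trans (le_norm_sint n0 _) _; first by apply: scontB; exact: scontM.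
  apply: (@le_trans _ _ (sint (fun z => eps / 2 * poisson y (r *: z)))); last first.
    by rewrite sintZl// sint_poisson// mulr1.
  apply: le_sint => //.
  - by apply: scont_norm; apply: scontB; exact: scontM.
  - by apply: scontM => //; exact: scont_cst.
  move=> z Sz; rewrite (mulrC (f _)) -mulrBr mulrC normrM.
  have p0 : 0 <= poisson y (r *: z).
    by apply: poisson_ge0 => //; apply: unit_ballZ => //; exact: norm01.
  by rewrite (ger0_norm p0); apply: ler_wpM2r => //; exact: hT.
have h2 := h y Sy.
move: h1 h2; move: (sint _) (sint _) (f _) => u v w h1 h2.
have -> : w - v = - (v - u) - (u - w) by ring.
apply: le_trans (ler_normB _ _) _; rewrite normrN; lra.
Unshelve. all: by end_near.
Qed.

End reproducing.

(** * The Szego kernel *)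

Section poisson_integral.
Context {R : realType} (n : nat).
Hypothesis n2 : (2 < n)%N.

Let n0 : (0 < n)%N. Proof. exact: ltn_trans n2. Qed.

Definition ball_cont (k : 'rV[R]_n -> 'rV[R]_n -> R) := forall z x : 'rV[R]_n,
  unit_sphere z -> unit_ball x -> {for (z, x), continuous (fun p => k p.1 p.2)}.

Variables (b : 'rV[R]_n -> R) (cb : scont b).

Let jcont_kernel (T : topologicalType) (k : 'rV[R]_n -> 'rV[R]_n -> R) (f : T -> 'rV[R]_n) (t : T) :
  ball_cont k -> {for t, continuous f} -> unit_ball (f t) ->
  jcont (fun z t => b z * k z (f t)) t.
Proof.
move=> ck cf Bt z Sz.
apply: cvgM; first exact: (@cvg_at _ (nbhs (z, t)) _ _ fst b z (@cvg_fst _ _ (nbhs z) (nbhs t) _) (cb Sz)).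
have fc : f p.2 @[p --> nbhs (z, t)] --> f t.
  exact: (@cvg_at _ (nbhs (z, t)) _ _ snd f t (@cvg_snd _ _ (nbhs z) (nbhs t) _) cf).
exact: (cvg_comp2 (@cvg_fst _ _ (nbhs z) (nbhs t) _) fc (ck z (f t) Sz Bt)).
Qed.

Lemma continuous_sint_kernel (k : 'rV[R]_n -> 'rV[R]_n -> R) (x : 'rV[R]_n) :
  ball_cont k -> unit_ball x -> {for x, continuous (fun x => sint (fun z => b z * k z x))}.
Proof.
move=> ck xB; apply: (@sint_continuous R n _ (fun z x : 'rV[R]_n => b z * k z x) x n0).
have : nbhs x (@unit_ball R n) by exact: (open_nbhs_nbhs (conj (@open_unit_ball R n) xB)).
apply: filterS => y yB; apply: (jcont_kernel ck _ yB).
exact: (@cvg_id _ (nbhs y)).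
Qed.

Lemma is_derive_sint_kernel (k dk : 'rV[R]_n -> 'rV[R]_n -> R) (x v : 'rV[R]_n) :
  ball_cont k -> ball_cont dk ->
  (forall z y : 'rV[R]_n, unit_sphere z -> unit_ball y -> is_derive y v (k z) (dk z y)) ->
  unit_ball x ->
  is_derive x v (fun x => sint (fun z => b z * k z x)) (sint (fun z => b z * dk z x)).
Proof.
move=> ck cdk hk xB; apply: is_derive_of_line.
have line_c (s : R) : {for s, continuous (fun s : R => x + s *: v)}.
  apply: (@cvgD _ _ _ (nbhs s) _ (fun=> x) (fun s : R => s *: v)).
    exact: (@cvg_cst _ x _ (nbhs s)).
  exact: scalel_continuous.
have := @sint_is_derive R n (fun z s => b z * k z (x + s *: v))
  (fun z s => b z * dk z (x + s *: v)) 0 n0.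
rewrite /= scale0r addr0; apply.
have : nbhs (0 : R) (fun s : R => unit_ball (x + s *: v)).
  apply: (line_c 0 (@unit_ball R n)).
  by rewrite scale0r addr0; exact: (open_nbhs_nbhs (conj (@open_unit_ball R n) xB)).
apply: filterS => s sB; split.
- exact: (jcont_kernel ck (line_c s) sB).
- exact: (jcont_kernel cdk (line_c s) sB).
- move=> z Sz; apply: is_derive_mulc; apply: is_derive_line; exact: hk.
Qed.

Let ball_poisson : ball_cont (fun z x => poisson z x).
Proof.
move=> z x Sz xB; apply: (@cvg_poisson R n _ (nbhs (z, x)) _ fst snd z x _ _ Sz xB).
  exact: (@cvg_fst _ _ (nbhs z) (nbhs x) _).
exact: (@cvg_snd _ _ (nbhs z) (nbhs x) _).
Qed.

Let ball_poisson1 i : ball_cont (fun z x => poisson1 i z x).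
Proof.
move=> z x Sz xB; apply: (@cvg_poisson1 R n _ (nbhs (z, x)) _ fst snd z x _ _ Sz xB).
  exact: (@cvg_fst _ _ (nbhs z) (nbhs x) _).
exact: (@cvg_snd _ _ (nbhs z) (nbhs x) _).
Qed.

Let ball_poisson2 i j : ball_cont (fun z x => poisson2 i j z x).
Proof.
move=> z x Sz xB; apply: (@cvg_poisson2 R n _ (nbhs (z, x)) _ fst snd z x _ _ Sz xB).
  exact: (@cvg_fst _ _ (nbhs z) (nbhs x) _).
exact: (@cvg_snd _ _ (nbhs z) (nbhs x) _).
Qed.

Lemma scont_ball_kernel (k : 'rV[R]_n -> 'rV[R]_n -> R) (x : 'rV[R]_n) :
  ball_cont k -> unit_ball x -> scont (k ^~ x).
Proof.
move=> ck xB z Sz.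
exact: (cvg_comp2 (@cvg_id _ (nbhs z)) (@cvg_cst _ x _ (nbhs z) _) (ck z x Sz xB)).
Qed.

Lemma H_harmonic_poisson_integral : H_harmonic (fun x => sint (fun z => b z * poisson z x)).
Proof.
have [C e1 e2] : [/\ class_C2 (@unit_ball R n) (fun x => sint (fun z => b z * poisson z x)),
    forall (x : 'rV[R]_n) i, unit_ball x ->
      pderive i (fun x => sint (fun z => b z * poisson z x)) x =
      sint (fun z => b z * poisson1 i z x) &
    forall (x : 'rV[R]_n) i j, unit_ball x ->
      pderive j (pderive i (fun x => sint (fun z => b z * poisson z x))) x =
      sint (fun z => b z * poisson2 i j z x)].
  apply: (C2_intro (f1 := fun i x => sint (fun z => b z * poisson1 i z x))
    (f2 := fun i j x => sint (fun z => b z * poisson2 i j z x))).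
  - exact: open_unit_ball.
  - move=> x i xB; apply: is_derive_sint_kernel => // z y; exact: is_derive_poisson.
  - move=> x i j xB; apply: is_derive_sint_kernel => // z y; exact: is_derive_poisson1.
  - by move=> x i j xB; apply: continuous_sint_kernel.
  - by move=> x i xB; apply: continuous_sint_kernel.
  - by move=> x xB; apply: continuous_sint_kernel.
split => // x xB.
have c1 i : scont (fun z => b z * poisson1 i z x).
  by apply: scontM => //; exact: (scont_ball_kernel (@ball_poisson1 i)).
have c2 i j : scont (fun z => b z * poisson2 i j z x).
  by apply: scontM => //; exact: (scont_ball_kernel (@ball_poisson2 i j)).
rewrite /hyperbolic_laplacian sqr_enorm /laplacian.
rewrite (eq_bigr (fun i => sint (fun z => b z * poisson2 i i z x))) => [|i _]; last exact: e2.
rewrite (_ : dotv x (gradient _ x) = \sum_i sint (fun z => x ord0 i * (b z * poisson1 i z x))); last first.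
  by apply: eq_bigr => i _; rewrite mxE e1// sintZl.
have c1' i : scont (fun z => x ord0 i * (b z * poisson1 i z x)).
  by apply: scontM => //; exact: scont_cst.
have cs1 : scont (fun z => \sum_i x ord0 i * (b z * poisson1 i z x)) by apply: scont_sum.
have cs2 : scont (fun z => \sum_i b z * poisson2 i i z x) by apply: scont_sum.
rewrite -(@sint_sum R n _ (index_enum _) xpredT (fun i z => b z * poisson2 i i z x) n0 (fun i _ => c2 i i)).
rewrite -(@sint_sum R n _ (index_enum _) xpredT _ n0 (fun i _ => c1' i)).
rewrite -!sintZl// -sintD//; [|by apply: scontM => //; exact: scont_cst|by apply: scontM => //; exact: scont_cst].
rewrite -sintZl//; last by apply: scontD; apply: scontM => //; exact: scont_cst.
rewrite -[RHS](sint_cst 0 n0); apply: eq_sint => z Sz.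
have E := congr1 ( *%R (b z)) (hyperbolic_poisson n2 Sz xB).
rewrite mulr0 in E; rewrite -[RHS]E.
rewrite -mulr_sumr.
have -> : \sum_i x ord0 i * (b z * poisson1 i z x) = b z * \sum_i x ord0 i * poisson1 i z x.
  by rewrite mulr_sumr; apply: eq_bigr => i _; rewrite mulrCA.
set s1 := \sum_i _; set s2 := \sum_i _; ring.
Qed.

End poisson_integral.

(** * Hardy bound and uniqueness of the kernel *)

Section szego_kernel.
Context {R : realType} (n : nat).
Hypothesis n2 : (2 < n)%N.

Let n0 : (0 < n)%N. Proof. exact: ltn_trans n2. Qed.

Lemma scont_poisson_l (x : 'rV[R]_n) : unit_ball x -> scont (fun z => poisson z x).
Proof.
move=> xB z Sz.
exact: (@cvg_poisson R n _ (nbhs z) _ id (fun=> x) z x (@cvg_id _ (nbhs z))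
  (@cvg_cst _ x _ (nbhs z) _) Sz xB).
Qed.

(** For fixed y the factor P(z, y) is bounded by some M on the sphere, and P(z, r e) has mass 1 in z
    by [poissonC]; hence |G(y, r e)| <= M for all r < 1. *)
Lemma hardy2_szego (y : 'rV[R]_n) : unit_ball y -> hardy2 (szego y).
Proof.
move=> yB; have cy := scont_poisson_l yB; split; first exact: H_harmonic_poisson_integral.
have [M hM] := scont_bounded cy.
apply: (@le_lt_trans _ _ (M ^+ 2)%:E); last exact: ltry.
apply: ge_ereal_sup => v [r /= r01 <-] {v}; rewrite in_itv/= in r01.
have r1 : `|r| < 1 by case/andP: r01 => r0 r1; rewrite ger0_norm// ltW.
have bound : on_sphere (fun e => `|szego y (r *: e)| <= M).
  move=> e Se; have eB := unit_ballZ r1 Se.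
  have cc : scont (fun z => poisson z y * poisson z (r *: e)).
    by apply: scontM => //; exact: scont_poisson_l.
  apply: le_trans (le_norm_sint n0 cc) _.
  have mass : sint (fun z => M * poisson z (r *: e)) = M.
    rewrite sintZl//; last exact: scont_poisson_l.
    rewrite -[RHS]mulr1 -(sint_poisson n2 r01 Se); congr (_ * _).
    by apply: eq_sint => z Sz; exact: poissonC.
  rewrite -[leRHS]mass; apply: le_sint => //.
  - exact: scont_norm.
  - by apply: scontM; [exact: scont_cst|exact: scont_poisson_l].
  - move=> z Sz; rewrite normrM (ger0_norm (poisson_ge0 Sz eB)).
    by apply: ler_wpM2r; [exact: poisson_ge0|exact: hM].
have cs : scont (fun e => `|szego y (r *: e)| ^+ 2).
  apply: scontX; apply: scont_norm; apply: scont_harmonic => //.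
  exact: H_harmonic_poisson_integral.
apply: (@le_trans _ _ (\int[@sphere_measure R n]_(e in @unit_sphere R n) (M ^+ 2)%:E)%E).
  apply: ge0_le_integral.
  - exact: measurable_unit_sphere.
  - by move=> e _; rewrite lee_fin exprn_ge0.
  - by apply/measurable_EFinP; exact: scont_measurable.
  - exact: measurable_cst.
  - by move=> e Se; rewrite lee_fin; apply: lerXn2r; rewrite ?nnegrE ?bound//;
      apply: le_trans (bound e Se).
rewrite integral_cst; last exact: measurable_unit_sphere.
by rewrite [X in (_ * X)%E]sphere_measure1// mule1.
Qed.

Lemma szegoC (x y : 'rV[R]_n) : szego x y = szego y x.
Proof. by apply: eq_sint => z _; rewrite mulrC. Qed.

Lemma szego_unique (K : 'rV[R]_n -> 'rV[R]_n -> R) (x y : 'rV[R]_n) :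
  is_szego_kernel K -> unit_ball x -> unit_ball y -> K x y = szego x y.
Proof.
move=> hK xB.
have hx : hardy2 (K x) by exact: szego_hardy_r.
have polar (s : R) (e : 'rV[R]_n) : 0 < s < 1 -> unit_sphere e -> K x (s *: e) = szego x (s *: e).
  move=> s01 Se; have sB : unit_ball (s *: e).
    by apply: unit_ballZ => //; case/andP: s01 => s0 s1; rewrite ger0_norm// ltW.
  have h1 := szego_reproducing hK (hardy2_szego sB) xB.
  have h2 := szego_reproduces n2 hx.1 s01 Se.
  have E : (fun r : R => sint (fun e0 => K x (r *: e0) * szego (s *: e) (r *: e0))) =
      (fun r : R => sint (fun e0 => szego (s *: e) (r *: e0) * K x (r *: e0))).
    by apply/funext => r; apply: eq_sint => z _; rewrite mulrC.
  rewrite E in h2; rewrite (szegoC x); exact: (cvg_unique _ h2 h1).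
move=> yB; have [y0|y0] := eqVneq (enorm y) 0; last first.
  have yp : 0 < enorm y by rewrite lt_neqAle eq_sym y0 enorm_ge0.
  have -> : y = enorm y *: ((enorm y)^-1 *: y) by rewrite scalerA divff// scale1r.
  apply: polar; first by rewrite yp.
  by rewrite /unit_sphere/= enormZ ger0_norm ?invr_ge0 ?enorm_ge0// mulVf.
(* [polar] covers points [s *: e] with s > 0 only; the origin is reached along a ray by continuity
   of both kernels. *)
have {yB} y00 : y = 0 by apply/eqP; rewrite -enorm_eq0 y0.
pose e0 : 'rV[R]_n := delta_mx ord0 (Ordinal n0).
have Se0 : unit_sphere e0 by apply/unit_sphereE; rewrite dotv_delta mxE !eqxx.
have B0 : unit_ball (0 : 'rV[R]_n) by rewrite /unit_ball/= -y00 y0.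
have c1 : {for (0 : 'rV[R]_n), continuous (K x)} by have [] := hx.1.1.1 0 B0.
have c2 : {for (0 : 'rV[R]_n), continuous (szego x)}.
  by have [] := (hardy2_szego xB).1.1.1 0 B0.
have lim0 : (fun s : R => s *: e0) s @[s --> (0 : R)^'+] --> (0 : 'rV[R]_n).
  rewrite -[X in _ --> X](scale0r e0); apply: cvg_at_right_filter.
  exact: scalel_continuous.
rewrite y00; suff l2 : K x (s *: e0) @[s --> (0 : R)^'+] --> szego x 0.
  exact: (cvg_unique _ (cvg_at lim0 c1) l2).
apply: cvg_trans (cvg_at lim0 c2); apply: near_eq_cvg.
near=> s; rewrite polar//; apply/andP; split; near: s.
  exact: nbhs_right_gt.
exact: nbhs_right_lt.
Unshelve. all: by end_near.
Qed.

End szego_kernel.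

(** * Moments of the sphere *)

Section moments.
Context {R : realType} (n : nat).
Hypothesis n0 : (0 < n)%N.
Variables (x y : 'rV[R]_n).

Definition moment j k : R := sint (fun e => dotv x e ^+ j * dotv y e ^+ k).

Lemma dotv_protr (v e : 'rV[R]_n) (i j : 'I_n) (c s : R) :
  dotv v (prot i j c s e) = dotv v e
    + ((c - 1) * e ord0 i - s * e ord0 j) * v ord0 i
    + (s * e ord0 i + (c - 1) * e ord0 j) * v ord0 j.
Proof. by rewrite /prot !dotvDr !dotvZr !(dotvC v (delta_mx _ _)) !(dotvC (delta_mx _ _)) !dotv_delta. Qed.

Lemma dotv_prot_partr (v e : 'rV[R]_n) (i j : 'I_n) (c s : R) :
  dotv v (prot_part i j c s e) =
    (c * e ord0 i - s * e ord0 j) * v ord0 i + (s * e ord0 i + c * e ord0 j) * v ord0 j.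
Proof. by rewrite /prot_part !dotvDr !dotvZr !(dotvC v (delta_mx _ _)) !(dotvC (delta_mx _ _)) !dotv_delta. Qed.

Lemma is_derive_dotv_rotation (v e : 'rV[R]_n) (i j : 'I_n) (t : R) :
  is_derive t 1 (fun t : R => dotv v (prot i j (cos t) (sin t) e))
    (dotv v (prot_part i j (- sin t) (cos t) e)).
Proof.
under eq_fun do rewrite dotv_protr.
pose K (c : R) := is_derive_const c t (1 : R).
have dc := is_derive_sub (is_derive_cos t) (K 1).
have ds := is_derive_sin t.
apply: (is_derive_to (is_derive_add (is_derive_add (K (dotv v e))
  (is_derive_mul (is_derive_sub (is_derive_mul dc (K (e ord0 i))) (is_derive_mul ds (K (e ord0 j))))
    (K (v ord0 i))))
  (is_derive_mul (is_derive_add (is_derive_mul ds (K (e ord0 i))) (is_derive_mul dc (K (e ord0 j))))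
    (K (v ord0 j))))).
rewrite dotv_prot_partr; ring.
Qed.

(** The integral of <u,e> <x,e>^a <y,e>^b does not change when e is rotated by a small angle, so its
    derivative at angle 0 vanishes; differentiation under the integral gives the integrand. *)
Lemma sint_rotation_derive (u : 'rV[R]_n) (a b : nat) (i j : 'I_n) : i != j ->
  sint (fun e => dotv u (prot_part i j 0 1 e) * (dotv x e ^+ a * dotv y e ^+ b)
    + dotv u e * ((a%:R * dotv x e ^+ a.-1 * dotv x (prot_part i j 0 1 e)) * dotv y e ^+ b
    + dotv x e ^+ a * (b%:R * dotv y e ^+ b.-1 * dotv y (prot_part i j 0 1 e)))) = 0.
Proof.
move=> ij.
pose lin v e t := dotv v (prot i j (cos t) (sin t) e : 'rV[R]_n).
pose lin' v e t := dotv v (prot_part i j (- sin t) (cos t) e : 'rV[R]_n).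
have joint (e : 'rV[R]_n) (t : R) v :
    lin v p.1 p.2 @[p --> nbhs (e, t)] --> lin v e t /\
    lin' v p.1 p.2 @[p --> nbhs (e, t)] --> lin' v e t.
  have f1 : p.1 @[p --> nbhs (e, t)] --> e by exact: (@cvg_fst _ _ (nbhs e) (nbhs t) _).
  have f2 : p.2 @[p --> nbhs (e, t)] --> t by exact: (@cvg_snd _ _ (nbhs e) (nbhs t) _).
  have vc : (fun=> v) p @[p --> nbhs (e, t)] --> v by exact: (@cvg_cst _ v _ (nbhs (e, t)) _).
  have cc : cos p.2 @[p --> nbhs (e, t)] --> cos t.
    exact: (@cvg_at _ (nbhs (e, t)) _ _ snd cos t f2 (@continuous_cos R t)).
  have ss : sin p.2 @[p --> nbhs (e, t)] --> sin t.
    exact: (@cvg_at _ (nbhs (e, t)) _ _ snd sin t f2 (@continuous_sin R t)).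
  split.
    exact: (cvg_dotv _ vc (cvg_prot (i := i) (j := j) _ f1 cc ss)).
  exact: (cvg_dotv _ vc (cvg_prot_part (i := i) (j := j) _ f1 (cvgN ss) cc)).
pose F e t := lin u e t * (lin x e t ^+ a * lin y e t ^+ b).
pose dF e t := lin' u e t * (lin x e t ^+ a * lin y e t ^+ b)
    + lin u e t * ((a%:R * lin x e t ^+ a.-1 * lin' x e t) * lin y e t ^+ b
    + lin x e t ^+ a * (b%:R * lin y e t ^+ b.-1 * lin' y e t)).
have cF t : jcont F t.
  move=> e Se; rewrite /continuous_at.
  apply: cvgM; first exact: (joint e t u).1.
  by apply: cvgM; apply: cvg_pow; [exact: (joint e t x).1|exact: (joint e t y).1].
have cdF t : jcont dF t.
  move=> e Se; rewrite /continuous_at.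
  have [ux ux'] := joint e t u; have [xx xx'] := joint e t x; have [yx yx'] := joint e t y.
  have cst (c : R) : (fun=> c) p @[p --> nbhs (e, t)] --> c by exact: (@cvg_cst _ c _ (nbhs (e, t)) _).
  have X k : lin x p.1 p.2 ^+ k @[p --> nbhs (e, t)] --> lin x e t ^+ k by apply: cvg_pow.
  have Y k : lin y p.1 p.2 ^+ k @[p --> nbhs (e, t)] --> lin y e t ^+ k by apply: cvg_pow.
  apply: cvgD; apply: cvgM; [exact: ux'| |exact: ux|].
    by apply: cvgM; [exact: X|exact: Y].
  apply: cvgD; apply: cvgM; [|exact: Y|exact: X|]; (apply: cvgM; last by []);
    by apply: cvgM; [exact: cst|].
have dFt (t : R) : on_sphere (fun e : 'rV[R]_n => is_derive t 1 (F e) (dF e t)).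
  move=> e Se.
  have d v := is_derive_dotv_rotation v e i j t.
  exact: (is_derive_mul (d u) (is_derive_mul (is_derive_exp a (d x)) (is_derive_exp b (d y)))).
have D := @sint_is_derive R n F dF 0 n0 (@filterE _ (nbhs (0 : R)) _ _ (fun t => And3 (cF t) (cdF t) (dFt t))).
have cstF : \forall t \near (0 : R), sint (F ^~ t) = sint (F ^~ 0).
  have : \forall t \near (0 : R), 0 < 1 + cos t.
    have c1 : 1 + cos t @[t --> (0 : R)] --> 1 + cos (0 : R).
      by apply: cvgD; [exact: cvg_cst|exact: continuous_cos].
    apply: (cvgr_gt _ c1); rewrite cos0; lra.
  apply: filterS => t ct.
  have c0 : scont (fun e => dotv u e * (dotv x e ^+ a * dotv y e ^+ b)).
    apply: scontM; first exact: scont_dotv.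
    by apply: scontM; apply: scontX; exact: scont_dotv.
  rewrite /F /lin cos0 sin0; under [in RHS]eq_fun do rewrite prot10.
  apply: (sint_prot n0 c0 ij ct); exact: cos2Dsin2.
have Z : is_derive (0 : R) 1 (fun t => sint (F ^~ t)) 0.
  apply: (near_eq_is_derive _ (is_derive_const (sint (F ^~ 0)) (0 : R) 1)).
  by apply: filterS cstF.
have E : sint (dF ^~ 0) = 0.
  by have [_ <-] := D (@nbhs_filter _ (0 : R)); have [_ ->] := Z.
rewrite -[RHS]E; apply: eq_sint => e Se.
by rewrite /dF /lin /lin' cos0 sin0 oppr0 prot10.
Qed.

(** The pairing is e_i v_j - e_j v_i, which vanishes for j = i, so the sum extends to all j and |e|
    = 1 applies. *)
Lemma sum_rotations (v : 'rV[R]_n) (e : 'rV[R]_n) (i : 'I_n) : unit_sphere e ->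
  \sum_(j | j != i) e ord0 j * dotv v (prot_part i j 0 1 e) = e ord0 i * dotv v e - v ord0 i.
Proof.
move=> /unit_sphereE Se.
transitivity (\sum_j (e ord0 i * (v ord0 j * e ord0 j) - v ord0 i * (e ord0 j * e ord0 j))).
  rewrite [RHS](bigD1 i)//= [X in _ = X + _](_ : _ = 0) ?add0r; last by ring.
  by apply: eq_bigr => j _; rewrite dotv_prot_partr; ring.
by rewrite sumrB -!mulr_sumr -[X in _ - _ * X]/(dotv e e) Se mulr1.
Qed.

(* The fields e_i d_j - e_j d_i integrate to 0 over the sphere; they are applied
   to e_j <x,e>^a <y,e>^b and the results are summed with weights x_i. *)
Lemma moment_rec a b : (n%:R - 1 + a%:R + b%:R) * moment a.+1 b =
  a%:R * dotv x x * moment a.-1 b + b%:R * dotv x y * moment a b.-1.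
Proof.
have cxy j k : scont (fun e : 'rV[R]_n => dotv x e ^+ j * dotv y e ^+ k).
  by apply: scontM; apply: scontX; exact: scont_dotv.
(* The integrand of [sint_rotation_derive] with [u] the j-th basis vector, whose derivative along
   the rotation is e_i. *)
pose T (i j : 'I_n) (e : 'rV[R]_n) : R := e ord0 i * (dotv x e ^+ a * dotv y e ^+ b)
  + e ord0 j * ((a%:R * dotv x e ^+ a.-1 * dotv x (prot_part i j 0 1 e)) * dotv y e ^+ b
    + dotv x e ^+ a * (b%:R * dotv y e ^+ b.-1 * dotv y (prot_part i j 0 1 e))).
have T0 i j : j != i -> sint (T i j) = 0.
  move=> ji; rewrite -[RHS](sint_rotation_derive (delta_mx ord0 j) a b (i := i) (j := j)); last by rewrite eq_sym.
  have dj w : dotv (delta_mx ord0 j : 'rV[R]_n) w = w ord0 j by rewrite dotvC dotv_delta.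
  apply: eq_sint => e Se; rewrite /T !dj prot_partE eqxx (negbTE ji).
  by rewrite mulr0 add0r mul1r mul0r addr0 mulr1.
have cT i j : scont (T i j).
  have cc k : scont (fun e : 'rV[R]_n => e ord0 k).
    by under eq_fun do rewrite -dotv_delta dotvC; exact: scont_dotv.
  have cp v : scont (fun e : 'rV[R]_n => dotv v (prot_part i j 0 1 e)).
    under eq_fun do rewrite dotv_prot_partr.
    by apply: scontD; apply: scontM; try exact: scont_cst;
      [apply: scontB|apply: scontD]; apply: scontM => //; exact: scont_cst.
  have cX k v : scont (fun e : 'rV[R]_n => dotv v e ^+ k) by apply: scontX; exact: scont_dotv.
  apply: scontD; first by apply: scontM.
  by apply: scontM => //; apply: scontD; repeat (apply: scontM => //; try exact: scont_cst).
have E : sint (fun e => \sum_i \sum_(j | j != i) x ord0 i * T i j e) = 0.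
  rewrite sint_sum// => [|i _]; last first.
    by apply: scont_sum => j _; apply: scontM => //; exact: scont_cst.
  apply: big1 => i _; rewrite sint_sum// => [|j _]; last first.
    by apply: scontM => //; exact: scont_cst.
  by apply: big1 => j ji; rewrite sintZl// T0// mulr0.
have key : on_sphere (fun e => \sum_i \sum_(j | j != i) x ord0 i * T i j e =
    (n%:R - 1 + a%:R + b%:R) * (dotv x e ^+ a.+1 * dotv y e ^+ b) -
    (a%:R * dotv x x * (dotv x e ^+ a.-1 * dotv y e ^+ b)
      + b%:R * dotv x y * (dotv x e ^+ a * dotv y e ^+ b.-1))).
  move=> e Se; set A := dotv x e ^+ a * dotv y e ^+ b.
  set Ax := a%:R * dotv x e ^+ a.-1 * dotv y e ^+ b.
  set Ay := b%:R * dotv x e ^+ a * dotv y e ^+ b.-1.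
  have inner i : \sum_(j | j != i) x ord0 i * T i j e = ((n%:R - 1) * A) * (x ord0 i * e ord0 i)
      + Ax * (dotv x e * (x ord0 i * e ord0 i) - x ord0 i * x ord0 i)
      + Ay * (dotv y e * (x ord0 i * e ord0 i) - x ord0 i * y ord0 i).
    transitivity (\sum_(j | j != i) (x ord0 i * (e ord0 i * A)) +
        (x ord0 i * Ax * (\sum_(j | j != i) e ord0 j * dotv x (prot_part i j 0 1 e)) +
         x ord0 i * Ay * (\sum_(j | j != i) e ord0 j * dotv y (prot_part i j 0 1 e)))).
      rewrite !mulr_sumr -!big_split/=; apply: eq_bigr => j _.
      by rewrite /T /Ax /Ay /A; ring.
    rewrite !sum_rotations// sumr_const cardC1 card_ord.
    have -> : (n%:R - 1 : R) = n.-1%:R by rewrite -{1}(prednK n0) -natr1 addrK.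
    by rewrite -[_ *+ n.-1]mulr_natr; ring.
  rewrite (eq_bigr _ (fun i _ => inner i)) !big_split/= -!mulr_sumr !sumrB -!mulr_sumr.
  rewrite -[\sum_i x ord0 i * e ord0 i]/(dotv x e) -[\sum_i x ord0 i * x ord0 i]/(dotv x x).
  rewrite -[\sum_i x ord0 i * y ord0 i]/(dotv x y).
  (* The factor [a%:R] also covers a = 0, where [a.-1] is truncated. *)
  have ea : a%:R * dotv x e ^+ a.-1 * dotv x e = a%:R * dotv x e ^+ a.
    by case: (a) => [|k]; rewrite ?mul0r//= exprSr mulrA.
  have eb : b%:R * dotv y e ^+ b.-1 * dotv y e = b%:R * dotv y e ^+ b.
    by case: (b) => [|k]; rewrite ?mul0r//= exprSr mulrA.
  rewrite exprSr /A /Ax /Ay.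
  have -> : a%:R * dotv x e ^+ a.-1 * dotv y e ^+ b * (dotv x e * dotv x e - dotv x x) =
     (a%:R * dotv x e ^+ a.-1 * dotv x e) * dotv y e ^+ b * dotv x e
      - a%:R * dotv x e ^+ a.-1 * dotv y e ^+ b * dotv x x by ring.
  have -> : b%:R * dotv x e ^+ a * dotv y e ^+ b.-1 * (dotv y e * dotv x e - dotv x y) =
     (b%:R * dotv y e ^+ b.-1 * dotv y e) * dotv x e ^+ a * dotv x e
      - b%:R * dotv x e ^+ a * dotv y e ^+ b.-1 * dotv x y by ring.
  rewrite ea eb; ring.
have cZ c j k : scont (fun e : 'rV[R]_n => c * (dotv x e ^+ j * dotv y e ^+ k)).
  by apply: scontM => //; exact: scont_cst.
rewrite (eq_sint key) sintB// in E; last exact: scontD.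
rewrite sintD// !sintZl// in E.
by apply/eqP; rewrite -subr_eq0 E.
Qed.

End moments.

(** * Closed form of the moments *)

Section moment_formula.
Context {R : realType}.

(** The X9 term without its two numerator Pochhammer symbols: those come from the binomial series,
    the denominator from the moments. *)
Definition moment_term (c u v w : R) (p q l : nat) : R :=
  u ^+ p * v ^+ q * w ^+ l / (pochhammer c (p + q + l) * p`!%:R * q`!%:R * l`!%:R).

Definition box_sum (B : nat) (f : nat -> nat -> nat -> R) : R :=
  \sum_(0 <= p < B) \sum_(0 <= q < B) \sum_(0 <= l < B) f p q l.

(** The monomial |x|^(2p) <x,y>^q |y|^(2l) has degree 2p + q in x and 2l + q in y; this selects
    bidegree (j, k). *)
Definition degree_is (j k p q l : nat) : R := ((2 * p + q == j)%N && (2 * l + q == k)%N)%:R.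

(** The degree constraints bound p, q and l, so any B above j and k captures all terms and the sum
    stays finite. *)
Definition moment_sum (B : nat) (c u v w : R) (j k : nat) : R :=
  box_sum B (fun p q l => degree_is j k p q l * moment_term c u v w p q l).

Lemma eq_box_sum B f g : (forall p q l, f p q l = g p q l) -> box_sum B f = box_sum B g.
Proof. by move=> fg; do 3!(apply: eq_bigr => ? _). Qed.

Lemma box_sumZ B (a : R) f : box_sum B (fun p q l => a * f p q l) = a * box_sum B f.
Proof.
rewrite /box_sum mulr_sumr; apply: eq_bigr => p _; rewrite mulr_sumr; apply: eq_bigr => q _.
by rewrite mulr_sumr.
Qed.

Lemma box_sumD B f g : box_sum B (fun p q l => f p q l + g p q l) = box_sum B f + box_sum B g.
Proof.
rewrite /box_sum -big_split; apply: eq_bigr => p _; rewrite -big_split; apply: eq_bigr => q _.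
by rewrite -big_split.
Qed.

Lemma box_sum_rev B f : box_sum B f = box_sum B (fun p q l => f l q p).
Proof.
rewrite /box_sum; under eq_bigr do rewrite exchange_big.
rewrite exchange_big/=; apply: eq_bigr => q _.
by rewrite exchange_big.
Qed.

Lemma sum_shift B (g h : nat -> R) : (0 < B)%N -> g 0%N = 0 -> h B.-1 = 0 ->
  (forall p, g p.+1 = h p) -> \sum_(0 <= p < B) g p = \sum_(0 <= p < B) h p.
Proof.
case: B => // B _ g0 hB gh.
rewrite big_nat_recl// big_nat_recr//= g0 hB add0r addr0.
by apply: eq_bigr => p _.
Qed.

Lemma moment_sumC B (c u v w : R) j k : moment_sum B c u v w j k = moment_sum B c w v u k j.
Proof.
rewrite /moment_sum box_sum_rev; apply: eq_box_sum => p q l.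
rewrite /degree_is andbC; congr (_ * _); rewrite /moment_term.
rewrite (_ : (l + q + p)%N = (p + q + l)%N); last lia.
congr (_ / _); ring.
Qed.

Lemma pochhammer_gt0 (c : R) m : 0 < c -> 0 < pochhammer c m.
Proof. by move=> c0; apply: prodr_gt0 => i _; rewrite ltr_wpDr. Qed.

Lemma moment_term_p (c u v w : R) p q l : 0 < c ->
  p.+1%:R * (c + (p + q + l)%:R) * moment_term c u v w p.+1 q l =
  u * moment_term c u v w p q l.
Proof.
move=> c0; rewrite /moment_term (_ : (p.+1 + q + l = (p + q + l).+1)%N); last lia.
rewrite pochhammerS factS natrM exprS.
have h1 := pochhammer_gt0 (p + q + l) c0.
have h2 : 0 < c + (p + q + l)%:R :> R by rewrite ltr_wpDr.
move: (pochhammer _ _) h1 (c + _) h2 => P P0 C C0.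
have : p`!%:R != 0 :> R := fact_neq0 p; have : q`!%:R != 0 :> R := fact_neq0 q.
have : l`!%:R != 0 :> R := fact_neq0 l.
have p1 : p.+1%:R != 0 :> R by rewrite pnatr_eq0.
move: (p.+1%:R) p1 (p`!%:R) (q`!%:R) (l`!%:R) => a a0 f1 f2 f3 h1 h2 h3.
by field; rewrite h1 h2 h3 a0 !gt_eqF.
Qed.

Lemma moment_term_q (c u v w : R) p q l : 0 < c ->
  q.+1%:R * (c + (p + q + l)%:R) * moment_term c u v w p q.+1 l =
  v * moment_term c u v w p q l.
Proof.
move=> c0; rewrite /moment_term (_ : (p + q.+1 + l = (p + q + l).+1)%N); last lia.
rewrite pochhammerS factS natrM exprS.
have h1 := pochhammer_gt0 (p + q + l) c0.
have h2 : 0 < c + (p + q + l)%:R :> R by rewrite ltr_wpDr.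
move: (pochhammer _ _) h1 (c + _) h2 => P P0 C C0.
have : p`!%:R != 0 :> R := fact_neq0 p; have : q`!%:R != 0 :> R := fact_neq0 q.
have : l`!%:R != 0 :> R := fact_neq0 l.
have p1 : q.+1%:R != 0 :> R by rewrite pnatr_eq0.
move: (q.+1%:R) p1 (p`!%:R) (q`!%:R) (l`!%:R) => a a0 f1 f2 f3 h1 h2 h3.
by field; rewrite h1 h2 h3 a0 !gt_eqF.
Qed.

(** On terms with 2p + q = a + 1 and 2l + q = b the factor 2c - 1 + a + b is 2C with C = c + p + q +
    l - 1, and a + 1 = 2p + q. The product splits as 4pC + 2qC, and pC and qC lower the index p or q
    of the term at the price of u or v. *)
Lemma moment_sum_rec B (c u v w : R) a b : 0 < c -> (a.+1 < B)%N ->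
  a.+1%:R * (2 * c - 1 + a%:R + b%:R) * moment_sum B c u v w a.+1 b =
  4 * u * (if a is a'.+1 then moment_sum B c u v w a' b else 0)
  + 2 * v * (if b is b'.+1 then moment_sum B c u v w a b' else 0).
Proof.
move=> c0 aB; have B0 : (0 < B)%N by lia.
pose t := moment_term c u v w.
pose C p q l : R := c + (p + q + l)%:R - 1.
have split p q l : a.+1%:R * (2 * c - 1 + a%:R + b%:R) * (degree_is a.+1 b p q l * t p q l) =
    4 * (degree_is a.+1 b p q l * (p%:R * C p q l * t p q l))
    + 2 * (degree_is a.+1 b p q l * (q%:R * C p q l * t p q l)).
  rewrite /degree_is; case: andP => [[/eqP ha /eqP hb]|_]; last by rewrite !mul0r !mulr0 addr0.
  have e1 : a.+1%:R = 2 * p%:R + q%:R :> R by rewrite -ha natrD natrM.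
  have e2 : b%:R = 2 * l%:R + q%:R :> R by rewrite -hb natrD natrM.
  have e3 : a%:R = 2 * p%:R + q%:R - 1 :> R by rewrite -e1 -natr1 addrK.
  by rewrite e1 e3 e2 /C !natrD; ring.
rewrite /moment_sum -box_sumZ (eq_box_sum _ split) box_sumD !box_sumZ -!mulrA.
congr (_ * _ + _ * _).
- transitivity (box_sum B (fun p q l => ((2 * p + q).+1 == a)%N%:R * (2 * l + q == b)%N%:R * (u * t p q l))).
    apply: sum_shift => //.
    + by apply: big1 => q _; apply: big1 => l _; rewrite !mul0r mulr0.
    + apply: big1 => q _; apply: big1 => l _.
      by rewrite (_ : _ == a = false) ?mul0r//; apply/eqP; lia.
    + move=> p; apply: eq_bigr => q _; apply: eq_bigr => l _.
      rewrite /degree_is -natrM mulnb; congr (_%:R * _).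
        by congr (nat_of_bool (_ && _)); apply/eqP/eqP; lia.
      by rewrite -moment_term_p// /C -!addnA addSn -natr1 -/t; ring.
  case: a aB {split} => [|a] aB.
    by rewrite mulr0 /box_sum; do 3!(apply: big1 => ? _); rewrite !mul0r.
  rewrite -box_sumZ; apply: eq_box_sum => p q l.
  by rewrite eqSS -natrM mulnb mulrCA.
- transitivity (box_sum B (fun p q l => (2 * p + q == a)%N%:R * ((2 * l + q).+1 == b)%N%:R * (v * t p q l))).
    apply: eq_bigr => p _; apply: sum_shift => //.
    + by apply: big1 => l _; rewrite !mul0r mulr0.
    + apply: big1 => l _.
      by rewrite (_ : _ == a = false) ?mul0r//; apply/eqP; lia.
    + move=> q; apply: eq_bigr => l _.
      rewrite /degree_is -natrM mulnb; congr (_%:R * _).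
        by congr (nat_of_bool (_ && _)); apply/eqP/eqP; lia.
      by rewrite -moment_term_q// /C addnS addSn -natr1 -/t; ring.
  case: b {split} => [|b].
    by rewrite mulr0 /box_sum; do 3!(apply: big1 => ? _); rewrite mulr0 mul0r.
  rewrite -box_sumZ; apply: eq_box_sum => p q l.
  by rewrite eqSS -natrM mulnb mulrCA.
Qed.

Lemma moment_sum00 B (c u v w : R) : (0 < B)%N -> moment_sum B c u v w 0 0 = 1.
Proof.
case: B => // B _; rewrite /moment_sum /box_sum.
rewrite big_nat_recl// [X in _ + X]big1 => [|p _]; last first.
  by apply: big1 => q _; apply: big1 => l _; rewrite /degree_is mulnS !addSn mul0r.
rewrite addr0 big_nat_recl// [X in _ + X]big1 => [|q _]; last first.
  by apply: big1 => l _; rewrite /degree_is addnS mul0r.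
rewrite addr0 big_nat_recl// [X in _ + X]big1 => [|l _]; last first.
  by rewrite /degree_is mulnS !addSn andbF mul0r.
rewrite /degree_is /moment_term /= fact0 /pochhammer big_ord0 !expr0; by field.
Qed.

End moment_formula.

Section moments_of_sphere.
Context {R : realType} (n : nat).
Hypothesis n0 : (0 < n)%N.
Implicit Types x y : 'rV[R]_n.

Lemma momentC x y j k : moment x y j k = moment y x k j.
Proof. by apply: eq_sint => e _; rewrite mulrC. Qed.

(** Both sides obey one recursion: c = n/2 gives the factor n - 1 + a + b, and the denominators 4,
    2, 4 absorb the coefficients of [moment_sum_rec]. Induction on j + k; when j = 0 the roles of x
    and y are exchanged. *)
Lemma momentE B x y j k : (1 < n)%N -> (j < B)%N -> (k < B)%N -> moment x y j k =
  j`!%:R * k`!%:R * moment_sum B (n%:R / 2) (dotv x x / 4) (dotv x y / 2) (dotv y y / 4) j k.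
Proof.
move=> n1; have [m] := ubnP (j + k); elim: m => // m IH in x y j k *.
have step x1 y1 a b : (a.+1 + b < m.+1)%N -> (a.+1 < B)%N -> (b < B)%N ->
    moment x1 y1 a.+1 b = a.+1`!%:R * b`!%:R *
      moment_sum B (n%:R / 2) (dotv x1 x1 / 4) (dotv x1 y1 / 2) (dotv y1 y1 / 4) a.+1 b.
  move=> abm aB bB; have c0 : 0 < n%:R / 2 :> R by rewrite divr_gt0 ?ltr0n.
  have rec := moment_sum_rec (dotv x1 x1 / 4) (dotv x1 y1 / 2) (dotv y1 y1 / 4) b c0 aB.
  have Mrec := moment_rec n0 x1 y1 a b.
  have nz : n%:R - 1 + a%:R + b%:R != 0 :> R.
    rewrite gt_eqF// -addrA ltr_wpDr ?addr_ge0// subr_gt0 ltr1n//.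
  apply: (mulfI nz); rewrite Mrec factS natrM.
  have e2 : 2 * (n%:R / 2) - 1 + a%:R + b%:R = n%:R - 1 + a%:R + b%:R :> R by field.
  rewrite {}e2 in rec.
  have E (A f g M N : R) : N * (A * f * g * M) = f * g * (A * N * M) by ring.
  rewrite {}E {}rec; move: (n%:R / 2) IH => c IH.
  have ha : a%:R * moment x1 y1 a.-1 b = a`!%:R * b`!%:R *
      (if a is a'.+1 then moment_sum B c (dotv x1 x1 / 4) (dotv x1 y1 / 2) (dotv y1 y1 / 4) a' b else 0).
    case: (a) abm aB => [|a'] abm aB; first by rewrite mul0r mulr0.
    by rewrite IH//=; [rewrite factS natrM; ring|lia|lia].
  have hb : b%:R * moment x1 y1 a b.-1 = a`!%:R * b`!%:R *
      (if b is b'.+1 then moment_sum B c (dotv x1 x1 / 4) (dotv x1 y1 / 2) (dotv y1 y1 / 4) a b' else 0).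
    case: (b) abm bB => [|b'] abm bB; first by rewrite mul0r mulr0.
    by rewrite IH//=; [rewrite factS natrM; ring|lia|lia|lia].
  rewrite mulrAC ha (mulrAC b%:R) hb.
  move: (if a is _.+1 then _ else _) (if b is _.+1 then _ else _) => A' B'.
  by field.
case: j => [|j] jk jB kB; last exact: step.
case: k jk kB => [|k] jk kB; last first.
  rewrite momentC (dotvC x y) moment_sumC mulrAC (mulrC _`!%:R).
  by rewrite step; [ring|lia|lia|lia].
rewrite moment_sum00// fact0 mulr1 mulr1 -[RHS](sint_cst 1 n0).
by apply: eq_sint => e _; rewrite !expr0 mulr1.
Qed.

End moments_of_sphere.

(** * Triple series *)

Section triple_series.
Context {R : realType}.
Implicit Types (f g : nat -> nat -> nat -> R) (u : R^nat).

Lemma nonneg_series u (C : R) : (forall k, 0 <= u k) ->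
  (forall N, \sum_(0 <= k < N) u k <= C) ->
  exists l, [/\ series u N @[N --> \oo] --> l, l <= C & forall N, \sum_(0 <= k < N) u k <= l].
Proof.
move=> u0 uC; have nd : nondecreasing_seq (series u).
  by apply/nondecreasing_seqP => N; rewrite /series/= big_nat_recr//= lerDl.
have cu : cvgn (series u).
  by apply: nondecreasing_is_cvgn => //; exists C => _ [N _ <-]; exact: uC.
exists (limn (series u)); split => //.
  by apply: limr_le => //; exact: nearW.
by move=> N; exact: nondecreasing_cvgn_le.
Qed.

(** Convergence of the three nested series is part of the statement, since the infinite sums of
    [exton_X9] have a value even without it. *)
Definition iterated_sum f (S : R) := exists r s,
  [/\ forall p q, series (f p q) N @[N --> \oo] --> (r p q : R),
      forall p, series (r p) N @[N --> \oo] --> (s p : R) &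
      series s N @[N --> \oo] --> S].

Lemma le_box_sum B f g : (forall p q l, f p q l <= g p q l) -> box_sum B f <= box_sum B g.
Proof. by move=> fg; do 3!(apply: ler_sum => ? _). Qed.

Lemma sum_nat_mono u B B' : (forall k, 0 <= u k) -> (B <= B')%N ->
  \sum_(0 <= k < B) u k <= \sum_(0 <= k < B') u k.
Proof.
by move=> u0 BB; rewrite [leRHS](big_cat_nat (n := B))//= lerDl; exact: sumr_ge0.
Qed.

Lemma box_sum_mono B B' f : (forall p q l, 0 <= f p q l) -> (B <= B')%N ->
  box_sum B f <= box_sum B' f.
Proof.
move=> f0 BB; apply: (@le_trans _ _ (\sum_(0 <= p < B) \sum_(0 <= q < B') \sum_(0 <= l < B') f p q l)).
  apply: ler_sum => p _; apply: (@le_trans _ _ (\sum_(0 <= q < B) \sum_(0 <= l < B') f p q l)).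
    by apply: ler_sum => q _; exact: sum_nat_mono.
  by apply: sum_nat_mono => // q; exact: sumr_ge0.
by apply: sum_nat_mono => // p; apply: sumr_ge0 => q _; exact: sumr_ge0.
Qed.

(** Every rectangular partial sum lies in a box, so the bound passes to each level, and monotone
    convergence gives the inner, middle and outer limits in turn. *)
Lemma nonneg_iterated_sum f (C : R) : (forall p q l, 0 <= f p q l) ->
  (forall B, box_sum B f <= C) ->
  exists S, [/\ iterated_sum f S, S <= C & forall B, box_sum B f <= S].
Proof.
move=> f0 fC.
have part (P Q L : nat) : \sum_(0 <= p < P) \sum_(0 <= q < Q) \sum_(0 <= l < L) f p q l <= C.
  apply: le_trans (fC (maxn P (maxn Q L))).
  set M := maxn P _.
  apply: (@le_trans _ _ (\sum_(0 <= p < P) \sum_(0 <= q < M) \sum_(0 <= l < M) f p q l)).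
    apply: ler_sum => p _; apply: (@le_trans _ _ (\sum_(0 <= q < Q) \sum_(0 <= l < M) f p q l)).
      by apply: ler_sum => q _; apply: sum_nat_mono => //; lia.
    by apply: sum_nat_mono => [q|]; [exact: sumr_ge0|lia].
  apply: sum_nat_mono => [p|]; [by apply: sumr_ge0 => q _; exact: sumr_ge0|lia].
have single (u : R^nat) k N : (forall j, 0 <= u j) -> (k < N)%N -> u k <= \sum_(0 <= j < N) u j.
  move=> u0 kN; rewrite (bigD1_seq k) ?iota_uniq ?mem_index_iota//= lerDl; exact: sumr_ge0.
have h1 p q : exists r, [/\ series (f p q) N @[N --> \oo] --> r, r <= C &
    forall N, \sum_(0 <= k < N) f p q k <= r].
  apply: nonneg_series => // N; apply: le_trans (part p.+1 q.+1 N).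
  apply: le_trans (single _ p _ _ _) => //; last first.
    by move=> p'; apply: sumr_ge0 => q' _; exact: sumr_ge0.
  apply: (single (fun q => \sum_(0 <= l < N) f p q l) q) => // q'; exact: sumr_ge0.
have [r' hr'] := choice (fun pq : nat * nat => h1 pq.1 pq.2).
pose r p q : R := r' (p, q).
have hr p q : [/\ series (f p q) N @[N --> \oo] --> (r p q), 0 <= r p q &
    forall N, \sum_(0 <= k < N) f p q k <= r p q].
  by have [? ? h] := hr' (p, q); split => //; have := h 0%N; rewrite big_geq.
have partr P Q : \sum_(0 <= p < P) \sum_(0 <= q < Q) r p q <= C.
  have c : \sum_(0 <= p < P) \sum_(0 <= q < Q) series (f p q) N @[N --> \oo] -->
      \sum_(0 <= p < P) \sum_(0 <= q < Q) r p q.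
    by apply: cvg_sumr => p _; apply: cvg_sumr => q _; have [] := hr p q.
  by apply: (ler_cvg_to c (@cvg_cst _ C _ \oo _)); apply: nearW => N; exact: part.
have h2 p : exists s, [/\ series (r p) N @[N --> \oo] --> s, s <= C &
    forall N, \sum_(0 <= k < N) r p k <= s].
  apply: nonneg_series => [q|N]; first by have [] := hr p q.
  apply: le_trans (partr p.+1 N); apply: (single (fun p => \sum_(0 <= q < N) r p q) p) => // p'.
  by apply: sumr_ge0 => q _; have [] := hr p' q.
have [s hs] := @choice _ _ _ h2.
have {}hs p : [/\ series (r p) N @[N --> \oo] --> (s p), 0 <= s p &
    forall N, \sum_(0 <= k < N) r p k <= s p].
  by have [? ? h] := hs p; split => //; have := h 0%N; rewrite big_geq.
have parts P : \sum_(0 <= p < P) s p <= C.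
  have c : \sum_(0 <= p < P) series (r p) N @[N --> \oo] --> \sum_(0 <= p < P) s p.
    by apply: cvg_sumr => p _; have [] := hs p.
  by apply: (ler_cvg_to c (@cvg_cst _ C _ \oo _)); apply: nearW => N; exact: partr.
have [S [cS SC hS]] : exists S, [/\ series s N @[N --> \oo] --> S, S <= C &
    forall N, \sum_(0 <= k < N) s k <= S].
  by apply: nonneg_series => // p; have [] := hs p.
exists S; split => //.
  by exists r, s; split => // [p q|p]; [have [] := hr p q|have [] := hs p].
move=> B; apply: le_trans (hS B); apply: ler_sum => p _.
have [_ _ h] := hs p; apply: le_trans (h B); apply: ler_sum => q _.
by have [_ _ h'] := hr p q; exact: h'.
Qed.

(* The triples (p, q, l) with 2p+q < N and 2l+q < N: the image of the square of
   exponents j, k < N of the double series in <x,e> and <y,e>. *)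
Definition degree_sum N f : R :=
  box_sum N (fun p q l => ((2 * p + q < N)%N && (2 * l + q < N)%N)%:R * f p q l).

Lemma degree_sumB N f g :
  degree_sum N (fun p q l => f p q l - g p q l) = degree_sum N f - degree_sum N g.
Proof.
rewrite /degree_sum -[X in _ - X]mul1r -mulNr -box_sumZ -box_sumD.
by apply: eq_box_sum => p q l; rewrite mulrBr mulN1r.
Qed.

Lemma degree_sum_le_box N f : (forall p q l, 0 <= f p q l) -> degree_sum N f <= box_sum N f.
Proof.
move=> f0; apply: le_box_sum => p q l; case: (_ && _); first by rewrite mul1r.
by rewrite mul0r.
Qed.

(** For p, q, l < B both 2p + q and 2l + q are below 3B. *)
Lemma box_le_degree_sum B N f : (forall p q l, 0 <= f p q l) -> (3 * B <= N)%N ->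
  box_sum B f <= degree_sum N f.
Proof.
move=> f0 BN; apply: (@le_trans _ _ (degree_sum N (fun p q l => ((p < B) && (q < B) && (l < B))%N%:R * f p q l))).
  apply: (@le_trans _ _ (box_sum B (fun p q l => ((2 * p + q < N)%N && (2 * l + q < N)%N)%:R *
      (((p < B) && (q < B) && (l < B))%N%:R * f p q l)))).
    rewrite le_eqVlt; apply/orP; left; apply/eqP.
    apply: eq_big_nat => p /andP[_ pB]; apply: eq_big_nat => q /andP[_ qB].
    apply: eq_big_nat => l /andP[_ lB]; rewrite pB qB lB !mul1r.
    by rewrite (_ : _ && _ = true) ?mul1r//; apply/andP; split; lia.
  apply: box_sum_mono => [p q l|]; last lia.
  by apply: mulr_ge0 => //; exact: mulr_ge0.
apply: le_box_sum => p q l; apply: ler_wpM2l => //.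
by case: (_ && _); rewrite ?mul1r ?mul0r.
Qed.

(** For nonnegative terms boxes and degree truncations are cofinal in each other, so they have the
    same limit. *)
Lemma nonneg_degree_sum f (S : R) : (forall p q l, 0 <= f p q l) ->
  degree_sum N f @[N --> \oo] --> S -> iterated_sum f S /\ forall B, box_sum B f <= S.
Proof.
move=> f0 fS.
have bS B : box_sum B f <= S.
  apply: (ler_cvg_to (@cvg_cst _ (box_sum B f) _ \oo _) fS).
  by exists (3 * B)%N => // N /= BN; exact: box_le_degree_sum.
have [S' [iS SS' hS]] := nonneg_iterated_sum f0 bS; split => //.
suff -> : S = S' by [].
apply/eqP; rewrite eq_le SS' andbT.
apply: (ler_cvg_to fS (@cvg_cst _ S' _ \oo _)); apply: nearW => N.
exact: le_trans (degree_sum_le_box _ f0) (hS N).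
Qed.

Lemma iterated_sumB f g (S T : R) : iterated_sum f S -> iterated_sum g T ->
  iterated_sum (fun p q l => f p q l - g p q l) (S - T).
Proof.
move=> [r [s [h1 h2 h3]]] [r' [s' [h1' h2' h3']]].
have E (u v : R^nat) : series (fun k => u k - v k) = fun N => series u N - series v N.
  by apply/funext => N; rewrite /series/= sumrB.
exists (fun p q => r p q - r' p q), (fun p => s p - s' p); split.
- by move=> p q; rewrite E; exact: cvgB.
- by move=> p; rewrite E; exact: cvgB.
- by rewrite E; exact: cvgB.
Qed.

Lemma iterated_sum_lim f (S : R) : iterated_sum f S ->
  \big[+%R/0]_(0 <= p <oo) \big[+%R/0]_(0 <= q <oo) \big[+%R/0]_(0 <= l <oo) f p q l = S.
Proof.
move=> [r [s [h1 h2 h3]]].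
have e1 p q : \big[+%R/0]_(0 <= l <oo) f p q l = r p q by exact: cvg_lim (h1 p q).
have e2 p : \big[+%R/0]_(0 <= q <oo) \big[+%R/0]_(0 <= l <oo) f p q l = s p.
  under eq_fun do under eq_bigr do rewrite e1; exact: cvg_lim (h2 p).
by under eq_fun do under eq_bigr do rewrite e2; exact: cvg_lim h3.
Qed.

(** Tonelli: an unordered sum of nonnegative terms is computed by nested summation. It converts
    iterated limits into summability. *)
Lemma iterated_sum_esum f (S : R) : (forall p q l, 0 <= f p q l) -> iterated_sum f S ->
  (\esum_(t in [set: nat * nat * nat]) (f t.1.1 t.1.2 t.2)%:E = S%:E)%E.
Proof.
move=> f0 [r [s [h1 h2 h3]]].
have E (u : R^nat) (l : R) : (forall k, 0 <= u k) -> series u N @[N --> \oo] --> l ->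
    (\esum_(k in [set: nat]) (u k)%:E = l%:E)%E.
  move=> u0 ul; rewrite -nneseries_esumT => [|k]; last by rewrite lee_fin.
  under eq_fun do rewrite sumEFin.
  by apply: cvg_lim => //; apply: cvg_EFin => //; exact: nearW.
have lim0 (u : R^nat) (l : R) : (forall k, 0 <= u k) -> series u N @[N --> \oo] --> l -> 0 <= l.
  move=> u0 ul; apply: (ler_cvg_to (@cvg_cst _ (0 : R) _ \oo _) ul); apply: nearW => N.
  exact: sumr_ge0.
have r0 p q : 0 <= r p q by apply: lim0 (h1 p q).
have s0 p : 0 <= s p by apply: lim0 (h2 p).
have XT (T1 T2 : Type) : [set: T1 * T2] = [set: T1] `*`` (fun=> [set: T2]).
  by apply/seteqP; split.
rewrite XT -(esum_esum (a := fun pq l => (f pq.1 pq.2 l)%:E)) => [|pq l _ _]; last by rewrite lee_fin.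
rewrite (eq_esum (b := fun pq => (r pq.1 pq.2)%:E)) => [|pq _]; last exact: E.
rewrite XT -(esum_esum (a := fun p q => (r p q)%:E)) => [|p q _ _]; last by rewrite lee_fin.
by rewrite (eq_esum (b := fun p => (s p)%:E)) => [|p _]; exact: E.
Qed.

(* f is the difference of the nonnegative families g and g - f. *)
Lemma dominated_iterated_sum f g (S T : R) : (forall p q l, `|f p q l| <= g p q l) ->
  degree_sum N f @[N --> \oo] --> S -> degree_sum N g @[N --> \oo] --> T ->
  iterated_sum f S /\
  summable [set: nat * nat * nat] (fun t => (f t.1.1 t.1.2 t.2)%:E).
Proof.
move=> fg fS gT; have g0 p q l : 0 <= g p q l by apply: le_trans (fg p q l).
have [ig bg] := nonneg_degree_sum g0 gT; split.
  have h0 p q l : 0 <= g p q l - f p q l.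
    by rewrite subr_ge0; apply: le_trans (ler_norm _) (fg p q l).
  have cd : degree_sum N (fun p q l => g p q l - f p q l) @[N --> \oo] --> T - S.
    by under eq_fun do rewrite degree_sumB; exact: cvgB.
  have [ih _] := nonneg_degree_sum h0 cd.
  have := iterated_sumB ig ih; rewrite opprB addrC subrK.
  rewrite (_ : (fun p q l => g p q l - (g p q l - f p q l)) = f)//.
  by apply/funext => p; apply/funext => q; apply/funext => l; rewrite opprB addrC subrK.
have nf B : box_sum B (fun p q l => `|f p q l|) <= T.
  by apply: le_trans (bg B); exact: le_box_sum.
have [S' [iS _ _]] := nonneg_iterated_sum (fun p q l => normr_ge0 (f p q l)) nf.
rewrite /summable; under eq_esum do rewrite abse_EFin.
by rewrite (iterated_sum_esum _ iS)// ltry.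
Qed.

End triple_series.

(** * From the kernel integral to the X9 series *)

Section expansion.
Context {R : realType} (n : nat).
Hypothesis n2 : (2 < n)%N.
Implicit Types (x y z : 'rV[R]_n) (j k N : nat).

Let n0 : (0 < n)%N. Proof. exact: ltn_trans n2. Qed.

Lemma sum_box_sum M B (F : nat -> nat -> nat -> nat -> R) :
  \sum_(0 <= j < M) box_sum B (F j) = box_sum B (fun p q l => \sum_(0 <= j < M) F j p q l).
Proof.
rewrite /box_sum exchange_big/=; apply: eq_bigr => p _.
by rewrite exchange_big/=; apply: eq_bigr => q _; rewrite exchange_big.
Qed.

Lemma sum_eqb M m (A : R^nat) : \sum_(0 <= j < M) A j * (m == j)%:R = (m < M)%N%:R * A m.
Proof.
elim: M => [|M IH]; first by rewrite big_geq// mul0r.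
rewrite big_nat_recr//= IH ltnS.
by case: ltngtP => [_|_|->]; rewrite ?(mul0r, mulr0, addr0, add0r, mul1r, mulr1).
Qed.

Lemma X9_term_split (s t u v w b1 b2 c i1 i2 : R) p q l :
  i1 * (b1 * s ^+ (2 * p + q)%N) * (i2 * (b2 * t ^+ (2 * l + q)%N) * (u ^+ p * v ^+ q * w ^+ l / c)) =
  i1 * i2 * (b1 * b2 / c * (s ^+ 2 * u) ^+ p * (s * t * v) ^+ q * (t ^+ 2 * w) ^+ l).
Proof. by rewrite (exprD s (2 * p)%N) (exprD t (2 * l)%N) (exprM s) (exprM t) !exprMn; ring. Qed.

(** Expanding both truncations gives moments of orders j, k <= N. Their factorials j! k! cancel
    those of the binomial coefficients, and summing over j and k replaces them by 2p + q and 2l + q,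
    the indices of the numerator Pochhammer symbols. *)
Lemma sint_poisson_sum x y N :
  sint (fun z => poisson_sum x N z * poisson_sum y N z) =
  poisson_factor x * poisson_factor y * degree_sum N.+1
    (X9_term (n - 1)%:R (n - 1)%:R (n%:R / 2) (poisson_scale x ^+ 2 * (dotv x x / 4))
       (poisson_scale x * poisson_scale y * (dotv x y / 2)) (poisson_scale y ^+ 2 * (dotv y y / 4))).
Proof.
set a : R := (n - 1)%:R; set s := poisson_scale x; set t := poisson_scale y.
pose A j : R := binom_coef (n - 1) j * s ^+ j.
pose B k : R := binom_coef (n - 1) k * t ^+ k.
transitivity (sint (fun z => \sum_(j < N.+1) \sum_(k < N.+1)
    (poisson_factor x * poisson_factor y * (A j * B k)) * (dotv x z ^+ j * dotv y z ^+ k))).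
  apply: eq_sint => z _; rewrite /poisson_sum mulrACA /binom_sum big_distrlr/= mulr_sumr.
  apply: eq_bigr => j _; rewrite mulr_sumr; apply: eq_bigr => k _.
  by rewrite /A /B (exprMn j (poisson_scale x)) (exprMn k (poisson_scale y)) -/s -/t; ring.
have cxy j k : scont (fun z => dotv x z ^+ j * dotv y z ^+ k).
  by apply: scontM; apply: scontX; exact: scont_dotv.
have cc (c : R) j k : scont (fun z => c * (dotv x z ^+ j * dotv y z ^+ k)).
  by apply: scontM => //; exact: scont_cst.
rewrite sint_sum// => [|j _]; last exact: scont_sum.
transitivity (poisson_factor x * poisson_factor y *
    \sum_(0 <= j < N.+1) \sum_(0 <= k < N.+1) A j * B k * moment x y j k).
  rewrite big_mkord mulr_sumr; apply: eq_bigr => j _; rewrite sint_sum//.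
  by rewrite big_mkord mulr_sumr; apply: eq_bigr => k _; rewrite sintZl// -mulrA.
congr (_ * _).
have n1 : (1 < n)%N by exact: ltn_trans n2.
pose P j : R := pochhammer a j * s ^+ j; pose Q k : R := pochhammer a k * t ^+ k.
pose u := dotv x x / 4; pose v := dotv x y / 2; pose w := dotv y y / 4.
transitivity (\sum_(0 <= j < N.+1) \sum_(0 <= k < N.+1)
    box_sum N.+1 (fun p q l => (P j * ((2 * p + q == j)%N)%:R) * ((Q k * ((2 * l + q == k)%N)%:R)
      * moment_term (n%:R / 2) u v w p q l))).
  apply: eq_big_nat => j /andP[_ jN]; apply: eq_big_nat => k /andP[_ kN].
  rewrite (momentE n0 _ _ n1 jN kN) /moment_sum mulrA -box_sumZ; apply: eq_box_sum => p q l.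
  rewrite /degree_is -mulnb natrM /A /B /binom_coef -/a /P /Q -/u -/v -/w.
  have := fact_neq0 j; have := fact_neq0 k => /(_ R) k0 /(_ R) j0.
  by field; rewrite k0 j0.
under eq_bigr do rewrite sum_box_sum.
rewrite sum_box_sum /degree_sum; apply: eq_box_sum => p q l.
under eq_bigr do rewrite -mulr_sumr -mulr_suml sum_eqb.
rewrite -mulr_suml sum_eqb /P /Q -mulnb natrM /X9_term /moment_term.
exact: X9_term_split.
Qed.

Lemma poisson_sum_cvg x y : unit_ball x -> unit_ball y ->
  sint (fun z => poisson_sum x N z * poisson_sum y N z) @[N --> \oo] --> szego x y.
Proof.
move=> xB yB; have [d [d0 hd]] := poisson_sum_cvg_uniform xB.
have [d' [d'0 hd']] := poisson_sum_cvg_uniform yB.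
have cx := scont_poisson_l xB; have cy := scont_poisson_l yB.
have [M hM] := scont_bounded cx; have [M' hM'] := scont_bounded cy.
apply/cvgrPdist_le => eps eps0.
have : d N * (M' + d' N) + M * d' N @[N --> \oo] --> 0 * (M' + 0) + M * 0.
  by apply: cvgD; apply: cvgM => //; [apply: cvgD => //|]; exact: cvg_cst.
rewrite mul0r mulr0 addr0 => /cvgrPdist_le/(_ eps eps0).
apply: filterS => N; rewrite sub0r normrN => hN; rewrite distrC.
have cs x1 : scont (poisson_sum x1 N) by exact: scont_poisson_sum.
rewrite /szego -sintB//; [|exact: scontM|exact: scontM].
apply: le_trans (le_trans (ler_norm _) hN).
apply: norm_sint_le => //; first by apply: scontB; exact: scontM.
move=> z Sz; have h1 := hd N z Sz; have h2 := hd' N z Sz.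
set S := poisson_sum x N z in h1 *; set T := poisson_sum y N z in h2 *.
have -> : S * T - poisson z x * poisson z y =
    (S - poisson z x) * T + poisson z x * (T - poisson z y) by ring.
apply: le_trans (ler_normD _ _) _; rewrite (normrM (S - _)) (normrM (poisson z x)); apply: lerD; apply: ler_pM => //; last exact: hM.
have -> : T = poisson z y + (T - poisson z y) by ring.
by apply: le_trans (ler_normD _ _) _; apply: lerD => //; exact: hM'.
Qed.

Lemma X9_degree_sum_cvg x y : unit_ball x -> unit_ball y ->
  degree_sum N (X9_term (n - 1)%:R (n - 1)%:R (n%:R / 2)
      ((enorm x / (1 + enorm x ^+ 2)) ^+ 2)
      (2 * dotv x y / ((1 + enorm x ^+ 2) * (1 + enorm y ^+ 2)))
      ((enorm y / (1 + enorm y ^+ 2)) ^+ 2)) @[N --> \oo]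
    --> szego x y / (poisson_factor x * poisson_factor y).
Proof.
move=> xB yB.
have pos z : 0 < 1 + dotv z z by rewrite ltr_wpDr// dotv_ge0.
have f0 := lt0r_neq0 (mulr_gt0 (poisson_factor_gt0 xB) (poisson_factor_gt0 yB)).
have e1 z : (enorm z / (1 + enorm z ^+ 2)) ^+ 2 = poisson_scale z ^+ 2 * (dotv z z / 4).
  rewrite /poisson_scale exprMn sqr_enorm; field; exact: lt0r_neq0.
have e2 : 2 * dotv x y / ((1 + enorm x ^+ 2) * (1 + enorm y ^+ 2)) =
    poisson_scale x * poisson_scale y * (dotv x y / 2).
  by rewrite /poisson_scale !sqr_enorm; field; rewrite !lt0r_neq0.
(* The truncation of order [N] contains the degrees below N + 1, hence the shift of the index. *)
rewrite !e1 e2 -cvg_shiftS/=.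
have h : sint (fun z => poisson_sum x N z * poisson_sum y N z)
    * (poisson_factor x * poisson_factor y)^-1 @[N --> \oo]
    --> szego x y / (poisson_factor x * poisson_factor y).
  by apply: cvgM; [exact: poisson_sum_cvg|exact: cvg_cst].
apply: cvg_trans h; apply: near_eq_cvg; apply: nearW => N /=.
by rewrite sint_poisson_sum mulrAC divff// mul1r.
Qed.

(* The series for parallel vectors of the same norms as x and y dominates. *)
Lemma X9_szego x y : unit_ball x -> unit_ball y ->
  let X := (enorm x / (1 + enorm x ^+ 2)) ^+ 2 in
  let Y := 2 * dotv x y / ((1 + enorm x ^+ 2) * (1 + enorm y ^+ 2)) in
  let Z := (enorm y / (1 + enorm y ^+ 2)) ^+ 2 in
  X9_convergent (n - 1)%:R (n - 1)%:R (n%:R / 2) X Y Z /\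
  exton_X9 (n - 1)%:R (n - 1)%:R (n%:R / 2) X Y Z =
    szego x y / (poisson_factor x * poisson_factor y).
Proof.
move=> xB yB X Y Z.
pose e0 : 'rV[R]_n := delta_mx ord0 (Ordinal n0).
have e01 : dotv e0 e0 = 1 by rewrite dotv_delta mxE !eqxx.
have Se0 : enorm e0 = 1 by apply/unit_sphereE.
have par z : enorm (enorm z *: e0) = enorm z.
  by rewrite enormZ Se0 mulr1 ger0_norm// enorm_ge0.
have parB z : unit_ball z -> unit_ball (enorm z *: e0) by rewrite /unit_ball/= par.
have := X9_degree_sum_cvg (parB x xB) (parB y yB).
rewrite !par dotvZl dotvZr e01 mulr1; set Y' := 2 * _ / _ => dom.
(* Cauchy-Schwarz, attained by parallel vectors; X and Z depend on the norms only and are unchanged.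
   Convergence of the dominating series is [dom], the same expansion at the parallel pair. *)
have YY' : `|Y| <= Y'.
  rewrite /Y /Y' normrM [X in _ * X]ger0_norm; last first.
    by rewrite invr_ge0 mulr_ge0// addr_ge0// sqr_ge0.
  apply: ler_wpM2r; first by rewrite invr_ge0 mulr_ge0// addr_ge0// sqr_ge0.
  by rewrite normrM ger0_norm//; apply: ler_wpM2l => //; exact: dotv_le.
have n2R : 0 < n%:R / 2 :> R by rewrite divr_gt0 ?ltr0n.
have bound p q l : `|X9_term (n - 1)%:R (n - 1)%:R (n%:R / 2) X Y Z p q l| <=
    X9_term (n - 1)%:R (n - 1)%:R (n%:R / 2) X Y' Z p q l.
  rewrite /X9_term; set C := (_ * _ / _).
  have C0 : 0 <= C.
    rewrite /C divr_ge0 ?mulr_ge0 ?pochhammer_ge0// ?ltW//.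
  have X0 : 0 <= X ^+ p by rewrite exprn_ge0// sqr_ge0.
  have Z0 : 0 <= Z ^+ l by rewrite exprn_ge0// sqr_ge0.
  rewrite 3!normrM (ger0_norm C0) (ger0_norm X0) (ger0_norm Z0) normrX.
  apply: ler_wpM2r => //; apply: ler_wpM2l; first exact: mulr_ge0.
  by apply: lerXn2r; rewrite ?nnegrE//; exact: le_trans YY'.
have [it sm] := dominated_iterated_sum bound (X9_degree_sum_cvg xB yB) dom.
split; first exact: sm.
exact: iterated_sum_lim it.
Qed.

End expansion.

Theorem corollary3p2 (R : realType) (n : nat) (hn : (2 < n)%N)
  (K : 'rV[R]_n -> 'rV[R]_n -> R) (hK : is_szego_kernel K)
  (x y : 'rV[R]_n) (hx : unit_ball x) (hy : unit_ball y) :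
  let X := (enorm x / (1 + enorm x ^+ 2)) ^+ 2 in
  let Y := 2 * dotv x y / ((1 + enorm x ^+ 2) * (1 + enorm y ^+ 2)) in
  let Z := (enorm y / (1 + enorm y ^+ 2)) ^+ 2 in
  X9_convergent (n%:R - 1) (n%:R - 1) (n%:R / 2) X Y Z /\
  K x y =
    (1 - enorm x ^+ 2) ^+ (n - 1) * (1 - enorm y ^+ 2) ^+ (n - 1)
      / ((1 + enorm x ^+ 2) ^+ (n - 1) * (1 + enorm y ^+ 2) ^+ (n - 1))
    * exton_X9 (n%:R - 1) (n%:R - 1) (n%:R / 2) X Y Z.
Proof.
move=> X Y Z; have e1 : n%:R - 1 = (n - 1)%:R :> R by rewrite natrB// ltnW// ltnW.
rewrite e1 (szego_unique hn hK hx hy); have [cv ->] := X9_szego hn hx hy; split => //.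
have fE (z : 'rV[R]_n) : (1 - enorm z ^+ 2) ^+ (n - 1) / (1 + enorm z ^+ 2) ^+ (n - 1) = poisson_factor z.
  by rewrite /poisson_factor !sqr_enorm expr_div_n.
have -> : (1 - enorm x ^+ 2) ^+ (n - 1) * (1 - enorm y ^+ 2) ^+ (n - 1)
    / ((1 + enorm x ^+ 2) ^+ (n - 1) * (1 + enorm y ^+ 2) ^+ (n - 1))
    = poisson_factor x * poisson_factor y.
  by rewrite [X in _ * X]invfM mulrACA !fE.
rewrite mulrC divfK//.
by rewrite lt0r_neq0// mulr_gt0// poisson_factor_gt0.
Qed.
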